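(* Let $n$ be a prime number greater than $3$ such that $n+1$ is divisible by $4$, and let $M^n=\mathbb{R}^n/\Gamma\in\mathcal{F}_{CHD}$ be an $n$-dimensional flat manifold of the family described in the context, with a fixed spin structure (either of the two spin structures $\alpha_+$, $\alpha_-$ of $M^n$). Then the eta invariant of the Dirac operator of $M^n$ is an integer: $\eta_{M^n}(0)\in\mathbb{Z}$.
   Context: The family $\mathcal{F}_{CHD}$. Let $k\ge 0$ be an integer and $n=2k+1$. Let $a_1,\dots,a_n$ be a basis of $\mathbb{R}^n$ and let $A:\mathbb{R}^n\to\mathbb{R}^n$ be the linear map with $A(a_j)=a_{j+1}$ for $j<n-1$, $A(a_{n-1})=-a_1-\dots-a_{n-1}$, $A(a_n)=a_n$. Let $g(x)=A(x)+\frac1n a_n$ and let $\Gamma=\langle a_1,\dots,a_{n-1},g\rangle$ (the $a_j$ acting as translations). Equip $\mathbb{R}^n$ with an $A$-invariant scalar product for which there is an orthonormal basis $e_1,\dots,e_n$ with $e_1,\dots,e_{n-1}\in\mathrm{Span}[a_1,\dots,a_{n-1}]$, $e_n=a_n$ (in particular $a_n$ has norm 1), and, for $1\le j\le k$, $A(e_{2j-1})=\cos(2\pi j/n)e_{2j-1}+\sin(2\pi j/n)e_{2j}$ and $A(e_{2j})=-\sin(2\pi j/n)e_{2j-1}+\cos(2\pi j/n)e_{2j}$. An $n$-dimensional manifold $M\in\mathcal{F}_{CHD}$ is the closed flat manifold $M=\mathbb{R}^n/\Gamma$ with the induced metric. Spin structures. The Clifford algebra has $e_i^2=-1$ and $e_ie_j=-e_je_i$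 for $i\ne j$; $\lambda:Spin(n)\to SO(n)$ is $\lambda(y)(x)=yxy^*$, where $(e_{j_1}\cdots e_{j_s})^*=e_{j_s}\cdots e_{j_1}$. Let $\beta=\pi/n$, $r_j=\cos(j\beta)+e_{2j-1}e_{2j}\sin(j\beta)$, $\alpha=r_1\cdots r_k$. Then $\lambda(\alpha)=A$. Put $\alpha_+=(-1)^{k(k+1)/2}\alpha$ and $\alpha_-=-\alpha_+$; these satisfy $\alpha_+^n=1$, $\alpha_-^n=-1$. The spin structure denoted $\alpha_\pm$ is given by the homomorphism $\widehat h:\Gamma\to Spin(n)$ with $\widehat h(a_j)=1$ for $j\le n-1$ and $\widehat h(g)=\alpha_\pm$, which lifts the holonomy homomorphism (linear part). These are the two spin structures of $M$. Spinors. Let $g_1=\begin{pmatrix} i&0\\0&-i\end{pmatrix}$, $g_2=\begin{pmatrix}0&i\\ i&0\end{pmatrix}$, $T=\begin{pmatrix}0&-i\\ i&0\end{pmatrix}$, and let $\Sigma_{2k}=(\mathbb{C}^2)^{\otimes k}$. The Clifford action on $\Sigma_{2k}$ is: for $j\le n-1$, $e_j$ acts as $I\otimes\cdots\otimes I\otimes g_{\alpha(j)}\otimes T\otimes\cdots\otimes T$ with $[\frac{j-1}{2}]$ factors $T$, where $\alpha(j)=1$ for $j$ odd and $\alpha(j)=2$ for $j$ even; $e_n$ acts as $i\,T\otimes\cdots\otimes T$. Spinors on $M$ are the smooth maps $\phi:\mathbb{R}^n\to\Sigma_{2k}$ invariant under the $\Gamma$-action $(\gamma\phi)(x)=\widehat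 h(\gamma)\phi(\gamma^{-1}x)$, and the Dirac operator is $D\phi=\sum_{j=1}^n e_j\frac{\partial\phi}{\partial x_j}$, with $x_1,\dots,x_n$ the coordinates determined by $e_1,\dots,e_n$. Eta invariant. $\eta_M(z)$ is the meromorphic extension to $\mathbb{C}$ of $\sum_{\lambda\ne0}\mathrm{sgn}(\lambda)|\lambda|^{-z}$ ($\mathrm{Re}\,z$ large), the sum being over nonzero eigenvalues of $D$ counted with multiplicity; it is regular at $0$, and the eta invariant is $\eta_M(0)$. *)

(* Defs.v *)
From HB Require Import structures.
From mathcomp Require Import all_boot all_order all_algebra finmap complex.
From mathcomp Require Import all_classical all_reals all_analysis.
From mathcomp.analysis.showcase Require summability.

Set Implicit Arguments.
Unset Strict Implicit.
Unset Printing Implicit Defensive.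

Import Order.TTheory GRing.Theory Num.Theory numFieldNormedType.Exports.

Local Open Scope complex_scope.
Local Open Scope ring_scope.

(* x is a vector of coefficients in the basis e_S = e_{i_1} ... e_{i_s},
   S = {i_1 < ... < i_s}, of the real Clifford algebra with e_i^2 = -1. *)
Definition clifford (R : comNzRingType) (n : nat) := {ffun {set 'I_n} -> R^o}.

HB.instance Definition _ (R : comNzRingType) n :=
  GRing.Lmodule.copy (clifford R n) {ffun {set 'I_n} -> R^o}.

Section Clifford.
Variables (R : comNzRingType) (n : nat).
Implicit Types (S T U : {set 'I_n}) (x y z : clifford R n).

Definition symdiff S T := (S :\: T) :|: (T :\: S).

(* e_S e_T = (-1)^N e_(S symdiff T), where N counts the pairs i in S, j in T
   with j <= i: one sign for each swap (j < i) and for each square (j = i). *)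
Definition clif_swaps S T : nat := (\sum_(i in S) \sum_(j in T) (j <= i)%N)%N.

Definition clif_mul x y : clifford R n :=
  [ffun U => \sum_S (-1) ^+ clif_swaps S (symdiff S U) * x S * y (symdiff S U)].

Definition clif_basis S : clifford R n := [ffun T => (T == S)%:R].

Definition clif_gen (i : 'I_n) : clifford R n := clif_basis [set i].

Lemma in_symdiff i S T : (i \in symdiff S T) = (i \in S) (+) (i \in T).
Proof. by rewrite !inE; case: (i \in S); case: (i \in T). Qed.

Lemma symdiffA S T U : symdiff S (symdiff T U) = symdiff (symdiff S T) U.
Proof. by apply/setP => i; rewrite !in_symdiff addbA. Qed.

Lemma symdiffC S T : symdiff S T = symdiff T S.
Proof. by apply/setP => i; rewrite !in_symdiff addbC. Qed.

Lemma symdiffK S T : symdiff S (symdiff S T) = T.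
Proof. by apply/setP => i; rewrite !in_symdiff addKb. Qed.

Lemma symdiff0 S : symdiff S finset.set0 = S.
Proof. by apply/setP => i; rewrite !in_symdiff inE addbF. Qed.

Lemma odd_sum_symdiff S T (F : 'I_n -> nat) :
  odd (\sum_(i in symdiff S T) F i) =
  odd (\sum_(i in S) F i) (+) odd (\sum_(i in T) F i).
Proof.
rewrite -oddD big_mkcond [in RHS]big_mkcond [X in (_ + X)%N]big_mkcond /=.
rewrite -big_split /=; elim/big_rec2: _ => // i p q _ e.
rewrite !oddD e; congr (_ (+) _).
by rewrite in_symdiff; case: (i \in S); case: (i \in T) => //=;
   rewrite ?addbb ?addbF.
Qed.

Lemma clif_swaps_symdiffl S T U :
  odd (clif_swaps (symdiff S T) U) = odd (clif_swaps S U) (+) odd (clif_swaps T U).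
Proof. exact: odd_sum_symdiff. Qed.

Lemma clif_swaps_symdiffr S T U :
  odd (clif_swaps S (symdiff T U)) = odd (clif_swaps S T) (+) odd (clif_swaps S U).
Proof.
have E X : clif_swaps S X = (\sum_(j in X) \sum_(i in S) (j <= i)%N)%N.
  exact: exchange_big.
by rewrite !E odd_sum_symdiff.
Qed.

Lemma clif_swaps0l S : clif_swaps finset.set0 S = 0.
Proof. by rewrite /clif_swaps big1 // => i; rewrite inE. Qed.

Lemma clif_swaps0r S : clif_swaps S finset.set0 = 0.
Proof. by rewrite /clif_swaps big1 // => i _; rewrite big1 // => j; rewrite inE. Qed.

Lemma symdiff_bij S : bijective (symdiff S).
Proof. by exists (symdiff S); exact: symdiffK. Qed.

Lemma clif_cocycle S T U :
  (-1) ^+ clif_swaps S (symdiff T U) * (-1) ^+ clif_swaps T U =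
  (-1) ^+ clif_swaps (symdiff S T) U * (-1) ^+ clif_swaps S T :> R.
Proof.
rewrite -!exprD -[LHS]signr_odd -[RHS]signr_odd !oddD.
rewrite clif_swaps_symdiffl clif_swaps_symdiffr; congr (_ ^+ nat_of_bool _).
by rewrite -addbA addbC.
Qed.

Lemma clif_mulA : associative clif_mul.
Proof.
move=> x y z; apply/ffunP => U; rewrite !ffunE.
under eq_bigr do rewrite ffunE big_distrr /=.
under [RHS]eq_bigr do rewrite ffunE big_distrr big_distrl /=.
rewrite [RHS]exchange_big /=; apply: eq_bigr => S _.
rewrite [RHS](reindex (symdiff S)) /=; last exact/onW_bij/symdiff_bij.
apply: eq_bigr => T _; rewrite symdiffK -symdiffA.
set V := symdiff T (symdiff S U); have -> : symdiff S U = symdiff T V.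
  by rewrite /V symdiffK.
have -> : symdiff S (symdiff T U) = V.
  by rewrite /V !symdiffA (symdiffC S).
by rewrite -[_ * y T * _]mulrA mulrACA clif_cocycle !mulrA.
Qed.

Lemma clif_mul1l : left_id (clif_basis finset.set0) clif_mul.
Proof.
move=> x; apply/ffunP => U; rewrite ffunE (bigD1 finset.set0) //= big1.
  by rewrite addr0 ffunE eqxx clif_swaps0l symdiffC symdiff0 !mul1r.
by move=> S nS; rewrite ffunE (negPf nS) mulr0 mul0r.
Qed.

Lemma clif_mul1r : right_id (clif_basis finset.set0) clif_mul.
Proof.
have symdiffv S : symdiff S S = finset.set0.
  by apply/setP => i; rewrite in_symdiff addbb inE.
move=> x; apply/ffunP => U; rewrite ffunE (bigD1 U) //= big1.
  by rewrite addr0 ffunE symdiffv eqxx clif_swaps0r mul1r mulr1.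
move=> S nS; rewrite ffunE; case: eqP => [e|]; last by rewrite mulr0.
by move: nS; rewrite -(symdiffK S U) e symdiff0 eqxx.
Qed.

Lemma clif_mulDl : left_distributive clif_mul +%R.
Proof.
move=> x y z; apply/ffunP => U; rewrite !ffunE -big_split /=.
by apply: eq_bigr => S _; rewrite ffunE mulrDr mulrDl.
Qed.

Lemma clif_mulDr : right_distributive clif_mul +%R.
Proof.
move=> x y z; apply/ffunP => U; rewrite !ffunE -big_split /=.
by apply: eq_bigr => S _; rewrite ffunE mulrDr.
Qed.

Lemma clif_1neq0 : clif_basis finset.set0 != 0.
Proof.
by apply/eqP => /ffunP/(_ finset.set0)/eqP; rewrite !ffunE eqxx oner_eq0.
Qed.

HB.instance Definition _ := GRing.Zmodule_isNzRing.Build (clifford R n)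
  clif_mulA clif_mul1l clif_mul1r clif_mulDl clif_mulDr clif_1neq0.

Lemma clif_scaleAl (c : R) x y : c *: (x * y) = (c *: x) * y.
Proof.
have regE (a : R) (b : R^o) : a *: b = a * b by [].
apply/ffunP => U; rewrite !ffunE regE big_distrr /=; apply: eq_bigr => S _.
by rewrite ffunE regE !mulrA [c * _]mulrC.
Qed.

HB.instance Definition _ :=
  GRing.Lmodule_isLalgebra.Build R (clifford R n) clif_scaleAl.

(* the linear map with (e_{i_1} ... e_{i_s})^* = e_{i_s} ... e_{i_1} *)
Definition clif_rev x : clifford R n :=
  \sum_S x S *: \prod_(i <- rev (enum S)) clif_gen i.

Lemma clif_genE i j :
  clif_gen i * clif_gen j =
  (-1) ^+ (j <= i)%N *: clif_basis (symdiff [set i] [set j]).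
Proof.
apply/ffunP => U; rewrite [LHS]ffunE (bigD1 [set i]) //= big1 => [|S nS].
  rewrite !ffunE eqxx addr0 mulr1; case: eqP => [e|ne].
    by rewrite e /clif_swaps !big_set1 -e symdiffK eqxx.
  case: eqP => [e|]; last by rewrite mulr0 scaler0.
  by case: ne; rewrite e symdiffK.
by rewrite !ffunE (negPf nS) mulr0 mul0r.
Qed.

Lemma clif_gen_sqr i : clif_gen i * clif_gen i = - 1.
Proof.
rewrite clif_genE leqnn scaleN1r; congr (- clif_basis _).
by apply/setP => j; rewrite in_symdiff addbb inE.
Qed.

Lemma clif_gen_anticomm i j : i != j ->
  clif_gen i * clif_gen j = - (clif_gen j * clif_gen i).
Proof.
move=> ij; rewrite !clif_genE symdiffC -scaleNr; congr (_ *: _).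
have := ij; rewrite -val_eqE /= neq_ltn => /orP[] lt_;
by rewrite (leqNgt j i) (leqNgt i j) lt_ ltnNge (ltnW lt_) /= ?opprK.
Qed.

End Clifford.

Local Open Scope classical_set_scope.
Local Open Scope ring_scope.

Section Spin.
Variables (R : realType) (n : nat).

(* the inclusion of R^n in its Clifford algebra, in orthonormal coordinates *)
Definition clif_vec (u : 'rV[R]_n) : clifford R n :=
  \sum_i u 0 i *: clif_gen R i.

(* Spin(n): products of an even number of unit vectors *)
Definition spin : set (clifford R n) :=
  [set y | exists us : seq 'rV[R]_n,
    [/\ ~~ odd (size us),
        forall u, u \in us -> \sum_i u 0 i ^+ 2 = 1 &
        y = \prod_(u <- us) clif_vec u]].

End Spin.

Section Geometry.
Variables (R : realType) (k : nat).
Local Notation n := k.*2.+1.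
Local Notation V := 'rV[R]_n.

(* The data defining a member of the family F_CHD in dimension n = 2k+1: the
   basis a_1, ..., a_n, the map A, the A-invariant scalar product and the
   orthonormal basis e_1, ..., e_n.  Indices are 0-based: chd_a i is a_(i+1),
   so that a_n is chd_a ord_max, and similarly for chd_e. *)
Record FCHD := {
  chd_a : 'I_n -> V;
  chd_A : {linear V -> V};
  chd_dot : {dot V for idfun};
  chd_e : 'I_n -> V;
  chd_a_basis : basis_of fullv [seq chd_a i | i : 'I_n];
  chd_A_next : forall i j : 'I_n, (i.+1 < k.*2)%N -> j = i.+1 :> nat ->
    chd_A (chd_a i) = chd_a j;
  chd_A_wrap : forall i : 'I_n, i.+1 = k.*2 ->
    chd_A (chd_a i) = - \sum_(j < n | (j < k.*2)%N) chd_a j;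
  chd_A_last : chd_A (chd_a ord_max) = chd_a ord_max;
  chd_dot_inv : forall x y : V,
    chd_dot (chd_A x) (chd_A y) = chd_dot x y;
  chd_e_orthonormal : orthonormal chd_dot [seq chd_e i | i : 'I_n];
  chd_e_span : forall i : 'I_n, (i < k.*2)%N ->
    chd_e i \in <<[seq chd_a j | j : 'I_n <- enum 'I_n & (j < k.*2)%N]>>%VS;
  chd_e_last : chd_e ord_max = chd_a ord_max;
  chd_A_rot1 : forall j : 'I_k, let t := 2 * pi * j.+1%:R / n%:R in
    chd_A (chd_e (inord j.*2)) =
    cos t *: chd_e (inord j.*2) + sin t *: chd_e (inord j.*2.+1);
  chd_A_rot2 : forall j : 'I_k, let t := 2 * pi * j.+1%:R / n%:R in
    chd_A (chd_e (inord j.*2.+1)) =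
    - sin t *: chd_e (inord j.*2) + cos t *: chd_e (inord j.*2.+1)
}.

Variable M : FCHD.

Definition chd_tr (j : 'I_n) : V -> V := fun x => x + chd_a M j.

Definition chd_g : V -> V :=
  fun x => chd_A M x + (n%:R)^-1 *: chd_a M ord_max.

(* Gamma, as a group of transformations of R^n *)
Inductive chd_group : (V -> V) -> Prop :=
| chd_group_id : chd_group id
| chd_group_tr (j : 'I_n) : (j < k.*2)%N -> chd_group (chd_tr j)
| chd_group_g : chd_group chd_g
| chd_group_comp u v : chd_group u -> chd_group v -> chd_group (u \o v)
| chd_group_inv u v : chd_group u -> cancel u v -> cancel v u -> chd_group v.

(* coordinates x_1, ..., x_n with respect to e_1, ..., e_n *)
Definition chd_coord (x : V) : V := \row_i chd_dot M x (chd_e M i).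

(* r_(j+1) = cos ((j+1) beta) + e_(2j+1) e_(2j+2) sin ((j+1) beta) *)
Definition chd_r (j : 'I_k) : clifford R n :=
  let b : R := j.+1%:R * (pi / n%:R) in
  (cos b)%:A + sin b *: (clif_gen R (inord j.*2) * clif_gen R (inord j.*2.+1)).

Definition chd_alpha : clifford R n := \prod_(j < k) chd_r j.

(* alpha_+ for s = true, alpha_- for s = false *)
Definition chd_alpha_pm (s : bool) : clifford R n :=
  let ap : clifford R n := (-1) ^+ ((k * k.+1)./2) * chd_alpha in
  if s then ap else - ap.

(* h : Gamma -> Spin(n) is the spin structure alpha_+ or alpha_- (only the
   values of h on Gamma matter).  The linear part of u is x |-> u x - u 0. *)
Record spin_structure (s : bool) (h : (V -> V) -> clifford R n) : Prop := {
  spin_str_spin : forall u, chd_group u -> spin (h u);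
  spin_str_morph : forall u v, chd_group u -> chd_group v ->
    h (u \o v) = h u * h v;
  spin_str_lift : forall u x, chd_group u ->
    h u * clif_vec (chd_coord x) * clif_rev (h u) =
    clif_vec (chd_coord (u x - u 0));
  spin_str_tr : forall j : 'I_n, (j < k.*2)%N -> h (chd_tr j) = 1;
  spin_str_g : h chd_g = chd_alpha_pm s
}.

End Geometry.

(* Sigma_2k, the k-fold tensor power of C^2, in coordinates with respect to
   the tensor products of the canonical basis vectors of C^2 *)
Definition Sigma (R : realType) (k : nat) :=
  {ffun {ffun 'I_k -> 'I_2} -> (R[i])^o}.

HB.instance Definition _ (R : realType) k :=
  GRing.Lmodule.copy (Sigma R k) {ffun {ffun 'I_k -> 'I_2} -> (R[i])^o}.

Section Spinors.
Variables (R : realType) (k : nat).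
Local Notation n := k.*2.+1.
Local Notation V := 'rV[R]_n.
Local Notation C := R[i].
Local Notation Sigma := (Sigma R k).

Definition mx2 (p q r s : C) : 'M[C]_2 :=
  \matrix_(i, j) if i == 0 then (if j == 0 then p else q)
                 else (if j == 0 then r else s).

Definition mg1 : 'M[C]_2 := mx2 'i%C 0 0 (- 'i%C).
Definition mg2 : 'M[C]_2 := mx2 0 'i%C 'i%C 0.
Definition mT : 'M[C]_2 := mx2 0 (- 'i%C) 'i%C 0.

(* the action of N_1 (x) ... (x) N_k on Sigma_2k *)
Definition tensor_op (N : 'I_k -> 'M[C]_2) (v : Sigma) : Sigma :=
  [ffun s : {ffun 'I_k -> 'I_2} =>
     \sum_(t : {ffun 'I_k -> 'I_2}) (\prod_(l < k) N l (s l) (t l)) * v t].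

(* For e_i, i < n - 1 (0-based), the last i./2 factors are T and the factor
   just before them is g_1 (i even) or g_2 (i odd). *)
Definition gamma_factor (i : nat) (l : 'I_k) : 'M[C]_2 :=
  if (k <= l + i./2)%N then mT
  else if (l + i./2).+1 == k then (if odd i then mg2 else mg1)
  else 1%:M.

Definition gamma (i : 'I_n) (v : Sigma) : Sigma :=
  if (i < k.*2)%N then tensor_op (gamma_factor i) v
  else 'i%C *: tensor_op (fun=> mT) v.

Definition clif_act (y : clifford R n) (v : Sigma) : Sigma :=
  \sum_S (y S)%:C *: foldr gamma v (enum S).

Fixpoint Ck (m : nat) (f : V -> R) : Prop :=
  if m is m'.+1 then
    (forall x, differentiable f x) /\ forall v, Ck m' ('D_v f)
  else continuous f.

Definition smooth (phi : V -> Sigma) : Prop := forall s m,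
  Ck m (fun x => complex.Re (phi x s)) /\ Ck m (fun x => complex.Im (phi x s)).

Definition pderive (v : V) (phi : V -> Sigma) (x : V) : Sigma :=
  [ffun s => 'D_v (fun y => complex.Re (phi y s)) x
          +i* 'D_v (fun y => complex.Im (phi y s)) x].

Variables (M : FCHD R k) (h : (V -> V) -> clifford R n).

Definition dirac (phi : V -> Sigma) (x : V) : Sigma :=
  \sum_(j < n) gamma j (pderive (chd_e M j) phi x).

(* In the invariance condition v is the inverse of u. *)
Definition spinor_field (phi : V -> Sigma) : Prop :=
  smooth phi /\
  forall u v, chd_group M u -> cancel u v -> cancel v u ->
    forall x, clif_act (h u) (phi (v x)) = phi x.

Definition eigenspinor (lam : R) (phi : V -> Sigma) : Prop :=
  spinor_field phi /\ forall x, dirac phi x = lam%:C *: phi x.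

(* m is the complex dimension of the lam-eigenspace of the Dirac operator:
   there is a family b_0, ..., b_(m-1) of eigenspinors through which every
   eigenspinor is expressed by unique coefficients. *)
Definition eigen_mult (lam : R) (m : nat) : Prop :=
  exists2 b : 'I_m -> V -> Sigma,
    forall i, eigenspinor lam (b i) &
    forall phi, eigenspinor lam phi ->
      exists! c : 'rV[C]_m, forall x, phi x = \sum_i c 0 i *: b i x.

End Spinors.

Section Eta.
Variable R : realType.
Local Notation C := R[i].

Definition cexp (z : C) : C :=
  (expR (complex.Re z))%:C * (cos (complex.Im z) +i* sin (complex.Im z)).

(* t ^ z, for t > 0 *)
Definition cpow (t : R) (z : C) : C := cexp (z * (ln t)%:C).

(* C^o is C as a normed space over itself, so this is complex
   differentiability. *)
Definition holomorphic_near (f : C -> C) (p : C) : Prop :=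
  \forall z \near (p : C^o), derivable (f : C^o -> C^o) z 1.

(* the value of f at a pole is irrelevant *)
Definition meromorphic (f : C -> C) : Prop :=
  forall p : C, exists (m : nat) (g : C -> C),
    holomorphic_near g p /\
    \forall z \near (p : C^o)^', f z * (z - p) ^+ m = g z.

Variables (k : nat) (M : FCHD R k).
Local Notation V := 'rV[R]_k.*2.+1.
Variable h : (V -> V) -> clifford R k.*2.+1.

Definition eta_term (mult : R -> nat) (z : C) (lam : R) : C^o :=
  if lam == 0 then 0
  else (mult lam)%:R * (Num.sg lam)%:C * cpow `|lam| (- z).

(* For Re z large, f z is the unordered sum of sgn(lam) |lam|^(-z) over the
   nonzero eigenvalues lam with multiplicity (other real numbers have
   multiplicity 0 and contribute 0), and f is meromorphic on C. *)
Definition is_eta_function (f : C -> C) : Prop :=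
  exists mult : R -> nat,
    [/\ forall lam, lam != 0 -> eigen_mult M h lam (mult lam),
        exists r : R, forall z : C, r < complex.Re z ->
          summability.partial_sum (eta_term mult z) @ summability.totally
            --> (f z : C^o) &
        meromorphic f].

(* v is eta(0): the meromorphic extension exists and is regular at 0, with
   value v there (such a v is unique, by the identity theorem). *)
Definition is_eta_invariant (v : C) : Prop :=
  exists f : C -> C, [/\ is_eta_function f, holomorphic_near f 0 & f 0 = v].

End Eta.

(* Main.v *)
(* The components of an eigenspinor are lattice-periodic eigenfunctions of the Laplacian.  Bernstein's
   inequality (maximum principle for |grad f|^2 + 2 L f^2) and a discrete Fourier decomposition in each
   lattice direction show that such functions are finite combinations of characters, so that
   eigenspaces are found by linear algebra on finite-dimensional spaces of trigonometric spinors.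

   Write D = H + e_n d/dx_n with H the horizontal part.  The operator S = e_n H preserves equivariant
   spinors, anticommutes with D and is diagonalizable, hence exchanges the eigenspaces of lam and -lam
   outside its kernel.  The kernel consists of spinors that depend on the height x_n only; with the joint
   eigenvectors v_sg of the operators e_(2j-1) e_(2j), it contributes the eigenvalues pi l with l congruent
   modulo 2n to an integer p_sg, one for each choice of signs sg.

   So mult(pi l) - mult(- pi l) = chi(l) = sum_sg ([l = p_sg] - [l = - p_sg]) modulo 2n, and all other
   eigenvalues are symmetric.  Then eta(z) = pi^(-z) sum_l chi(l) l^(-z), where chi is periodic of mean
   zero; repeated summation by parts continues this series to an entire function whose value at 0 is
   - (1 / 2n) sum_(l = 1)^(2n) l chi(l).  This is an integer as soon as sum_sg p_sg = 0, which holds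
   for k > 1. *)

Require Import Defs.
From HB Require Import structures.
From mathcomp Require Import all_boot all_order all_algebra finmap complex zify ring lra.
From mathcomp Require Import all_classical all_reals all_analysis.
From mathcomp.analysis.showcase Require summability.

Set Implicit Arguments.
Unset Strict Implicit.
Unset Printing Implicit Defensive.

Import Order.TTheory GRing.Theory Num.Theory numFieldNormedType.Exports.

Local Open Scope classical_set_scope.
Local Open Scope complex_scope.
Local Open Scope ring_scope.

(** * Calculus on smooth periodic functions *)

(** The predicate [eigen_mult] demands that every eigenspinor be a unique combination of a finite
    family. Completeness of the characters is thus needed for each eigenspace separately, and
    Bernstein's inequality provides it without integration or convergence of Fourier series.

    Periodicity refers to the lattice spanned by a_1, ..., a_(n-1) and 2 a_n: the factor 2 absorbs
    alpha_-^n = -1, so that both spin structures are treated at once, and it explains the modulus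
    2n.

    The individual multiplicities are never computed. For lam^2 = L the operator S has the same rank
    on the eigenspaces of lam and - lam, so each multiplicity is this common rank plus the dimension
    of the kernel of S, and the rank cancels in eta.

    Integrality is a congruence. The sum of l [l = p] over l = 1, ..., 2n is congruent to p modulo
    2n, hence the first moment of chi is congruent to 2 sum_sg p_sg. Here p_sg is the product of all
    signs times an affine function of the signs; once k > 1 every monomial of it keeps some sign to
    an odd power and sums to zero. *)

Lemma MVT_everywhere (R : realType) (f df : R -> R) (a b : R) : a < b ->
  (forall t : R, is_derive t 1 f (df t)) ->
  exists2 c, a < c < b & f b - f a = df c * (b - a).
Proof.
move=> ab dfE; have cf : {within `[a, b], continuous f}.
  apply: continuous_subspaceT => t.
  by apply/differentiable_continuous/derivable1_diffP; have [] := dfE t.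
have [c + E] := MVT ab (fun t _ => dfE t) cf.
by rewrite in_itv /= => ?; exists c.
Qed.

(** At the maximum [g' 0 = 0]; a positive [g''] would make [g'] positive just to the right of 0, and
    the mean value theorem would lift [g] above [g 0]. *)
Lemma second_derivative_le0 (R : realType) (g g' : R -> R) (g'' : R) :
  (forall t : R, is_derive t 1 g (g' t)) -> is_derive (0 : R) 1 g' g'' ->
  (forall t, g t <= g 0) -> g'' <= 0.
Proof.
move=> dg dg' gmax; rewrite leNgt; apply/negP => g''_gt0.
have g'0 : g' 0 = 0.
  have h : is_derive (0 : R) 1 g 0.
    apply: (@derive1_at_max R g (-1) 1 0); rewrite ?in_itv /= ?ltrN10 ?ltr01 //.
  by have [_ <-] := dg 0; have [_ E] := h.
have [/derivable_nbhsx dv val] := dg'.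
have [/= e e0 small] : \forall h \near (0 : R), 0 < h -> 0 < g' h.
  have [cv lv] : derivable g' 0 1 /\ 'D_1 g' 0 = g'' by case: dg'.
  have : (fun h : R => h^-1 *: ((g' \o shift (0:R)) (h *: (1 : R)) - g' 0)) @ 0^' --> g''.
    by rewrite -lv; exact: cv.
  move=> /cvgrPdist_lt/(_ _ g''_gt0); rewrite near_withinE.
  apply: filterS => h hlt h0; have := hlt (lt0r_neq0 h0).
  rewrite /= g'0 subr0 addr0 /GRing.scale /= mulr1 ltr_distlC => /andP[+ _].
  by rewrite subrr pmulr_rgt0 // invr_gt0.
have e20 : 0 < e / 2 by rewrite divr_gt0.
have [c /andP[c0 ce] E] := MVT_everywhere e20 dg.
have : 0 < g' c.
  apply: small => //=; rewrite sub0r normrN gtr0_norm //.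
  by rewrite (lt_trans ce) // ltr_pdivrMr // ltr_pMr // ltr1n.
move=> gc; have := gmax (e / 2); rewrite -subr_le0 E subr0 => /le_lt_trans.
by move=> /(_ _ (mulr_gt0 gc e20)); rewrite ltxx.
Qed.

Section DeriveReal.
Variable R : realType.
Implicit Types (f g : R -> R) (t df dg : R).

Lemma is_derive_mulf f g t df dg : is_derive t 1 f df -> is_derive t 1 g dg ->
  is_derive t 1 (fun s => f s * g s) (f t * dg + g t * df).
Proof. by move=> ? ?; exact: (is_deriveM (f := f) (g := g)). Qed.

Lemma is_derive_addf f g t df dg : is_derive t 1 f df -> is_derive t 1 g dg ->
  is_derive t 1 (fun s => f s + g s) (df + dg).
Proof. by move=> ? ?; exact: (is_deriveD (f := f) (g := g)). Qed.

Lemma is_derive_scalef f t df (c : R) : is_derive t 1 f df ->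
  is_derive t 1 (fun s => c * f s) (c * df).
Proof. by move=> ?; exact: (is_deriveZ (f := f)). Qed.

Lemma is_derive_sumf m (h : 'I_m -> R -> R) t (dh : 'I_m -> R) :
  (forall i, is_derive t 1 (h i) (dh i)) ->
  is_derive t 1 (fun s => \sum_i h i s) (\sum_i dh i).
Proof.
move=> dhE; rewrite (_ : (fun s => _) = \sum_i h i).
  exact: is_derive_sum.
by apply/funext => s; rewrite fct_sumE.
Qed.

(** Second-derivative test with (u^2)'' = 2 (u'^2 + u u''). It will be applied along a line through
    a maximum, with [u i] the components of a gradient and [v] the function itself. *)
Lemma sum_squares_max m (u u' : 'I_m -> R -> R) (u'' : 'I_m -> R) (v v' : R -> R) (v'' c : R) :
  (forall i t, is_derive t 1 (u i) (u' i t)) ->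
  (forall i, is_derive (0 : R) 1 (u' i) (u'' i)) ->
  (forall t, is_derive t 1 v (v' t)) -> is_derive (0 : R) 1 v' v'' ->
  (forall t, \sum_i u i t ^+ 2 + c * v t ^+ 2 <= \sum_i u i 0 ^+ 2 + c * v 0 ^+ 2) ->
  \sum_i (u' i 0 ^+ 2 + u i 0 * u'' i) + c * (v' 0 ^+ 2 + v 0 * v'') <= 0.
Proof.
move=> du du' dv dv' mx.
have : \sum_i 2 * (u' i 0 ^+ 2 + u i 0 * u'' i) + c * (2 * (v' 0 ^+ 2 + v 0 * v'')) <= 0.
  apply: (@second_derivative_le0 R (fun t => \sum_i u i t ^+ 2 + c * v t ^+ 2)
     (fun t => \sum_i 2 * (u i t * u' i t) + c * (2 * (v t * v' t)))) => //.
  - move=> t; apply: is_derive_addf.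
      apply: is_derive_sumf => i; apply: is_derive_eq (is_derive_mulf (du i t) (du i t)) _; ring.
    apply: is_derive_scalef; apply: is_derive_eq (is_derive_mulf (dv t) (dv t)) _; ring.
  - apply: is_derive_addf.
      apply: is_derive_sumf => i; apply: is_derive_scalef.
      apply: is_derive_eq (is_derive_mulf (du i 0) (du' i)) _; ring.
    do 2 apply: is_derive_scalef.
    apply: is_derive_eq (is_derive_mulf (dv 0) dv') _; ring.
by rewrite -mulr_sumr mulrCA -mulrDr pmulr_rle0.
Qed.

(** Here [D] is the gradient of f at the maximum, [H] its Hessian, [T j i] the product of d_i f with
    d_j d_j d_i f, [S j] the second derivatives and [y] the value. Summed over [j], the hypotheses
    give |H|^2 - L |D|^2 + 2 L |D|^2 - 2 L^2 y^2 <= 0, and |H|^2 is dropped. *)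
Lemma bernstein_algebra m (H T : 'I_m -> 'I_m -> R) (D S : 'I_m -> R) (y L : R) : 0 < L ->
  (forall j, \sum_i (H j i ^+ 2 + T j i) + 2 * L * (D j ^+ 2 + y * S j) <= 0) ->
  (forall i, \sum_j T j i = - L * D i ^+ 2) -> \sum_j S j = - L * y ->
  \sum_i D i ^+ 2 <= 2 * L * y ^+ 2.
Proof.
move=> L0 le0 sT sS.
have : \sum_j (\sum_i (H j i ^+ 2 + T j i) + 2 * L * (D j ^+ 2 + y * S j)) <= 0.
  by apply: sumr_le0 => j _.
rewrite big_split /= -mulr_sumr big_split /= -mulr_sumr sS exchange_big /=.
under eq_bigr do rewrite big_split /= sT.
rewrite big_split /= -mulr_sumr.
have : 0 <= \sum_i \sum_j H j i ^+ 2.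
  by apply: sumr_ge0 => j _; apply: sumr_ge0 => i _; exact: sqr_ge0.
move: (\sum_i \sum_j _ ^+ 2) (\sum_i _ ^+ 2) => h G h0 hle.
by rewrite -(ler_pM2l L0); lra.
Qed.

End DeriveReal.

Section Smooth.
Variables (R : realType) (k : nat).
Local Notation n := k.*2.+1.
Local Notation V := 'rV[R]_n.
Implicit Types (f g : V -> R) (x v w : V).

Definition smf f := forall m, Ck m f.

Lemma smf_diff f x : smf f -> differentiable f x.
Proof. by move=> /(_ 1%N)[]. Qed.

Lemma smf_derivable f x v : smf f -> derivable f x v.
Proof. by move=> /smf_diff d; exact: diff_derivable. Qed.
Hint Resolve smf_derivable : core.

Lemma smf_cont f : smf f -> continuous f.
Proof. by move=> /(_ 0%N). Qed.

Lemma smf_D f v : smf f -> smf ('D_v f).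
Proof. by move=> sf m; have [_] := sf m.+1; apply. Qed.

Lemma Ck_add m f g : Ck m f -> Ck m g -> Ck m (f + g).
Proof.
elim: m f g => [|m IH] f g /=; first by move=> cf cg x; exact: (continuousD (cf x) (cg x)).
move=> [df cf] [dg cg]; split=> [x|v]; first exact: differentiableD.
have -> : 'D_v (f + g) = 'D_v f + 'D_v g.
  by apply/funext => x; rewrite deriveD //; exact: diff_derivable.
exact: IH.
Qed.

Lemma Ck_scale m c f : Ck m f -> Ck m (c *: f).
Proof.
elim: m f => [|m IH] f /=; first by move=> cf x; exact: (@continuousZr R R^o V f c x (cf x)).
move=> [df cf]; split=> [x|v]; first exact: differentiableZ.
have -> : 'D_v (c *: f) = c *: 'D_v f.
  by apply/funext => x; rewrite deriveZ //; exact: diff_derivable.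
exact: IH.
Qed.

Lemma smf_add f g : smf f -> smf g -> smf (f + g).
Proof. by move=> sf sg m; apply: Ck_add. Qed.

Lemma smf_scale c f : smf f -> smf (c *: f).
Proof. by move=> sf m; apply: Ck_scale. Qed.

Lemma derive_translate f v (a : V) x : 'D_v (fun y => f (y + a)) x = 'D_v f (x + a).
Proof.
rewrite /derive.
suff -> : (fun h : R => h^-1 *: (((fun y => f (y + a)) \o shift x) (h *: v) - f (x + a))) =
  (fun h : R => h^-1 *: ((f \o shift (x + a)) (h *: v) - f (x + a))) by [].
by apply/funext => h; rewrite /= addrA.
Qed.

Lemma Ck_translate m f (a : V) : Ck m f -> Ck m (fun y => f (y + a)).
Proof.
elim: m f => [|m IH] f /=.
  move=> cf x; apply: (@continuous_comp V V R (fun y => y + a) f); last exact: cf.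
  exact: (@differentiable_continuous R V V x (fun y => y + a)).
move=> [df cf]; split=> [x|v].
  by apply: (@differentiable_comp _ _ _ _ (fun y => y + a) f).
have -> : 'D_v (fun y => f (y + a)) = (fun y => 'D_v f (y + a)).
  by apply/funext => x; exact: derive_translate.
exact: (IH _ (cf v)).
Qed.

Lemma smf_translate f (a : V) : smf f -> smf (fun y => f (y + a)).
Proof. by move=> sf m; apply: Ck_translate. Qed.

Lemma deriveDv f x v w : differentiable f x -> 'D_(v + w) f x = 'D_v f x + 'D_w f x.
Proof. by move=> d; rewrite !deriveE // linearD. Qed.

Lemma deriveZv f x c v : differentiable f x -> 'D_(c *: v) f x = c * 'D_v f x.
Proof. by move=> d; rewrite !deriveE // linearZ. Qed.

Lemma derive_sumv (I : Type) (r : seq I) f x (c : I -> R) (v : I -> V) :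
  differentiable f x ->
  'D_(\sum_(i <- r) c i *: v i) f x = \sum_(i <- r) c i * 'D_(v i) f x.
Proof.
move=> d; rewrite deriveE // linear_sum; apply: eq_bigr => i _.
by rewrite linearZ deriveE.
Qed.

Lemma is_derive_line f x v (t : R) : differentiable f (x + t *: v) ->
  is_derive t 1 (fun s => f (x + s *: v)) ('D_v f (x + t *: v)).
Proof.
move=> sf; have E : (fun h : R => h^-1 *:
    (((fun s => f (x + s *: v)) \o shift t) (h *: (1 : R)) - f (x + t *: v))) =
  (fun h : R => h^-1 *: ((f \o shift (x + t *: v)) (h *: v) - f (x + t *: v))).
  apply/funext => h /=; congr (_ *: (f _ - _)).
  by rewrite [h *: 1]mulr1 scalerDl addrCA.
have d : derivable f (x + t *: v) v by exact: diff_derivable.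
by split; [rewrite /derivable E | rewrite /derive E].
Qed.

(* [derive] is sealed because unification tends to unfold it to a limit. *)
Fact dd_key : unit. Proof. exact: tt. Qed.
Definition dd v f : V -> R := locked_with dd_key (fun x => 'D_v f x).

Lemma ddE v f x : dd v f x = 'D_v f x.
Proof. by rewrite /dd unlock. Qed.

Lemma ddEf v f : dd v f = 'D_v f.
Proof. by rewrite /dd unlock. Qed.

Lemma smf_dd f v : smf f -> smf (dd v f).
Proof. by rewrite ddEf; exact: smf_D. Qed.

Lemma dd_line f x v (t : R) : smf f ->
  is_derive t 1 (fun s => f (x + s *: v)) (dd v f (x + t *: v)).
Proof. by move=> sf; rewrite ddE; apply: is_derive_line; exact: smf_diff. Qed.

(** Two mean value theorems, the first for the difference between the lines through x + h w and x.
    The left side is symmetric in [v] and [w], which is the point. *)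
Lemma second_difference f x v w (h : R) : smf f -> 0 < h ->
  exists s t : R, [/\ 0 < s < h, 0 < t < h &
   f (x + h *: v + h *: w) - f (x + h *: v) - (f (x + h *: w) - f x) =
   h * (h * dd w (dd v f) (x + s *: v + t *: w))].
Proof.
move=> sf h0.
have [s s0h Es] := @MVT_everywhere R
  (fun s => f (x + h *: w + s *: v) - f (x + s *: v))
  (fun s => dd v f (x + h *: w + s *: v) - dd v f (x + s *: v)) 0 h h0
  (fun t => is_deriveB (dd_line (x + h *: w) v t sf) (dd_line x v t sf)).
have [t t0h Et] := @MVT_everywhere R
  (fun t => dd v f (x + s *: v + t *: w))
  (fun t => dd w (dd v f) (x + s *: v + t *: w)) 0 h h0
  (fun t => dd_line (x + s *: v) w t (smf_dd v sf)).
exists s, t; split=> //; move: Es Et; rewrite /= !scale0r !addr0 !subr0.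
rewrite (addrAC x (h *: v)) => ->; rewrite (addrAC x (h *: w)) => ->.
by rewrite mulrC; congr (_ * _); rewrite mulrC.
Qed.

(** Schwarz's theorem: the two mixed derivatives take equal values at two points arbitrarily near
    [x], both being the same second difference divided by h^2; continuity excludes a gap [d] between
    them. *)
Lemma dd_sym_pt f x v w : smf f -> dd w (dd v f) x = dd v (dd w f) x.
Proof.
move=> sf; apply: contrapT => /eqP; rewrite -subr_eq0 -normr_gt0 => d0.
set d := `|_| in d0.
have c1 := @smf_cont _ (smf_dd w (smf_dd v sf)) x.
have c2 := @smf_cont _ (smf_dd v (smf_dd w sf)) x.
have d2 : 0 < d / 2 by rewrite divr_gt0.
have : \forall y \near x, `|dd w (dd v f) x - dd w (dd v f) y| < d / 2 /\
    `|dd v (dd w f) x - dd v (dd w f) y| < d / 2.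
  by apply: filterI; [move/cvgrPdist_lt: c1|move/cvgrPdist_lt: c2]; apply.
(* With h = e / K all points x + s v + t w, 0 < s, t < h, stay in the ball of radius [e]; the
   summand 1 keeps [K] positive. *)
case/nbhs_ballP => e /= e0 close; pose K := `|v| + `|w| + 1.
have K0 : 0 < K by rewrite /K; have := normr_ge0 v; have := normr_ge0 w; lra.
pose h := e / K; have h0 : 0 < h by rewrite divr_gt0.
have near1 v' w' s t : `|v'| + `|w'| + 1 = K -> 0 < s < h -> 0 < t < h ->
    ball x e (x + s *: v' + t *: w').
  move=> KE /andP[s0 sh] /andP[t0 th]; rewrite -ball_normE /= -addrA opprD addrA subrr sub0r normrN.
  apply: (le_lt_trans (ler_normD _ _)); rewrite !normrZ !gtr0_norm //.
  apply: (@le_lt_trans _ _ (h * (`|v'| + `|w'|))).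
    by rewrite mulrDr lerD // ler_wpM2r // ltW.
  by rewrite -(divfK (lt0r_neq0 K0) e) -/h ltr_pM2l // -KE ltrDl ltr01.
have [s1 [t1 [s1h t1h E1]]] := second_difference x v w sf h0.
have [s2 [t2 [s2h t2h E2]]] := second_difference x w v sf h0.
have E : dd w (dd v f) (x + s1 *: v + t1 *: w) = dd v (dd w f) (x + s2 *: w + t2 *: v).
  apply: (mulfI (lt0r_neq0 h0)); apply: (mulfI (lt0r_neq0 h0)).
  apply: etrans (etrans (esym E1) _) E2; rewrite (addrAC x (h *: w)).
  by rewrite !opprB !addrA [RHS]addrAC [LHS]addrAC; congr (_ + _); rewrite -!addrA; congr (_ + _);
    rewrite addrC.
have [p1 _] := close _ (near1 v w _ _ erefl s1h t1h).
have KE : `|w| + `|v| + 1 = K by rewrite (addrC `|w|).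
have [_ p2] := close _ (near1 w v _ _ KE s2h t2h).
have : d < d; last by rewrite ltxx.
rewrite {1}/d; move: p1 p2; rewrite E => p1 p2.
rewrite distrC in p2; apply: (le_lt_trans (ler_distD _ _ _)).
by rewrite [ltRHS]splitr; exact: ltrD p1 p2.
Qed.

(** * Lattice-periodic functions *)

Section Lattice.
Variable (B : 'M[R]_n).
Hypothesis B_unit : B \in unitmx.

Definition lattice_vec (m : 'rV[int]_n) : V := map_mx intr m *m B.

Lemma periodic_lattice (T : Type) (f : V -> T) :
  (forall j x, f (x + row j B) = f x) -> forall m x, f (x + lattice_vec m) = f x.
Proof.
move=> per m; rewrite /lattice_vec mulmx_sum_row.
elim/big_rec: _ => [|j y _ IH] x; first by rewrite addr0.
rewrite addrA IH mxE; case: (m 0 j) => p.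
  elim: p => [|p IHp]; first by rewrite scale0r addr0.
  by rewrite intS rmorphD /= scalerDl scale1r addrA -[RHS]IHp addrAC per.
rewrite NegzE; elim: p.+1 => [|q IHq]; first by rewrite scale0r addr0.
rewrite intS opprD rmorphD /= scalerDl scaleN1r addrA addrAC -[RHS]IHq.
by rewrite -(per j) subrK.
Qed.

Lemma mulmxr_continuous : continuous (fun c : V => c *m B).
Proof.
move=> c; have -> : (fun c : V => c *m B) = \sum_i (fun c : V => c 0 i *: row i B).
  by apply/funext => d; rewrite mulmx_sum_row fct_sumE.
apply: differentiable_continuous; apply: differentiable_sum => i.
by apply: differentiableZl; exact: differentiable_coord.
Qed.

(** The unit cube in lattice coordinates is compact, and subtracting the floors of the coordinates
    moves any point into it. *)
Lemma periodic_max f : continuous f ->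
  (forall j x, f (x + row j B) = f x) -> exists x0, forall x, f x <= f x0.
Proof.
move=> cf per; pose A := [set c : V | forall i, `[0, 1]%classic (c ord0 i : R)].
have cA : compact A.
  by apply: (@rV_compact R _ (fun=> `[0, 1]%classic)) => i; exact: segment_compact.
have A0 : A !=set0 by exists 0 => i /=; rewrite mxE in_itv /= lexx ler01.
have cfB : {within A, continuous (fun c : V => f (c *m B))}.
  apply: continuous_subspaceT => c.
  by apply: (@continuous_comp V V R); [exact: mulmxr_continuous | exact: cf].
have [c _ cmax] := EVT_max_rV A0 cA cfB.
exists (c *m B) => x; pose d := x *m invmx B.
pose m : 'rV[int]_n := map_mx Num.floor d.
have -> : x = (d - map_mx intr m) *m B + lattice_vec m.
  by rewrite mulmxBl subrK mulmxKV.
rewrite periodic_lattice //; apply: cmax; rewrite inE => i /=.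
have -> : (d - map_mx intr m) ord0 i = d 0 i - (Num.floor (d 0 i))%:~R by rewrite [LHS]mxE;
  congr (_ + _); rewrite !mxE.
rewrite in_itv /=; have /andP[h1 h2] := floor_itv (d 0 i).
by rewrite subr_ge0 h1 lerBlDr addrC ltW // -[X in _ + X]/(1%:~R) -rmorphD.
Qed.

End Lattice.

Lemma dd_add v f g : smf f -> smf g -> dd v (f + g) = dd v f + dd v g.
Proof.
move=> sf sg; rewrite !ddEf; apply/funext => x.
by rewrite deriveD //; exact: smf_derivable.
Qed.

Lemma dd_scale v c f : smf f -> dd v (c *: f) = c *: dd v f.
Proof.
move=> sf; rewrite !ddEf; apply/funext => x.
by rewrite deriveZ //; exact: smf_derivable.
Qed.

Lemma dd_translate v f (a : V) :
  dd v (fun y => f (y + a)) = (fun y => dd v f (y + a)).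
Proof. by rewrite !ddEf; apply/funext => x; exact: derive_translate. Qed.

Lemma dd_sym f v w : smf f -> dd w (dd v f) = dd v (dd w f).
Proof. by move=> sf; apply/funext => x; exact: dd_sym_pt. Qed.

Lemma smf_cst (c : R) : smf (cst c).
Proof.
move=> m; elim: m c => [|m IH] c /=; first exact: cst_continuous.
split=> [x|v]; first exact: differentiable_cst.
by have -> : 'D_v (cst c) = cst 0 by apply/funext => x; rewrite derive_cst.
Qed.

Lemma smf_sum (I : Type) (r : seq I) (F : I -> V -> R) :
  (forall i, smf (F i)) -> smf (\sum_(i <- r) F i).
Proof.
move=> sF; elim/big_rec: _ => [|i g _ sg]; last exact: smf_add.
exact: smf_cst.
Qed.

Lemma dd_sum v (I : Type) (r : seq I) (F : I -> V -> R) :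
  (forall i, smf (F i)) -> dd v (\sum_(i <- r) F i) = \sum_(i <- r) dd v (F i).
Proof.
move=> sF; elim: r => [|i r IH].
  rewrite !big_nil ddEf; apply/funext => x; exact: (derive_cst (0 : R)).
by rewrite !big_cons dd_add ?IH //; exact: smf_sum.
Qed.

Lemma dd_dir_sum (I : Type) (r : seq I) f x (c : I -> R) (v : I -> V) : smf f ->
  dd (\sum_(i <- r) c i *: v i) f x = \sum_(i <- r) c i * dd (v i) f x.
Proof.
move=> sf; rewrite ddE derive_sumv; last exact: smf_diff.
by apply: eq_bigr => i _; rewrite ddE.
Qed.

Section Bernstein.
Variables (B E : 'M[R]_n) (L : R).
Hypotheses (B_unit : B \in unitmx) (E_unit : E \in unitmx) (L_gt0 : 0 < L).

Definition lap f x := \sum_i dd (row i E) (dd (row i E) f) x.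

Definition eigf f := [/\ smf f, forall x, lap f x = - L * f x &
  forall j x, f (x + row j B) = f x].

Lemma eigf_add f g : eigf f -> eigf g -> eigf (f + g).
Proof.
move=> [sf lf pf] [sg lg pg]; split; first exact: smf_add.
  move=> x; rewrite [(f + g) x]/(f x + g x) mulrDr -lf -lg /lap -big_split /=.
  by apply: eq_bigr => i _; rewrite !dd_add //; exact: smf_dd.
by move=> j x; rewrite /= -[LHS]/(f _ + g _) pf pg.
Qed.

Lemma eigf_scale c f : eigf f -> eigf (c *: f).
Proof.
move=> [sf lf pf]; split; first exact: smf_scale.
  move=> x; rewrite [(c *: f) x]/(c * f x) mulrCA -lf /lap big_distrr /=.
  by apply: eq_bigr => i _; rewrite !dd_scale //; exact: smf_dd.
by move=> j x; rewrite /= -[LHS]/(c * f _) pf.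
Qed.

Lemma eigf_translate f (a : V) : eigf f -> eigf (fun y => f (y + a)).
Proof.
move=> [sf lf pf]; split; first exact: smf_translate.
  move=> x; rewrite -lf /lap; apply: eq_bigr => i _.
  by rewrite !dd_translate.
by move=> j x; rewrite addrAC pf.
Qed.

Lemma eigf_D f v : eigf f -> eigf (dd v f).
Proof.
move=> [sf lf pf]; split; first exact: smf_dd.
  move=> x.
  have <- : dd v (lap f) x = - L * dd v f x.
    have -> : lap f = (- L) *: f by apply/funext => y; rewrite lf.
    by rewrite dd_scale.
  have -> : lap f = \sum_i dd (row i E) (dd (row i E) f).
    by apply/funext => y; rewrite fct_sumE.
  rewrite dd_sum; last by move=> i; exact/smf_dd/smf_dd.
  rewrite fct_sumE; apply: eq_bigr => i _.
  by rewrite (@dd_sym (dd (row i E) f)) ?(@dd_sym f v) //; exact: smf_dd.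
move=> j x; have := dd_translate v f (row j B); rewrite funeqE => /(_ x) <-.
by congr (dd _ _ _); apply/funext => y; exact: pf.
Qed.

(* At a maximum of [|grad f|^2 + 2 L f^2] the second derivatives along the frame are nonpositive;
   summing them makes the third-order terms collapse by [lap f = - L f]. *)
Lemma bernstein_max f x0 : eigf f ->
  (forall x, \sum_i dd (row i E) f x ^+ 2 + 2 * L * f x ^+ 2 <=
             \sum_i dd (row i E) f x0 ^+ 2 + 2 * L * f x0 ^+ 2) ->
  forall x, \sum_i dd (row i E) f x ^+ 2 <= 4 * L * f x0 ^+ 2.
Proof.
move=> ef wmax x; have [sf lf _] := ef.
have sd i : smf (dd (row i E) f) by exact: smf_dd.
have wle j : \sum_i (dd (row j E) (dd (row i E) f) x0 ^+ 2 +
      dd (row i E) f x0 * dd (row j E) (dd (row j E) (dd (row i E) f)) x0)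
    + 2 * L * (dd (row j E) f x0 ^+ 2 + f x0 * dd (row j E) (dd (row j E) f) x0) <= 0.
  have e0 : x0 + 0 *: row j E = x0 by rewrite scale0r addr0.
  have := @sum_squares_max R n (fun i t => dd (row i E) f (x0 + t *: row j E)) _ _
    (fun t => f (x0 + t *: row j E)) _ _ (2 * L)
    (fun i t => dd_line x0 (row j E) t (sd i))
    (fun i => dd_line x0 (row j E) 0 (smf_dd (row j E) (sd i)))
    (fun t => dd_line x0 (row j E) t sf)
    (dd_line x0 (row j E) 0 (smf_dd (row j E) sf)).
  by rewrite /= e0; apply=> t; exact: wmax.
have Hlap i : \sum_j dd (row i E) f x0 * dd (row j E) (dd (row j E) (dd (row i E) f)) x0 =
    - L * (dd (row i E) f x0 ^+ 2).
  have [_ l _] := eigf_D (row i E) ef.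
  by rewrite -mulr_sumr -[X in _ * X]/(lap (dd (row i E) f) x0) l mulrCA expr2.
(* At [x0] this gives |grad f|^2 <= 2 L f^2, so the maximal value is at most 4 L f(x0)^2; it
   dominates |grad f|^2 everywhere. *)
have := bernstein_algebra L_gt0 wle Hlap (lf x0).
have := wmax x.
move: (\sum_i _ ^+ 2) (\sum_i _ ^+ 2) (f x) (f x0) => G G0 y y0 w0 le0.
have yL : 0 <= L * y ^+ 2 by rewrite mulr_ge0 ?sqr_ge0 // ltW.
by lra.
Qed.

(** The constant depends on [L] alone, not on [f]; the same bound therefore serves all functions
    derived from an eigenfunction by differentiation or discrete Fourier components. *)
Lemma bernstein f c i : eigf f -> (forall x, `|f x| <= c) ->
  forall x, `|dd (row i E) f x| <= 2 * Num.sqrt L * c.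
Proof.
move=> ef fc; have [sf lf pf] := ef.
have c0 : 0 <= c by apply: le_trans (fc 0).
have [x0 x0max] : exists x0, forall x,
    \sum_i dd (row i E) f x ^+ 2 + 2 * L * f x ^+ 2 <=
    \sum_i dd (row i E) f x0 ^+ 2 + 2 * L * f x0 ^+ 2.
  apply: (periodic_max B_unit) => [x|j x].
    rewrite (_ : (fun x => _) = \sum_i dd (row i E) f ^+ 2 + (2 * L) *: f ^+ 2); last first.
      by apply/funext => y; rewrite -[RHS]/((\sum_i _) y + _) fct_sumE.
    apply: differentiable_continuous; apply: differentiableD.
      by apply: differentiable_sum => j; apply: differentiableX; exact/smf_diff/smf_dd.
    by apply: differentiableZ; apply: differentiableX; exact/smf_diff.
  rewrite pf; congr (_ + _); apply: eq_bigr => l _.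
  by have [_ _ ->] := eigf_D (row l E) ef.
move=> x; have h := bernstein_max ef x0max x.
rewrite -ler_sqr ?nnegrE ?mulr_ge0 ?sqrtr_ge0 //.
rewrite real_normK ?num_real // !exprMn sqr_sqrtr ?(ltW L_gt0) //.
apply: (@le_trans _ _ (\sum_i dd (row i E) f x ^+ 2)).
  by rewrite (bigD1 i) //= lerDl; apply: sumr_ge0 => j _; exact: sqr_ge0.
apply: (le_trans h); rewrite -natrX ler_wpM2l ?mulr_ge0 ?(ltW L_gt0) //.
by rewrite -real_normK ?num_real // ler_sqr ?nnegrE.
Qed.

Lemma bernstein_dir v : exists2 K, 0 <= K & forall f c, eigf f ->
  (forall x, `|f x| <= c) -> forall x, `|dd v f x| <= K * c.
Proof.
pose a i := (v *m invmx E) 0 i.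
have vE : v = \sum_i a i *: row i E by rewrite -mulmx_sum_row mulmxKV.
exists (\sum_i `|a i| * (2 * Num.sqrt L)).
  by apply: sumr_ge0 => i _; rewrite !mulr_ge0 // sqrtr_ge0.
move=> f c ef fc x; rewrite vE dd_dir_sum; last by case: ef.
rewrite mulr_suml; apply: (le_trans (ler_norm_sum _ _ _)).
apply: ler_sum => i _; rewrite normrM -mulrA ler_wpM2l //.
exact: bernstein.
Qed.

Lemma eigf_bounded f : eigf f -> exists c, forall x, `|f x| <= c.
Proof.
move=> ef; have [sf _ pf] := ef; have [sg _ pg] := eigf_scale (-1) ef.
have [x0 h0] := periodic_max B_unit (smf_cont sf) pf.
have [x1 h1] := periodic_max B_unit (smf_cont sg) pg.
exists (`|f x0| + `|f x1|) => x; rewrite ler_norml.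
have := h0 x; have := h1 x.
rewrite -![((-1) *: f) _]/(-1 * f _) !mulN1r lerN2.
have := ler_norm (f x0); have := ler_norm (- f x1); rewrite normrN.
have := normr_ge0 (f x0); have := normr_ge0 (f x1).
by move=> *; apply/andP; split; lra.
Qed.

End Bernstein.
End Smooth.

Section Cis.
Variable R : realType.
Local Notation C := R[i].
Implicit Types (s t : R).

Definition cis t : C := cos t +i* sin t.

Lemma cisD s t : cis (s + t) = cis s * cis t.
Proof. by rewrite /cis cosD sinD; apply/eqP; rewrite eq_complex /= eqxx /= addrC mulrC. Qed.

Lemma cis0 : cis 0 = 1.
Proof. by rewrite /cis cos0 sin0. Qed.

Lemma cisN t : cis (- t) * cis t = 1.
Proof. by rewrite -cisD addNr cis0. Qed.

Lemma cis_neq0 t : cis t != 0.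
Proof.
by apply/eqP => e; have := cisN t; rewrite e mulr0 => /eqP; rewrite eq_sym oner_eq0.
Qed.

Lemma cisX t m : cis t ^+ m = cis (m%:R * t).
Proof.
elim: m => [|m IH]; first by rewrite expr0 mul0r cis0.
by rewrite exprS IH -cisD -natr1 mulrDl mul1r addrC.
Qed.

Lemma cis_2pi_int (m : int) : cis (2 * pi * m%:~R) = 1.
Proof.
have e (p : nat) : cis (2 * pi * p%:R) = 1.
  by rewrite mulrC -cisX mulr_natl /cis cos2pi sin2pi expr1n.
case: m => p; first exact: e.
by rewrite NegzE rmorphN mulrN -[LHS]mulr1 -[X in _ * X](e p.+1) cisN.
Qed.

(** After removal of a multiple of 2 pi the angle lies in [0, 2 pi). Cosine is injective on [0, pi],
    and the other half is reflected to it. *)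
Lemma cis_eq1 t : cis t = 1 -> exists m : int, t = 2 * pi * m%:~R.
Proof.
have p0 : 0 < 2 * pi :> R by rewrite mulr_gt0 // pi_gt0.
move=> h; pose m := Num.floor (t / (2 * pi)); exists m.
pose s := t - 2 * pi * m%:~R.
have /andP[m1 m2] := floor_itv (t / (2 * pi)).
have s0 : 0 <= s by rewrite subr_ge0 mulrC -ler_pdivlMr.
have s2 : s < 2 * pi.
  rewrite ltrBlDr -[X in X + _]mulr1 -mulrDr mulrC -ltr_pdivrMr //.
  by rewrite addrC -[X in _ + X]/(1%:~R) -rmorphD.
have cs : cis s = 1.
  by have := cisD s (2 * pi * m%:~R); rewrite subrK h cis_2pi_int mulr1.
have cos1 (u : R) : 0 <= u <= pi -> cos u = 1 -> u = 0.
  move=> u0 cu; apply: (@cos_inj R); rewrite ?in_itv //= ?lexx ?pi_ge0 //.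
  by rewrite cos0.
have [e1] : cos s = 1 by have := cs; rewrite /cis => -[].
case: (leP s pi) => sp.
  by apply/eqP; rewrite -subr_eq0; apply/eqP/cos1; rewrite ?s0.
have : 2 * pi - s = 0.
  apply: cos1; first by apply/andP; split; lra.
  by rewrite -cosN opprB mulr_natl cosB cos2pi sin2pi mulr1 mulr0 addr0.
by lra.
Qed.

Lemma geometric_root (z : C) N : z ^+ N = 1 -> z != 1 -> \sum_(i < N) z ^+ i = 0.
Proof.
move=> zN z1; have := subrX1 z N; rewrite zN subrr => /esym/eqP.
by rewrite mulf_eq0 subr_eq0 (negPf z1) /= => /eqP.
Qed.

(** Orthogonality of the characters of Z/N. The shift by [M], which centres the frequencies, only
    contributes a common factor. *)
Lemma sum_cis N M (r : nat) : (r < N)%N ->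
  \sum_(i < N) cis (- (2 * pi * (i%:R - M%:R) / N%:R * r%:R)) =
  if r == 0%N then N%:R else 0.
Proof.
move=> rN; case: eqP => [->|/eqP r0].
  under eq_bigr do rewrite mulr0 oppr0 cis0.
  by rewrite sumr_const card_ord.
have N0 : N%:R != 0 :> R by rewrite pnatr_eq0; case: N rN.
pose z := cis (- (2 * pi / N%:R * r%:R)).
transitivity (cis (2 * pi * M%:R / N%:R * r%:R) * \sum_(i < N) z ^+ i).
  rewrite mulr_sumr; apply: eq_bigr => i _; rewrite /z cisX -cisD; congr cis; ring.
rewrite geometric_root ?mulr0 //.
  rewrite /z cisX (_ : _ * _ = 2 * pi * (- r%:Z)%:~R) ?cis_2pi_int //.
  by rewrite rmorphN /= -pmulrn; field.
apply/eqP => /cis_eq1[m] e.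
have p0 : 2 * pi != 0 :> R by rewrite mulf_neq0 // gt_eqF // pi_gt0.
have {e} e : (r%:Z)%:~R = (- m * N%:Z)%:~R :> R.
  apply: (mulfI p0); rewrite rmorphM rmorphN /= -!pmulrn mulNr mulrN mulrA -e.
  by field.
have := intr_inj e; have rp : (0 < r)%N by rewrite lt0n.
by move: rN rp; clear; case: m => m; nia.
Qed.

End Cis.

(** This turns estimates into exact identities. The index type is arbitrary, so that two functions
    with a common bound can be treated as one family. *)
Lemma half_shrink (R : realType) (A : Type) (P : A -> R) (c : R) :
  (forall c : R, (forall x, `|P x| <= c) -> forall x, `|P x| <= c / 2) ->
  (forall x, `|P x| <= c) -> forall x, P x = 0.
Proof.
move=> sh b x.
have {b} b m : forall x, `|P x| <= c / 2 ^+ m.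
  elim: m => [|m IH]; first by rewrite expr0 divr1.
  by rewrite exprSr invfM mulrA; exact: sh.
apply/eqP; rewrite -normr_le0 leNgt; apply/negP => p0.
have c0 : 0 <= c by have := b 0%N x; rewrite expr0 divr1; exact: le_trans.
have := archi_boundP (divr_ge0 c0 (ltW p0)); set m := Num.bound _ => hm.
have : `|P x| * 2 ^+ m <= c by rewrite -ler_pdivlMr ?exprn_gt0.
apply/negP; rewrite -ltNge mulrC -ltr_pdivrMr //; apply: (lt_trans hm).
by rewrite -natrX ltr_nat ltn_expl.
Qed.

Lemma sum_cyclic_shift (T : nmodType) (a : nat -> T) N : a N = a 0%N ->
  \sum_(r < N) a r.+1 = \sum_(r < N) a r.
Proof.
case: N => [|N] aN; first by rewrite !big_ord0.
by rewrite big_ord_recr [RHS]big_ord_recl /= aN addrC.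
Qed.

Lemma mul_imag (R : realType) (c a b : R) :
  (0 +i* c) * (a +i* b) = (- (c * b)) +i* (c * a).
Proof. by apply/eqP; rewrite eq_complex /= !mul0r sub0r add0r !eqxx. Qed.

(** Centred frequencies m satisfy |m| <= N / 2, so the angle 2 pi m / N is at most pi in absolute
    value. *)
Lemma centered_index (M : nat) (i : 'I_(M.*2.+1)) :
  2%:Z * `|i%:Z - M%:Z| <= (M.*2.+1)%:Z.
Proof. by have := ltn_ord i; lia. Qed.

(** * Laplace eigenfunctions are finite sums of characters *)

Section Fourier.
Variables (R : realType) (k : nat).
Local Notation n := k.*2.+1.
Local Notation V := 'rV[R]_n.
Local Notation C := R[i].
Variables (B E : 'M[R]_n) (L : R).
Hypotheses (B_unit : B \in unitmx) (E_unit : E \in unitmx) (L_gt0 : 0 < L).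
Local Notation eigf := (eigf B E L).
Implicit Types (f g : V -> R) (F G : V -> C) (x v : V).

Lemma dd_increment f x v (h : R) : smf f -> 0 < h ->
  exists xi : R, 0 < xi < h /\ f (x + h *: v) - f x = h * dd v f (x + xi *: v).
Proof.
move=> sf h0; have [c ch] := MVT_everywhere h0 (fun t => dd_line x v t sf).
by rewrite scale0r addr0 subr0 mulrC => e; exists c.
Qed.

(** With F = f + i g this is the real part of the derivative of e^(- i kap t) F(x + t v). The
    imaginary part is the same statement for the pair (g, - f). *)
Lemma twisted_derivative f g (kap : R) x v (t : R) : smf f -> smf g ->
  is_derive t 1
   (fun s => cos (kap * s) * f (x + s *: v) + sin (kap * s) * g (x + s *: v))
   (cos (kap * t) * (dd v f (x + t *: v) + kap * g (x + t *: v)) +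
    sin (kap * t) * (dd v g (x + t *: v) - kap * f (x + t *: v))).
Proof.
move=> sf sg.
have dk : is_derive t 1 (fun s : R => kap * s) kap.
  by rewrite -[X in is_derive _ _ _ X]mulr1; apply: is_derive_scalef; exact: is_derive_id.
have dc : is_derive t 1 (fun s => cos (kap * s)) (- sin (kap * t) * kap).
  by have := is_derive1_comp (is_derive_cos (kap * t)) dk.
have ds : is_derive t 1 (fun s => sin (kap * s)) (cos (kap * t) * kap).
  by have := is_derive1_comp (is_derive_sin (kap * t)) dk.
apply: is_derive_eq.
  by apply: is_derive_addf; apply: is_derive_mulf; apply: dd_line.
by rewrite /=; ring.
Qed.

Definition bernstein_bound v (K : R) := 0 < K /\
  forall f (c : R), eigf f -> (forall x, `|f x| <= c) -> forall x, `|dd v f x| <= K * c.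

(* With [F = f + i g], the function [e^(- i kap t) F (x + t v)] takes equal values at [0] and [1 / N], so
   the real part of its derivative vanishes somewhere in between; a second use of the mean value theorem
   and Bernstein's bound control the derivative at [0], which is the defect [h1 x]. *)
Lemma twisted_shrink v f g (kap K N c : R) : 0 < N -> eigf f -> eigf g ->
  bernstein_bound v K -> 4 * (K + `|kap|) <= N ->
  let h1 := dd v f + kap *: g in let h2 := dd v g + (- kap) *: f in
  (forall x, cos (kap / N) * f (x + N^-1 *: v) + sin (kap / N) * g (x + N^-1 *: v) = f x) ->
  (forall x, `|h1 x| <= c) -> (forall x, `|h2 x| <= c) -> forall x, `|h1 x| <= c / 2.
Proof.
move=> N0 ef eg [K_gt0 bern] NK h1 h2 per b1 b2 x.
have [sf _ _] := ef; have [sg _ _] := eg.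
have eh1 : eigf h1 by apply: eigf_add; [exact: eigf_D | exact: eigf_scale].
have eh2 : eigf h2 by apply: eigf_add; [exact: eigf_D | exact: eigf_scale].
have [sh1 _ _] := eh1; have [sh2 _ _] := eh2.
have c0 : 0 <= c by apply: le_trans (b1 0).
have iN0 : 0 < N^-1 by rewrite invr_gt0.
pose q (t : R) := cos (kap * t) * h1 (x + t *: v) + sin (kap * t) * h2 (x + t *: v).
have [xi /andP[xi0 xiN]] := MVT_everywhere iN0 (fun t => twisted_derivative kap x v t sf sg).
rewrite !mulr0 cos0 sin0 mul1r mul0r scale0r !addr0 per subrr subr0 => /esym/eqP.
rewrite mulf_eq0 (gt_eqF iN0) orbF => /eqP q0.
have {}q0 : q xi = 0.
  by rewrite -q0 /q /h1 /h2 -![(_ + _ : V -> R) _]/(_ + _ * _) mulNr.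
have [eta _] := MVT_everywhere xi0 (fun t => twisted_derivative kap x v t sh1 sh2).
rewrite !mulr0 cos0 sin0 mul1r mul0r scale0r !addr0 -/(q xi) q0 subr0 sub0r.
move=> /(congr1 Num.norm); rewrite normrN normrM (gtr0_norm xi0) => ->.
set y := x + eta *: v.
have K0 : 0 <= K + `|kap| by rewrite addr_ge0 // ltW.
have bd a b : `|a| <= (K + `|kap|) * c -> `|b| <= (K + `|kap|) * c ->
   `|cos (kap * eta) * a + sin (kap * eta) * b| <= 2 * ((K + `|kap|) * c).
  move=> ha hb; apply: (le_trans (ler_normD _ _)); rewrite !normrM mulr_natl mulr2n.
  by apply: lerD; [have := cos_max (kap * eta) | have := sin_max (kap * eta)];
     move=> hm; apply: (le_trans (ler_wpM2r (normr_ge0 _) hm)); rewrite mul1r.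
(* The second mean value point yields |h1 x| <= 2 (K + |kap|) c xi with xi < 1 / N; the hypothesis
   on [N] makes this at most c / 2. *)
apply: (@le_trans _ _ (2 * ((K + `|kap|) * c) * N^-1)).
  apply: ler_pM => //; [exact: ltW | | exact: ltW].
  apply: bd; apply: (le_trans (ler_normD _ _)); rewrite mulrDl; apply: lerD.
  - exact: bern.
  - by rewrite normrM ler_wpM2l.
  - exact: bern.
  - by rewrite normrN normrM ler_wpM2l.
rewrite ler_pdivrMr // mulrA.
have -> : c / 2 * N = 2 * c * (N / 4) by field.
have : K + `|kap| <= N / 4 by rewrite ler_pdivlMr // mulrC.
by move=> h; rewrite mulrAC ler_wpM2l // mulr_ge0.
Qed.

(* Translation by [v / N] acts as the rotation of angle [th], hence
   [|e^(i th) - 1| sup |F| <= (K / N) sup |F|]; the hypothesis on [th] makes this a halving of the bound. *)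
Lemma rotation_shrink v f g (th K N c : R) : 0 < N -> eigf f -> eigf g ->
  bernstein_bound v K -> 8 * K ^+ 2 <= N ^+ 2 * (2 - 2 * cos th) ->
  (forall x, f (x + N^-1 *: v) = cos th * f x - sin th * g x) ->
  (forall x, g (x + N^-1 *: v) = sin th * f x + cos th * g x) ->
  (forall x, `|f x| <= c) -> (forall x, `|g x| <= c) ->
  forall x, `|f x| <= c / 2 /\ `|g x| <= c / 2.
Proof.
move=> N0 ef eg [K_gt0 bern] NK rf rg bf bg x.
have [sf _ _] := ef; have [sg _ _] := eg.
have c0 : 0 <= c by apply: le_trans (bf 0).
have iN0 : 0 < N^-1 by rewrite invr_gt0.
have [x1 [_ e1]] := dd_increment x v sf iN0.
have [x2 [_ e2]] := dd_increment x v sg iN0.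
have sq a : `|a| <= K * c -> a ^+ 2 <= (K * c) ^+ 2.
  by move=> h; rewrite -[a ^+ 2]real_normK ?num_real // ler_sqr ?nnegrE ?mulr_ge0 // ltW.
have d1 := sq _ (bern f c ef bf (x + x1 *: v)).
have d2 := sq _ (bern g c eg bg (x + x2 *: v)).
move: e1 e2 d1 d2; rewrite rf rg.
move: (dd v f _) (dd v g _) (f x) (g x) => d1 d2 a b e1 e2 h1 h2.
have {}e1 : N * (cos th * a - sin th * b - a) = d1 by rewrite e1 mulrA mulfV ?mul1r // gt_eqF.
have {}e2 : N * (sin th * a + cos th * b - b) = d2 by rewrite e2 mulrA mulfV ?mul1r // gt_eqF.
(* The squared length of (e^(i th) - 1)(a + i b), as |e^(i th) - 1|^2 = 2 - 2 cos th. *)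
have key : N ^+ 2 * (2 - 2 * cos th) * (a ^+ 2 + b ^+ 2) <= 2 * (K * c) ^+ 2.
  apply: (@le_trans _ _ (d1 ^+ 2 + d2 ^+ 2)); last by rewrite mulr_natl mulr2n lerD.
  rewrite le_eqVlt; apply/orP; left; apply/eqP; rewrite -e1 -e2.
  have := cos2Dsin2 th; move: (cos th) (sin th) => C S h.
  have -> : 2 - 2 * C = C ^+ 2 + S ^+ 2 + 1 - 2 * C by rewrite h; ring.
  by ring.
have K2 : 0 < K ^+ 2 by rewrite exprn_gt0.
have : 8 * K ^+ 2 * (a ^+ 2 + b ^+ 2) <= 2 * (K * c) ^+ 2.
  by apply: le_trans key; rewrite ler_wpM2r // addr_ge0 // sqr_ge0.
rewrite exprMn => key2.
have {}key2 : 4 * (a ^+ 2 + b ^+ 2) <= c ^+ 2 by rewrite -(ler_pM2l K2); lra.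
have c20 : 0 <= c / 2 by rewrite divr_ge0.
have := sqr_ge0 a; have := sqr_ge0 b => b2 a2.
split; rewrite -ler_sqr ?nnegrE // real_normK ?num_real //;
 by rewrite exprMn exprVn ler_pdivlMr //; lra.
Qed.

Definition ReF F : V -> R := fun x => complex.Re (F x).
Definition ImF F : V -> R := fun x => complex.Im (F x).
Definition csm F := smf (ReF F) /\ smf (ImF F).
Definition ceig F := eigf (ReF F) /\ eigf (ImF F).
Definition dC v F x : C := dd v (ReF F) x +i* dd v (ImF F) x.

Lemma ceig_csm F : ceig F -> csm F.
Proof. by move=> [[sf _ _] [sg _ _]]. Qed.

Lemma ReF_scale (a : C) F :
  ReF (fun x => a * F x) = complex.Re a *: ReF F + (- complex.Im a) *: ImF F.
Proof.
apply/funext => x; rewrite -[RHS]/(complex.Re a * complex.Re (F x) + - complex.Im a * complex.Im (F x)).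
by rewrite /ReF; case: a (F x) => a b [c d] /=; rewrite mulNr.
Qed.

Lemma ImF_scale (a : C) F :
  ImF (fun x => a * F x) = complex.Re a *: ImF F + complex.Im a *: ReF F.
Proof.
apply/funext => x; rewrite -[RHS]/(complex.Re a * complex.Im (F x) + complex.Im a * complex.Re (F x)).
by rewrite /ImF; case: a (F x) => a b [c d] /=.
Qed.

Lemma ReF_add F G : ReF (fun x => F x + G x) = ReF F + ReF G.
Proof. by apply/funext => x; rewrite /ReF -[RHS]/(_ + _) raddfD. Qed.

Lemma ImF_add F G : ImF (fun x => F x + G x) = ImF F + ImF G.
Proof. by apply/funext => x; rewrite /ImF -[RHS]/(_ + _) raddfD. Qed.

Lemma csm_add F G : csm F -> csm G -> csm (fun x => F x + G x).
Proof.
by move=> [? ?] [? ?]; split; rewrite ?ReF_add ?ImF_add; exact: smf_add.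
Qed.

Lemma csm_scale (a : C) F : csm F -> csm (fun x => a * F x).
Proof.
by move=> [? ?]; split; rewrite ?ReF_scale ?ImF_scale; apply: smf_add; exact: smf_scale.
Qed.

Lemma ceig_add F G : ceig F -> ceig G -> ceig (fun x => F x + G x).
Proof.
by move=> [? ?] [? ?]; split; rewrite ?ReF_add ?ImF_add; exact: eigf_add.
Qed.

Lemma ceig_scale (a : C) F : ceig F -> ceig (fun x => a * F x).
Proof.
by move=> [? ?]; split; rewrite ?ReF_scale ?ImF_scale; apply: eigf_add; exact: eigf_scale.
Qed.

Lemma ceig_translate F v : ceig F -> ceig (fun x => F (x + v)).
Proof. by move=> [? ?]; split; [exact: (@eigf_translate _ _ _ _ _ (ReF F))
  | exact: (@eigf_translate _ _ _ _ _ (ImF F))]. Qed.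

Lemma dC_add v F G : csm F -> csm G ->
  dC v (fun x => F x + G x) = fun x => dC v F x + dC v G x.
Proof.
move=> [? ?] [? ?]; apply/funext => x; rewrite /dC ReF_add ImF_add !dd_add //.
Qed.

Lemma dC_scale v (a : C) F : csm F -> dC v (fun x => a * F x) = fun x => a * dC v F x.
Proof.
move=> [? ?]; apply/funext => x; rewrite /dC ReF_scale ImF_scale.
rewrite !dd_add ?dd_scale //; try exact: smf_scale.
case: a => a b; apply/eqP; rewrite eq_complex /=.
rewrite -![(_ + _ : V -> R) _]/(_ + _) -![(_ *: _ : V -> R) _]/(_ * _).
by rewrite mulNr !eqxx.
Qed.

Lemma dC_translate v F (a : V) : dC v (fun x => F (x + a)) = fun x => dC v F (x + a).
Proof.
apply/funext => x; rewrite /dC (dd_translate v (ReF F)) (dd_translate v (ImF F)) //.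
Qed.

Lemma ceig_cst0 : ceig (fun=> 0).
Proof.
have e0 : eigf (cst 0).
  split; [exact: smf_cst| |by []].
  move=> x; rewrite mulr0; apply: big1 => i _.
  have d0 w : dd w (cst (0 : R)) = cst 0.
    by rewrite ddEf; apply/funext => y; exact: derive_cst.
  by rewrite !d0.
by split; exact: e0.
Qed.

Lemma csm_sum (I : Type) (r : seq I) (F : I -> V -> C) : (forall i, csm (F i)) ->
  csm (fun x => \sum_(i <- r) F i x).
Proof.
move=> eF; elim: r => [|i r IH].
  by rewrite (_ : (fun x => _) = fun=> 0); [split; exact: smf_cst | apply/funext => x; rewrite big_nil].
rewrite (_ : (fun x => _) = fun x => F i x + \sum_(j <- r) F j x).
  exact: csm_add.
by apply/funext => x; rewrite big_cons.
Qed.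

Lemma ceig_sum (I : Type) (r : seq I) (F : I -> V -> C) : (forall i, ceig (F i)) ->
  ceig (fun x => \sum_(i <- r) F i x).
Proof.
move=> eF; elim: r => [|i r IH].
  by rewrite (_ : (fun x => _) = fun=> 0); [exact: ceig_cst0 | apply/funext => x; rewrite big_nil].
rewrite (_ : (fun x => _) = fun x => F i x + \sum_(j <- r) F j x).
  exact: ceig_add.
by apply/funext => x; rewrite big_cons.
Qed.

Lemma dC_sum v (I : Type) (r : seq I) (F : I -> V -> C) : (forall i, csm (F i)) ->
  dC v (fun x => \sum_(i <- r) F i x) = fun x => \sum_(i <- r) dC v (F i) x.
Proof.
move=> eF; elim: r => [|i r IH].
  apply/funext => x; rewrite big_nil.
  rewrite (_ : (fun y => \sum_(i <- [::]) F i y) = fun y => 0 * 0); last first.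
    by apply/funext => y; rewrite big_nil mulr0.
  by rewrite dC_scale ?mul0r //; split; exact: smf_cst.
rewrite (_ : (fun x => _) = fun x => F i x + \sum_(j <- r) F j x).
  by rewrite dC_add ?IH //; [apply/funext => x; rewrite big_cons | exact: csm_sum].
by apply/funext => x; rewrite big_cons.
Qed.

(* The component of frequency [m] of [F] for the discrete Fourier transform of order [N] along [v]. *)
Definition fcomp v (N : nat) (m : R) F x : C :=
  (N%:R)^-1 * \sum_(r < N) cis (- (2 * pi * m / N%:R * r%:R)) * F (x + (r%:R / N%:R) *: v).

Lemma fcomp_ceig v N m F : ceig F -> ceig (fcomp v N m F).
Proof.
move=> eF; apply: ceig_scale; apply: ceig_sum => r; apply: ceig_scale.
exact: ceig_translate.
Qed.

Lemma fcomp_dC v N m F w (a : C) : csm F -> (forall x, dC w F x = a * F x) ->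
  forall x, dC w (fcomp v N m F) x = a * fcomp v N m F x.
Proof.
move=> sF dF x.
have sT b : csm (fun y => F (y + b)).
  by have [? ?] := sF; split; [exact: (@smf_translate _ _ (ReF F)) | exact: (@smf_translate _ _ (ImF F))].
rewrite /fcomp dC_scale; last by apply: csm_sum => r; exact: csm_scale.
rewrite dC_sum; last by move=> r; exact: csm_scale.
rewrite [RHS]mulrCA; congr (_ * _); rewrite mulr_sumr; apply: eq_bigr => r _.
by rewrite dC_scale // dC_translate dF mulrCA.
Qed.

Lemma sum_fcomp v N (M : nat) F x : (0 < N)%N ->
  \sum_(i < N) fcomp v N (i%:R - M%:R) F x = F x.
Proof.
move=> N0; rewrite -mulr_sumr exchange_big /=.
under eq_bigr => r _ do rewrite -mulr_suml sum_cis //.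
case: N N0 => // N _; rewrite (bigD1 ord0) //= big1 => [|r /negPf r0].
  by rewrite mul0r scale0r !addr0 mulKf // pnatr_eq0.
by rewrite -val_eqE /= in r0; rewrite r0 mul0r.
Qed.

Lemma fcomp_shift v N (m : int) F x : (0 < N)%N -> (forall y, F (y + v) = F y) ->
  fcomp v N m%:~R F (x + (N%:R)^-1 *: v) = cis (2 * pi * m%:~R / N%:R) * fcomp v N m%:~R F x.
Proof.
move=> N0 pF; have NR : N%:R != 0 :> R by rewrite pnatr_eq0 -lt0n.
rewrite /fcomp mulrCA; congr (_ * _).
pose a (r : nat) := cis (- (2 * pi * m%:~R / N%:R * r%:R)) * F (x + (r%:R / N%:R) *: v).
transitivity (cis (2 * pi * m%:~R / N%:R) * \sum_(r < N) a r.+1).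
  rewrite mulr_sumr; apply: eq_bigr => r _; rewrite /a mulrA -cisD.
  have -> : r.+1%:R = r%:R + 1 :> R by rewrite natr1.
  rewrite [X in cis X * F _ = _](_ : _ = 2 * pi * m%:~R / N%:R - 2 * pi * m%:~R / N%:R * (r%:R + 1));
    last by ring.
  congr (_ * F _).
  by rewrite -addrA -scalerDl mulrDl mul1r (addrC (_^-1)).
congr (_ * _); rewrite (@sum_cyclic_shift _ a) // /a mul0r scale0r addr0 mulr0 oppr0.
rewrite cis0 mul1r divff // scale1r pF divfK //.
by rewrite -mulrN -mulrNz cis_2pi_int mul1r.
Qed.

(** The two equations say that F = f + i g satisfies dF/dv = i kap F. Each defect shrinks by
    [twisted_shrink], applied to (f, g) and to (g, - f), that is to F and to - i F. *)
Lemma small_frequency v f g (kap K N : R) x : 0 < N -> eigf f -> eigf g ->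
  bernstein_bound v K -> 4 * (K + `|kap|) <= N ->
  (forall x, f (x + N^-1 *: v) = cos (kap / N) * f x - sin (kap / N) * g x) ->
  (forall x, g (x + N^-1 *: v) = sin (kap / N) * f x + cos (kap / N) * g x) ->
  dd v f x = - (kap * g x) /\ dd v g x = kap * f x.
Proof.
move=> N0 ef eg bern NK rf rg.
have [sf _ _] := ef; have [sg _ _] := eg.
have eNf := eigf_scale (-1) ef.
pose h1 := dd v f + kap *: g; pose h2 := dd v g + (- kap) *: f.
have eh1 : eigf h1 by apply: eigf_add; [exact: eigf_D | exact: eigf_scale].
have eh2 : eigf h2 by apply: eigf_add; [exact: eigf_D | exact: eigf_scale].
have cs := cos2Dsin2 (kap / N).
have per1 y : cos (kap / N) * f (y + N^-1 *: v) + sin (kap / N) * g (y + N^-1 *: v) = f y.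
  by rewrite rf rg -[RHS]mul1r -cs; ring.
have per2 y : cos (kap / N) * g (y + N^-1 *: v) + sin (kap / N) * ((-1) *: f) (y + N^-1 *: v) = g y.
  by rewrite -[((-1) *: f) _]/(-1 * _) mulN1r rf rg -[RHS]mul1r -cs; ring.
have E2 : dd v g + kap *: ((-1) *: f) = h2 by rewrite scalerA mulrN1.
have E1 : dd v ((-1) *: f) + (- kap) *: g = (-1) *: h1.
  by rewrite dd_scale // scalerDr scalerA mulN1r.
have [c1 b1] := eigf_bounded B_unit eh1; have [c2 b2] := eigf_bounded B_unit eh2.
(* Each halving uses the bounds of both defects, so they are made one function on [V * bool]. *)
have h0 : forall yb : V * bool, (if yb.2 then h1 yb.1 else h2 yb.1) = 0.
  apply: (@half_shrink _ _ _ (`|c1| + `|c2|)) => [c hc yb|yb].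
    have hc1 y := hc (y, true); have hc2 y := hc (y, false).
    case: yb => y [] /=.
      exact: (twisted_shrink N0 ef eg bern NK per1 hc1 hc2).
    have := twisted_shrink N0 eg eNf bern NK per2; rewrite E2 E1; apply=> // z.
    by rewrite -[((-1) *: h1) z]/(-1 * _) mulN1r normrN; exact: hc1.
  case: yb.2.
    by apply: (le_trans (b1 _)); apply: (le_trans (ler_norm _)); rewrite lerDl.
  by apply: (le_trans (b2 _)); apply: (le_trans (ler_norm _)); rewrite lerDr.
have := h0 (x, true); have := h0 (x, false); rewrite /= /h1 /h2.
rewrite -![(_ + _ : V -> R) x]/(_ + _ * _) mulNr => /eqP; rewrite subr_eq0 => /eqP -> /eqP.
by rewrite addr_eq0 => /eqP ->.
Qed.

(** [M] depends on the direction and on [L] only. It is so large that each frequency m falls into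
    one of two cases: either 4 (K + 2 pi |m|) <= N, and the component is an exact exponential along
    the direction, or 1/8 < |2 pi m / N| <= pi, and the component vanishes by [rotation_shrink]. *)
Lemma fourier_direction j : exists2 M : nat, True & forall F, ceig F ->
  let N := M.*2.+1 in forall (i : 'I_N) x,
  dC (row j B) (fcomp (row j B) N (i%:R - M%:R) F) x =
  (0 +i* (2 * pi * (i%:R - M%:R))) * fcomp (row j B) N (i%:R - M%:R) F x.
Proof.
set v := row j B.
have [K0 K0_ge0 bern0] := bernstein_dir B_unit E_unit L_gt0 v.
pose K := K0 + 1; have K_gt0 : 0 < K by rewrite ltr_wpDl.
have bern : bernstein_bound v K.
  split=> // f c ef fc x; apply: (le_trans (bern0 f c ef fc x)).
  by rewrite /K mulrDl mul1r lerDl; apply: le_trans (fc 0).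
(* The minimum of |e^(i th) - 1|^2 for 1/8 <= |th| <= pi. *)
pose d : R := 2 - 2 * cos (1 / 8).
have d_gt0 : 0 < d.
  suff : cos (1 / 8 : R) < cos 0 by rewrite cos0 /d; lra.
  have p2 := pi_ge2 R.
  by rewrite ltr_cos ?in_itv /= ?lexx //; apply/andP; split; lra.
(* The term 8 K makes K <= N / 8, so that failure of the first case forces |th| > 1/8; the term 8
   K^2 / d gives the hypothesis of [rotation_shrink]. *)
pose M := Num.bound (8 * K + 8 * K ^+ 2 / d); exists M => // F eF N i x.
have bge : 8 * K + 8 * K ^+ 2 / d < M%:R.
  by apply: archi_boundP; rewrite addr_ge0 ?divr_ge0 ?mulr_ge0 ?exprn_ge0 // ltW.
have NM : N%:R = 2 * M%:R + 1 :> R by rewrite /N -addn1 natrD -muln2 natrM mulrC.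
have q0 : 0 <= 8 * K ^+ 2 / d by rewrite divr_ge0 ?mulr_ge0 ?exprn_ge0 // ltW.
have N_gt0 : 0 < N%:R :> R by rewrite ltr0n.
have N1 : 1 <= N%:R :> R by rewrite ler1n.
have N8K : 8 * K <= N%:R by lra.
have N8K2 : 8 * K ^+ 2 <= N%:R ^+ 2 * d.
  rewrite -ler_pdivrMr //; apply: (@le_trans _ _ N%:R); first by lra.
  by rewrite expr2 ler_peMr // ltW.
pose m : int := i%:Z - M%:Z.
have mE : i%:R - M%:R = m%:~R :> R by rewrite rmorphB.
rewrite mE; set G := fcomp v N m%:~R F.
have eG : ceig G by exact: fcomp_ceig.
have pF y : F (y + v) = F y.
  have [[_ _ p1] [_ _ p2]] := eF; apply/eqP; rewrite eq_complex.
  by have := p1 j y; have := p2 j y; rewrite /ReF /ImF => -> ->; rewrite !eqxx.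
have sG y := fcomp_shift m y (isT : (0 < N)%N) pF; rewrite -/G in sG.
set th := 2 * pi * m%:~R / N%:R in sG.
have [e1 e2] := eG.
have sR y : ReF G (y + (N%:R)^-1 *: v) = cos th * ReF G y - sin th * ImF G y.
  by rewrite /ReF sG /ImF; case: (G y).
have sI y : ImF G (y + (N%:R)^-1 *: v) = sin th * ReF G y + cos th * ImF G y.
  by rewrite /ImF sG /ReF /cis; case: (G y) => a b /=; rewrite addrC.
have [c1 b1] := eigf_bounded B_unit e1; have [c2 b2] := eigf_bounded B_unit e2.
case: (leP (4 * (K + `|2 * pi * m%:~R|)) N%:R) => [small|big].
  have -> : G x = ReF G x +i* ImF G x by rewrite /ReF /ImF; case: (G x).
  rewrite /dC; have [-> ->] := @small_frequency v (ReF G) (ImF G) _ K N%:R x N_gt0 e1 e2 bern small sR sI.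
  by rewrite mul_imag.
have th_gt : 1 / 8 < `|th|.
  rewrite /th normrM (gtr0_norm (_ : 0 < (N%:R)^-1)) ?invr_gt0 // ltr_pdivlMr //.
  have : N%:R = N%:R / 2 + N%:R / 2 :> R by rewrite -splitr. lra.
have th_le : `|th| <= pi.
  rewrite /th normrM (gtr0_norm (_ : 0 < (N%:R)^-1)) ?invr_gt0 // ler_pdivrMr //.
  rewrite normrM gtr0_norm ?mulr_gt0 ?pi_gt0 // -mulrA mulrCA ler_wpM2l ?pi_ge0 //.
  rewrite -intr_norm -[2]/(2%:~R) -rmorphM -[N%:R]/(N%:Z%:~R) ler_int /m.
  exact: centered_index.
have cth : cos th <= cos (1 / 8).
  rewrite -(cos_norm th) ltW // ltr_cos // ?in_itv /=; apply/andP; split=> //; lra.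
have bigN : 8 * K ^+ 2 <= N%:R ^+ 2 * (2 - 2 * cos th).
  apply: (le_trans N8K2); rewrite ler_wpM2l ?exprn_ge0 ?(ltW N_gt0) // /d; lra.
have G0 : forall yb : V * bool, (if yb.2 then ReF G yb.1 else ImF G yb.1) = 0.
  apply: (@half_shrink _ _ _ (`|c1| + `|c2|)) => [c hc yb|yb].
    have := rotation_shrink N_gt0 e1 e2 bern bigN sR sI (fun y => hc (y, true)) (fun y =>
      hc (y, false)) yb.1.
    by case: yb.2 => -[].
  case: yb.2.
    by apply: (le_trans (b1 _)); apply: (le_trans (ler_norm _)); rewrite lerDl.
  by apply: (le_trans (b2 _)); apply: (le_trans (ler_norm _)); rewrite lerDr.
have {}G0 : G = fun=> 0.
  apply/funext => y; apply/eqP; rewrite eq_complex.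
  by have := G0 (y, true); have := G0 (y, false); rewrite /ReF /ImF /= => -> ->; rewrite eqxx.
rewrite G0 mulr0 (_ : (fun=> 0) = fun y => 0 * (0 : C)); last by apply/funext => y; rewrite mulr0.
by rewrite dC_scale ?mul0r //; split; exact: smf_cst.
Qed.

End Fourier.

(** * Characters of the lattice and exponential solutions *)

Section Characters.
Variables (R : realType) (k : nat).
Local Notation n := k.*2.+1.
Local Notation V := 'rV[R]_n.
Local Notation C := R[i].
Implicit Types (f g : V -> R) (F G : V -> C) (x v : V).

Section Wave.
Variable (w : V -> R).
Hypothesis w_lin : linear w.

Lemma wave_add x y : w (x + y) = w x + w y.
Proof. by have := w_lin 1 x y; rewrite !scale1r. Qed.

Lemma wave0 : w 0 = 0.
Proof. by apply: (addrI (w 0)); rewrite -wave_add !addr0. Qed.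

Lemma wave_scale c x : w (c *: x) = c * w x.
Proof. by have := w_lin c x 0; rewrite !addr0 wave0 addr0. Qed.

Lemma wave_sum (I : Type) (r : seq I) (v : I -> V) :
  w (\sum_(i <- r) v i) = \sum_(i <- r) w (v i).
Proof. by apply: big_morph; [exact: wave_add | exact: wave0]. Qed.

Lemma wave_diff x : differentiable w x.
Proof.
have -> : w = \sum_i (fun y : V => y 0 i *: w (delta_mx 0 i)).
  apply/funext => y; rewrite fct_sumE {1}(matrix_sum_delta y) big_ord1 wave_sum.
  by apply: eq_bigr => i _; rewrite wave_scale.
apply: differentiable_sum => i; apply: differentiableZl.
exact: differentiable_coord.
Qed.

Lemma wave_comp_diff (h : R -> R) x : (forall t : R, derivable h t 1) ->
  differentiable (fun y => h (w y)) x.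
Proof.
move=> dh; apply: (@differentiable_comp _ _ _ _ w h); first exact: wave_diff.
by apply/derivable1_diffP.
Qed.

Lemma wave_comp_derive (h h' : R -> R) v : (forall t : R, is_derive t 1 h (h' t)) ->
  forall x, 'D_v (fun y => h (w y)) x = w v * h' (w x).
Proof.
move=> dh x.
have d0 : differentiable (fun y => h (w y)) (x + 0 *: v).
  by apply: wave_comp_diff => t; have [] := dh t.
have := is_derive_line d0; rewrite scale0r addr0 => -[_ <-].
have E : (fun s : R => h (w (x + s *: v))) = h \o (fun s : R => w x + w v * s).
  by apply/funext => s /=; rewrite wave_add wave_scale mulrC.
have da : is_derive (0 : R) 1 (fun s : R => w x + w v * s) (w v).
  rewrite -[X in is_derive _ _ _ X]add0r; apply: is_derive_addf.
  by rewrite -[X in is_derive _ _ _ X]mulr1; apply: is_derive_scalef; exact: is_derive_id.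
transitivity ('D_1 (h \o (fun s : R => w x + w v * s)) (0 : R)); first by rewrite -E.
have dh0 : is_derive (w x + w v * 0) 1 h (h' (w x)) by rewrite mulr0 addr0.
by have [_ ->] := @is_derive1_comp _ h _ 0 _ _ dh0 da; rewrite mulrC.
Qed.

(** Both coefficients are general because the induction on the order of differentiability needs a
    family stable under directional derivatives. *)
Lemma smf_wave (a b : R) : smf (fun x => a * cos (w x) + b * sin (w x)).
Proof.
move=> m; elim: m a b => [|m IH] a b /=.
  move=> x; apply: differentiable_continuous.
  apply: (@wave_comp_diff (fun t => a * cos t + b * sin t)) => t.
  by apply: derivableD; apply: derivableM => //; exact: derivable_cst.
split=> [x|v].
  apply: (@wave_comp_diff (fun t => a * cos t + b * sin t)) => t.
  by apply: derivableD; apply: derivableM => //; exact: derivable_cst.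
rewrite (_ : 'D_v _ = fun x => (w v * b) * cos (w x) + (- (w v * a)) * sin (w x)) //.
apply/funext => y; rewrite (@wave_comp_derive (fun t => a * cos t + b * sin t)
  (fun t => a * - sin t + b * cos t)); first by ring.
Qed.

Lemma csm_wave : csm (fun x => cis (w x)).
Proof.
split; rewrite /ReF /ImF /cis /=.
  rewrite (_ : (fun x => _) = fun x => 1 * cos (w x) + 0 * sin (w x)).
    exact: smf_wave.
  by apply/funext => x; rewrite mul0r addr0 mul1r.
rewrite (_ : (fun x => _) = fun x => 0 * cos (w x) + 1 * sin (w x)).
  exact: smf_wave.
by apply/funext => x; rewrite mul0r add0r mul1r.
Qed.

Lemma dC_wave v x : dC v (fun x => cis (w x)) x = (0 +i* w v) * cis (w x).
Proof.
rewrite /dC /ReF /ImF /cis /= !ddEf mul_imag.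
rewrite (@wave_comp_derive cos (fun t => - sin t)).
by rewrite (@wave_comp_derive sin cos) mulrN.
Qed.

End Wave.

Variable (B : 'M[R]_n).
Hypothesis (B_unit : B \in unitmx).

(** An element of the dual lattice times 2 pi, kept as a linear form because the basis [B] is not
    orthonormal. *)
Definition freq (m : 'rV[int]_n) (x : V) : R :=
  \sum_j (x *m invmx B) 0 j * (2 * pi * (m 0 j)%:~R).

Lemma freq_linear m : linear (freq m).
Proof.
move=> c x y; rewrite /freq /GRing.scale /= mulr_sumr -big_split /=.
by apply: eq_bigr => j _; rewrite mulmxDl -scalemxAl !mxE; ring.
Qed.

Lemma freq_row m j : freq m (row j B) = 2 * pi * (m 0 j)%:~R.
Proof.
rewrite /freq -row_mul mulmxV // (bigD1 j) //= big1 ?addr0.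
  by rewrite !mxE eqxx mul1r.
by move=> i ij; rewrite !mxE eq_sym (negPf ij) mul0r.
Qed.

Definition chi m x : C := cis (freq m x).

Variables (E : 'M[R]_n) (L : R).
Hypotheses (E_unit : E \in unitmx) (L_gt0 : 0 < L).

Definition freq_sqr m : R := \sum_i freq m (row i E) ^+ 2.

Definition trig F := exists s : seq ('rV[int]_n * C),
  (forall p, p \in s -> freq_sqr p.1 = L) /\
  forall x, F x = \sum_(p <- s) p.2 * chi p.1 x.

Lemma trig0 : trig (fun=> 0).
Proof. by exists [::]; split=> // x; rewrite big_nil. Qed.

Lemma trig_add F G : trig F -> trig G -> trig (fun x => F x + G x).
Proof.
move=> [s [sL sF]] [r [rL rG]]; exists (s ++ r); split=> [p|x].
  by rewrite mem_cat => /orP[]; [exact: sL | exact: rL].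
by rewrite big_cat sF rG.
Qed.

Lemma trig_sum (I : Type) (r : seq I) (F : I -> V -> C) : (forall i, trig (F i)) ->
  trig (fun x => \sum_(i <- r) F i x).
Proof.
move=> tF; elim: r => [|i r IH].
  by rewrite (_ : (fun x => _) = fun=> 0); [exact: trig0 | apply/funext => x; rewrite big_nil].
rewrite (_ : (fun x => _) = fun x => F i x + \sum_(j <- r) F j x).
  exact: trig_add.
by apply/funext => x; rewrite big_cons.
Qed.

Lemma dC_dir_sum (c : 'I_n -> R) (v : 'I_n -> V) (a : 'I_n -> R) F x : csm F ->
  (forall i, dC (v i) F x = (0 +i* a i) * F x) ->
  dC (\sum_i c i *: v i) F x = (0 +i* (\sum_i c i * a i)) * F x.
Proof.
move=> [sf sg] dF; rewrite /dC !dd_dir_sum //.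
have d1 i : dd (v i) (ReF F) x = - (a i * ImF F x).
  by have := dF i; rewrite /dC /ImF; case: (F x) => ? ?; rewrite mul_imag => -[].
have d2 i : dd (v i) (ImF F) x = a i * ReF F x.
  by have := dF i; rewrite /dC /ReF; case: (F x) => ? ?; rewrite mul_imag => -[].
rewrite /ReF /ImF in d1 d2 *; case: (F x) d1 d2 => p q /= d1 d2; rewrite mul_imag.
apply/eqP; rewrite eq_complex /= !mulr_suml -sumrN; apply/andP; split; apply/eqP; apply: eq_bigr => i _.
  by rewrite d1 mulrN mulrA.
by rewrite d2 mulrA.
Qed.

(** Along the segment from 0 to x the function e^(- i t w(x)) F(t x) has derivative zero, so its
    values at t = 0 and t = 1 agree. *)
Lemma wave_solution (w : V -> R) F : csm F ->
  (forall v x, dC v F x = (0 +i* w v) * F x) ->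
  forall x, F x = F 0 * cis (w x).
Proof.
move=> [sf sg] dF x.
have d1 y : dd x (ReF F) y = - (w x * ImF F y).
  by have := dF x y; rewrite /dC /ImF; case: (F y) => ? ?; rewrite mul_imag => -[].
have d2 y : dd x (ImF F) y = w x * ReF F y.
  by have := dF x y; rewrite /dC /ReF; case: (F y) => ? ?; rewrite mul_imag => -[].
have snf := smf_scale (-1) sf.
(* The direction is [x] itself and the twisting frequency [w x]. The two applications treat the real
   and the imaginary part. *)
have [t _] := MVT_everywhere ltr01 (fun t => twisted_derivative (w x) 0 x t sf sg).
have [t' _] := MVT_everywhere ltr01 (fun t => twisted_derivative (w x) 0 x t sg snf).
rewrite dd_scale // !scale0r !addr0 !add0r !scale1r !mulr1 !mulr0 cos0 sin0 !mul1r !mul0r !addr0.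
rewrite -![((-1) *: _ : V -> R) _]/(-1 * _) !d1 !d2 => e2 e1.
have {}e1 : cos (w x) * ReF F x + sin (w x) * ImF F x = ReF F 0.
  by apply/eqP; rewrite -subr_eq0 e1; apply/eqP; ring.
have {}e2 : cos (w x) * ImF F x + sin (w x) * (-1 * ReF F x) = ImF F 0.
  by apply/eqP; rewrite -subr_eq0 e2; apply/eqP; ring.
have -> : F 0 = ReF F 0 +i* ImF F 0 by rewrite /ReF /ImF; case: (F 0).
have -> : F x = ReF F x +i* ImF F x by rewrite /ReF /ImF; case: (F x).
rewrite -e1 -e2 !mulN1r; have := cos2Dsin2 (w x); rewrite /cis.
move: (cos _) (sin _) (ReF F x) (ImF F x) => c s p q h.
apply/eqP; rewrite eq_complex /=; apply/andP; split; apply/eqP.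
  by rewrite -[LHS]mul1r -h; ring.
by rewrite -[LHS]mul1r -h; ring.
Qed.

(** Pure frequencies in all lattice directions force F = F(0) chi_m. Unless F(0) = 0, the Laplace
    equation at 0 then gives [freq_sqr m = L]. *)
Lemma trig_pure (m : 'rV[int]_n) F : ceig B E L F ->
  (forall j x, dC (row j B) F x = (0 +i* (2 * pi * (m 0 j)%:~R)) * F x) -> trig F.
Proof.
move=> eF dF; have sF := ceig_csm eF; have [sf sg] := sF.
have dw v x : dC v F x = (0 +i* freq m v) * F x.
  rewrite {1}(_ : v = \sum_i (v *m invmx B) 0 i *: row i B); last first.
    by rewrite -mulmx_sum_row mulmxKV.
  by rewrite (dC_dir_sum _ sF (fun i => dF i x)).
have FE := wave_solution sF dw.
have [F0|F0] := eqVneq (F 0) 0.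
  rewrite (_ : F = fun=> 0); first exact: trig0.
  by apply/funext => x; rewrite FE F0 mul0r.
exists [:: (m, F 0)]; split=> [p|x]; last by rewrite big_seq1 /= FE.
rewrite inE => /eqP -> /=.
have d1 v : dd v (ReF F) = (- freq m v) *: ImF F.
  apply/funext => y; rewrite -[RHS]/(_ * _).
  by have := dw v y; rewrite /dC /ImF; case: (F y) => ? ?; rewrite mul_imag mulNr => -[].
have d2 v : dd v (ImF F) = freq m v *: ReF F.
  apply/funext => y; rewrite -[RHS]/(_ * _).
  by have := dw v y; rewrite /dC /ReF; case: (F y) => ? ?; rewrite mul_imag => -[].
have [[_ l1 _] [_ l2 _]] := eF.
have {}l1 : freq_sqr m * ReF F 0 = L * ReF F 0.
  apply: oppr_inj; rewrite -[RHS]mulNr -l1 /lap /freq_sqr mulr_suml -sumrN; apply: eq_bigr => i _.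
  by rewrite d1 dd_scale // d2 -[RHS]/(_ * (_ * _)); ring.
have {}l2 : freq_sqr m * ImF F 0 = L * ImF F 0.
  apply: oppr_inj; rewrite -[RHS]mulNr -l2 /lap /freq_sqr mulr_suml -sumrN; apply: eq_bigr => i _.
  by rewrite d2 dd_scale // d1 -[RHS]/(_ * (_ * _)); ring.
case: (eqVneq (ReF F 0) 0) => [r0|r0]; last exact: (mulIf r0).
case: (eqVneq (ImF F 0) 0) => [i0|i0]; last exact: (mulIf i0).
by case/eqP: F0; apply/eqP; rewrite eq_complex; rewrite /ReF /ImF in r0 i0; rewrite r0 i0 eqxx.
Qed.

(** One lattice direction is resolved at a time: F is the finite sum of its Fourier components along
    that direction, each of pure frequency there, and passing to components preserves the
    frequencies obtained before. *)
Lemma ceig_trig F : ceig B E L F -> trig F.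
Proof.
move=> eF.
(* [d] counts the directions still unresolved; [m] records the frequencies in the others. *)
suff: forall d (m : 'rV[int]_n) G, (d <= n)%N -> ceig B E L G ->
   (forall (j : 'I_n) x, (j < n - d)%N -> dC (row j B) G x = (0 +i* (2 * pi * (m 0 j)%:~R)) * G x) ->
     trig G.
  by move=> /(_ n 0 F (leqnn _) eF); apply=> j x; rewrite subnn.
elim=> [|d IH] m G dn eG dG.
  by apply: (trig_pure eG) => j x; apply: dG; rewrite subn0.
have jn : (n - d.+1 < n)%N by rewrite ltn_subrL.
pose j := Ordinal jn; have [M _ dj] := fourier_direction B_unit E_unit L_gt0 j.
pose N := M.*2.+1.
rewrite (_ : G = fun x => \sum_(i < N) fcomp (row j B) N (i%:R - M%:R) G x); last first.
  by apply/funext => x; rewrite sum_fcomp.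
apply: trig_sum => i.
apply: (IH (\row_l if l == j then i%:Z - M%:Z else m 0 l)) => [|| l x lj].
- exact: ltnW.
- exact: fcomp_ceig.
rewrite mxE; case: eqP => [->|/eqP nlj].
  by rewrite dj // rmorphB.
apply: fcomp_dC; first exact: ceig_csm eG.
move=> y; apply: dG.
by move: nlj lj dn; rewrite -val_eqE /=; lia.
Qed.

End Characters.

(** * Clifford action on spinors *)

Lemma enum_min (m : nat) (T : {set 'I_m}) (j : 'I_m) : j \in T ->
  (forall l, l \in T -> (j <= l)%N) -> enum T = j :: enum (T :\ j).
Proof.
move=> jT jmin; pose lt := relpre (@nat_of_ord m) ltn.
have ltT : transitive lt by move=> a b c; exact: ltn_trans.
have ltI : irreflexive lt by move=> a; exact: ltnn.
have se (A : {set 'I_m}) : sorted lt (enum A).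
  rewrite /enum_mem -enumT; apply: sorted_filter => //.
  by rewrite /lt -sorted_map val_enum_ord iota_ltn_sorted.
apply: (irr_sorted_eq ltT ltI) => //= [|l].
  rewrite (path_sortedE ltT) se andbT; apply/allP => l.
  rewrite mem_enum 2!inE => /andP[lj lT].
  by rewrite /lt /= ltn_neqAle jmin // andbT eq_sym.
by rewrite inE !mem_enum 2!inE; case: eqP => // ->.
Qed.

(** Removing the least element matches the nesting of the Clifford action, whose outermost generator
    is the least one. *)
Lemma set_min_ind (m : nat) (P : {set 'I_m} -> Prop) : P finset.set0 ->
  (forall (T : {set 'I_m}) j, j \in T -> (forall l, l \in T -> (j <= l)%N) -> P (T :\ j) -> P T) ->
  forall T, P T.
Proof.
move=> P0 PS T; elim: {T}#|T| {-2}T (erefl #|T|) => [|c IH] T cT.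
  by rewrite (cards0_eq cT).
have [j0 j0T] : exists j, j \in T by apply/set0Pn; rewrite -card_gt0 cT.
case: (@arg_minnP _ j0 (mem T) (@nat_of_ord m) j0T) => j jT jmin.
apply: (PS T j jT jmin); apply: IH.
by apply/eqP; rewrite -eqSS -cT (cardsD1 j T) (jT : j \in T).
Qed.

Section CliffordAction.
Variables (R : realType) (k : nat).
Local Notation n := k.*2.+1.
Local Notation C := R[i].
Local Notation Sigma := (Sigma R k).
Implicit Types (N : 'I_k -> 'M[C]_2) (v : Sigma) (i j : 'I_n) (S T : {set 'I_n}).

Lemma tensor_opD N v w : tensor_op N (v + w) = tensor_op N v + tensor_op N w.
Proof.
apply/ffunP => s; rewrite !ffunE -big_split /=; apply: eq_bigr => t _.
by rewrite ffunE mulrDr.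
Qed.

Lemma tensor_opZ N (c : C) v : tensor_op N (c *: v) = c *: tensor_op N v.
Proof.
apply/ffunP => s; rewrite !ffunE scaler_sumr; apply: eq_bigr => t _.
by rewrite ffunE -[c *: v t]/(c * v t) -[RHS]/(c * _) mulrCA.
Qed.

Lemma tensor_op_comp N N' v :
  tensor_op N (tensor_op N' v) = tensor_op (fun l => N l *m N' l) v.
Proof.
apply/ffunP => s; rewrite !ffunE.
under eq_bigr do rewrite ffunE mulr_sumr.
rewrite exchange_big /=; apply: eq_bigr => u _.
under eq_bigr do rewrite mulrA; rewrite -mulr_suml; congr (_ * _).
under [RHS]eq_bigr do rewrite mxE.
by rewrite bigA_distr_bigA; apply: eq_bigr => t _; rewrite big_split.
Qed.

Lemma tensor_op_scale (c : 'I_k -> C) N v :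
  tensor_op (fun l => c l *: N l) v = (\prod_l c l) *: tensor_op N v.
Proof.
apply/ffunP => s; rewrite !ffunE scaler_sumr; apply: eq_bigr => t _.
rewrite -[RHS]/(_ * (_ * _)) mulrA -big_split /=; congr (_ * _).
by apply: eq_bigr => l _; rewrite mxE.
Qed.

Lemma eq_tensor_op N N' v : N =1 N' -> tensor_op N v = tensor_op N' v.
Proof.
by move=> e; apply/ffunP => s; rewrite !ffunE; apply: eq_bigr => t _; under eq_bigr do rewrite e.
Qed.

Definition product_vector (u : 'I_k -> 'I_2 -> C) : Sigma :=
  [ffun s : {ffun 'I_k -> 'I_2} => \prod_l u l (s l)].

Lemma tensor_op_product N u :
  tensor_op N (product_vector u) = product_vector (fun l a => \sum_b N l a b * u l b).
Proof.
apply/ffunP => s; rewrite !ffunE bigA_distr_bigA; apply: eq_bigr => t _.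
by rewrite ffunE -big_split.
Qed.

Lemma tensor_op1 v : tensor_op (fun=> 1%:M) v = v.
Proof.
apply/ffunP => s; rewrite ffunE (bigD1 s) //= [X in _ + X]big1 => [|t ts].
  by rewrite addr0 big1 ?mul1r // => l _; rewrite mxE eqxx.
suff [l sl] : exists l, s l != t l.
  by rewrite (bigD1 l) //= mxE (negPf sl) mul0r mul0r.
apply: contrapT => h; case/eqP: ts; apply/ffunP => l; apply: contrapT => /eqP tsl.
by apply: h; exists l; rewrite eq_sym.
Qed.

Lemma ord2_case (P : 'I_2 -> Prop) : P 0 -> P 1 -> forall a, P a.
Proof.
by move=> p0 p1 [[|[|//]] h]; [move: p0|move: p1]; congr P; apply: val_inj.
Qed.

Lemma mx2_mul (p q r s p' q' r' s' : C) : mx2 p q r s *m mx2 p' q' r' s' =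
  mx2 (p * p' + q * r') (p * q' + q * s') (r * p' + s * r') (r * q' + s * s').
Proof.
by apply/matrixP; apply: ord2_case; apply: ord2_case; rewrite !mxE !big_ord_recl big_ord0 /= !mxE /= addr0.
Qed.

Lemma mx2_scale (c p q r s : C) : c *: mx2 p q r s = mx2 (c * p) (c * q) (c * r) (c * s).
Proof. by apply/matrixP; apply: ord2_case; apply: ord2_case; rewrite !mxE. Qed.

Lemma mx2_scalar (c : C) : c%:M = mx2 c 0 0 c.
Proof. by apply/matrixP; apply: ord2_case; apply: ord2_case; rewrite !mxE. Qed.

Let ii : 'i%C * 'i%C = -1 :> C. Proof. by rewrite -expr2 sqr_i. Qed.

Ltac mx2_calc := rewrite ?mx2_scalar ?mx2_mul ?mx2_scale; congr mx2;
  rewrite ?(mulr0, mul0r, addr0, add0r, mulrN, mulNr, opprK, oppr0, mul1r, mulr1, mulN1r, ii).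

Lemma mT_sqr : mT R *m mT R = 1%:M. Proof. by rewrite /mT; mx2_calc. Qed.
Lemma mg1_sqr : mg1 R *m mg1 R = (-1) *: 1%:M. Proof. by rewrite /mg1; mx2_calc. Qed.
Lemma mg2_sqr : mg2 R *m mg2 R = (-1) *: 1%:M. Proof. by rewrite /mg2; mx2_calc. Qed.
Lemma mg1_mg2 : mg1 R *m mg2 R = (- 'i%C) *: mT R. Proof. by rewrite /mg1 /mg2 /mT; mx2_calc. Qed.
Lemma mg1_mg2_anti : mg1 R *m mg2 R = (-1) *: (mg2 R *m mg1 R).
Proof. by rewrite /mg1 /mg2; mx2_calc. Qed.
Lemma mg1_mT_anti : mg1 R *m mT R = (-1) *: (mT R *m mg1 R).
Proof. by rewrite /mg1 /mT; mx2_calc. Qed.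
Lemma mg2_mT_anti : mg2 R *m mT R = (-1) *: (mT R *m mg2 R).
Proof. by rewrite /mg2 /mT; mx2_calc. Qed.

Definition gamma_coef i : C := if (i < k.*2)%N then 1 else 'i%C.

(** For the last index i./2 = k, so [gamma_factor] already puts T in every slot; only the scalar i
    distinguishes this case. *)
Lemma gammaE i v : gamma i v = gamma_coef i *: tensor_op (@gamma_factor R k i) v.
Proof.
rewrite /gamma /gamma_coef; case: ifPn => ik; first by rewrite scale1r.
congr (_ *: _); apply: eq_tensor_op => l; rewrite /gamma_factor ifT //.
by have := ltn_ord i; have := ltn_ord l; lia.
Qed.

Lemma gammaD i v w : gamma i (v + w) = gamma i v + gamma i w.
Proof. by rewrite !gammaE tensor_opD scalerDr. Qed.

Lemma gammaZ i (c : C) v : gamma i (c *: v) = c *: gamma i v.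
Proof. by rewrite !gammaE tensor_opZ !scalerA mulrC. Qed.

Lemma gamma0 i : gamma i (0 : Sigma) = 0.
Proof. by rewrite -(scale0r (0 : Sigma)) gammaZ !scale0r. Qed.

Lemma gamma_sum i (I : Type) (r : seq I) (P : pred I) (F : I -> Sigma) :
  gamma i (\sum_(x <- r | P x) F x) = \sum_(x <- r | P x) gamma i (F x).
Proof. by apply: big_morph; [exact: gammaD | exact: gamma0]. Qed.

(** T squares to 1 and exactly one slot, k - 1 - i./2, carries g_1 or g_2, of square -1. For the
    last index there is no such slot, and the sign comes from the scalar i. *)
Lemma gamma_sqr i v : gamma i (gamma i v) = - v.
Proof.
rewrite !gammaE tensor_opZ scalerA tensor_op_comp.
pose p (l : 'I_k) := ((l + i./2).+1 == k)%N.
rewrite (@eq_tensor_op _ (fun l => (if p l then -1 else 1) *: 1%:M)); last first.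
  move=> l; rewrite /gamma_factor /p; case: ifPn => h1.
    by rewrite ifF ?scale1r ?mT_sqr //; apply/negP; lia.
  by case: ifP; [case: ifP; rewrite ?mg1_sqr ?mg2_sqr | rewrite scale1r mul1mx].
rewrite tensor_op_scale tensor_op1 scalerA /gamma_coef; case: ifPn => ik.
  have lk : (k - (i./2).+1 < k)%N by lia.
  rewrite (bigD1 (Ordinal lk)) //= {1}/p ifT /=; last by lia.
  rewrite big1 ?mulr1 ?mul1r ?scaleN1r // => l; rewrite -val_eqE /= /p => lne.
  by rewrite ifF //; apply/negP; lia.
rewrite big1 ?mulr1 ?ii ?scaleN1r // => l _; rewrite /p ifF //; apply/negP.
by have := ltn_ord i; have := ltn_ord l; lia.
Qed.

(** The slot k - 1 - i./2 is the only one where the factors anticommute: [gamma j] has T there, or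
    g_2 when [i] and [j] form a pair. In earlier slots [gamma i] has the identity, in later ones
    both have T. *)
Lemma gamma_anti_lt i j v : (i < j)%N -> gamma i (gamma j v) = - gamma j (gamma i v).
Proof.
move=> ij; rewrite !gammaE !tensor_opZ !scalerA !tensor_op_comp.
have ik : (i < k.*2)%N by have := ltn_ord j; lia.
pose p (l : 'I_k) := ((l + i./2).+1 == k)%N.
rewrite (@eq_tensor_op _ (fun l => (if p l then -1 else 1) *:
    (@gamma_factor R k j l *m @gamma_factor R k i l))); last first.
  move=> l; rewrite /gamma_factor /p.
  case: (ltngtP (l + i./2).+1 k) => h1.
  - by rewrite [(k <= l + i./2)%N]leqNgt (ltnW h1) scale1r mulmx1 mul1mx.
  - rewrite -ltnS h1 ifT ?scale1r //; by lia.
  - rewrite [(k <= l + i./2)%N](_ : _ = false); last by lia.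
    have [jk|jk] := boolP (k <= l + j./2)%N.
      by case: ifP; rewrite ?mg1_mT_anti ?mg2_mT_anti.
    rewrite [(l + j./2).+1 == k](_ : _ = true); last by apply/eqP; lia.
    have -> : odd i = false by lia.
    have -> : odd j = true by lia.
    exact: mg1_mg2_anti.
rewrite tensor_op_scale scalerA mulrC -scaleNr; congr (_ *: _).
have lk : (k - (i./2).+1 < k)%N by lia.
rewrite (bigD1 (Ordinal lk)) //= {1}/p ifT /=; last by lia.
rewrite big1 ?mulr1 ?mulN1r => [|l]; first by rewrite mulrC.
by rewrite -val_eqE /= /p => lne; rewrite ifF //; apply/negP; lia.
Qed.

Lemma gamma_anti i j v : i != j -> gamma i (gamma j v) = - gamma j (gamma i v).
Proof.
rewrite -val_eqE /= neq_ltn => /orP[ij|ij]; first exact: gamma_anti_lt.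
by rewrite [in RHS]gamma_anti_lt // opprK.
Qed.

Definition act S v := foldr (@gamma R k) v (enum S).

Lemma act_min T j v : j \in T -> (forall l, l \in T -> (j <= l)%N) ->
  act T v = gamma j (act (T :\ j) v).
Proof. by move=> jT jmin; rewrite /act (enum_min jT jmin). Qed.

Lemma act0 v : act finset.set0 v = v.
Proof. by rewrite /act enum_set0. Qed.

Lemma swaps1 i T : clif_swaps [set i] T = (\sum_(l in T) (l <= i)%N)%N.
Proof. by rewrite /clif_swaps big_set1. Qed.

Lemma act1 i v : act (finset.set1 i) v = gamma i v.
Proof. by rewrite /act enum_set1. Qed.

(** Compares [i] with the least element of [T]: a smaller [i] is prepended, an equal one is squared
    away, a larger one is moved inwards by anticommutation. The signs add up to the elements of [T]
    that are at most [i]. *)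
Lemma act_gen i T v : gamma i (act T v) =
  (-1) ^+ clif_swaps [set i] T *: act (symdiff [set i] T) v.
Proof.
elim/set_min_ind: T => [|T j jT jmin IH].
  by rewrite symdiff0 clif_swaps0r expr0 scale1r act0 act1.
have sw : clif_swaps [set i] T = ((j <= i) + clif_swaps [set i] (T :\ j))%N.
  by rewrite !swaps1 (bigD1 j) //=; congr (_ + _)%N; apply: eq_bigl => l; rewrite !inE andbC.
case: (ltngtP i j) => [ij|ji|/val_inj eij].
- have sw0 : clif_swaps [set i] T = 0%N.
    rewrite swaps1 big1 // => l /jmin jl; apply/eqP; rewrite eqb0 -ltnNge.
    exact: leq_trans ij jl.
  have iT : i \notin T by apply/negP => /jmin; rewrite leqNgt ij.
  have sE : symdiff [set i] T = i |: T.
    by apply/setP => l; rewrite in_symdiff !inE; case: eqP => [->|//]; rewrite (negPf iT).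
  rewrite sw0 expr0 scale1r sE (@act_min (i |: T) i) ?setU11 ?setU1K // => l.
  by rewrite !inE => /orP[/eqP -> //|/jmin]; apply: leq_trans; exact: ltnW.
- rewrite (act_min v jT jmin) gamma_anti; last by rewrite -val_eqE /= gtn_eqF.
  rewrite IH gammaZ sw (ltnW ji) exprD expr1 mulN1r scaleNr; congr (- (_ *: _)).
  have -> : symdiff [set i] (T :\ j) = symdiff [set i] T :\ j.
    apply/setP => l; rewrite !(in_symdiff, inE); case: (eqVneq l j) => //= ->.
    by rewrite -val_eqE /= ltn_eqF.
  rewrite -act_min // => [|l].
    by rewrite in_symdiff inE jT addbT -val_eqE /= ltn_eqF.
  rewrite in_symdiff inE; case: eqP => [-> _|_ /= /jmin //]; exact: ltnW.
- rewrite -eij in jT jmin IH sw *.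
  have sE : symdiff [set i] T = T :\ i.
    by apply/setP => l; rewrite in_symdiff !inE; case: eqP => [->|//]; rewrite jT.
  rewrite (act_min v jT jmin) gamma_sqr sE sw leqnn.
  have -> : clif_swaps [set i] (T :\ i) = 0%N.
    rewrite swaps1 big1 // => l; rewrite !inE => /andP[li /jmin il].
    by apply/eqP; rewrite eqb0 -ltnNge ltn_neqAle il andbT val_eqE eq_sym.
  by rewrite expr1 scaleN1r.
Qed.

Lemma clif_actD x y v : clif_act (x + y) v = clif_act x v + clif_act y v.
Proof.
rewrite /clif_act -big_split /=; apply: eq_bigr => S _.
by rewrite ffunE rmorphD /= scalerDl.
Qed.

Lemma clif_actZ (c : R) x v : clif_act (c *: x) v = c%:C *: clif_act x v.
Proof.
rewrite /clif_act scaler_sumr; apply: eq_bigr => S _.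
by rewrite ffunE -[_ *: x S]/(_ * x S) rmorphM scalerA.
Qed.

Lemma clif_act_basis S v : clif_act (clif_basis R S) v = act S v.
Proof.
rewrite /clif_act (bigD1 S) //= big1 ?addr0 => [|T nT].
  by rewrite ffunE eqxx scale1r.
by rewrite ffunE (negPf nT) scale0r.
Qed.

Lemma clif_act1 v : clif_act 1 v = v.
Proof. by rewrite [LHS]clif_act_basis act0. Qed.

Lemma clif_act_gen i v : clif_act (clif_gen R i) v = gamma i v.
Proof.
by rewrite clif_act_basis act1.
Qed.

Lemma clif_act_linear x (c : C) v w : clif_act x (c *: v + w) = c *: clif_act x v + clif_act x w.
Proof.
have actL S : act S (c *: v + w) = c *: act S v + act S w.
  by rewrite /act; elim: (enum S) => //= j s ->; rewrite gammaD gammaZ.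
rewrite /clif_act scaler_sumr -big_split /=; apply: eq_bigr => S _.
by rewrite -/(act S _) actL scalerDr !scalerA mulrC.
Qed.

Lemma clif_act_v0 x : clif_act x (0 : Sigma) = 0.
Proof.
have := clif_act_linear x 1 0 0; rewrite !scale1r addr0 => /eqP.
by rewrite -subr_eq subrr => /eqP <-.
Qed.

Lemma clif_act_vZ x (c : C) v : clif_act x (c *: v) = c *: clif_act x v.
Proof. by have := clif_act_linear x c v 0; rewrite clif_act_v0 !addr0. Qed.

Lemma clif_act_vD x v w : clif_act x (v + w) = clif_act x v + clif_act x w.
Proof. by have := clif_act_linear x 1 v w; rewrite !scale1r. Qed.

(** Fixing the left factor lets the property pass from generators through sums, scalings and
    products to all of Spin(n). *)
Definition multiplicative_act (x : clifford R n) :=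
  forall y v, clif_act (x * y) v = clif_act x (clif_act y v).

Lemma mact_gen i : multiplicative_act (clif_gen R i).
Proof.
move=> y v; rewrite clif_act_gen {2}/clif_act gamma_sum.
rewrite /clif_act (reindex (symdiff [set i])) /=; last exact/onW_bij/symdiff_bij.
apply: eq_bigr => T _; rewrite gammaZ -/(act T v) act_gen scalerA; congr (_ *: _).
rewrite ffunE (bigD1 (finset.set1 i)) //= big1 ?addr0 => [|S nS].
  by rewrite ffunE eqxx symdiffK mulr1 mulrC rmorphM rmorphXn rmorphN1.
by rewrite ffunE (negPf nS) mulr0 mul0r.
Qed.

Lemma mactD x x' : multiplicative_act x -> multiplicative_act x' -> multiplicative_act (x + x').
Proof. by move=> mx mx' y v; rewrite mulrDl !clif_actD mx mx'. Qed.

Lemma mactZ (c : R) x : multiplicative_act x -> multiplicative_act (c *: x).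
Proof. by move=> mx y v; rewrite -scalerAl !clif_actZ mx. Qed.

Lemma mact1 : multiplicative_act 1.
Proof. by move=> y v; rewrite mul1r clif_act1. Qed.

Lemma mactM x x' : multiplicative_act x -> multiplicative_act x' -> multiplicative_act (x * x').
Proof. by move=> mx mx' y v; rewrite -mulrA mx mx' mx. Qed.

Lemma mact_prod (I : Type) (r : seq I) (F : I -> clifford R n) :
  (forall a, multiplicative_act (F a)) -> multiplicative_act (\prod_(a <- r) F a).
Proof.
by move=> mF; elim/big_ind: _ => // [|x y mx my]; [exact: mact1 | exact: mactM].
Qed.

Lemma mact_vec (u : 'rV[R]_n) : multiplicative_act (clif_vec u).
Proof.
rewrite /clif_vec; elim/big_ind: _ => [|x y mx my|i _]; last exact/mactZ/mact_gen.
  by rewrite -(scale0r 1); exact/mactZ/mact1.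
exact: mactD.
Qed.

Lemma mact_spin y : spin y -> multiplicative_act y.
Proof. by move=> [us [_ _ ->]]; apply: mact_prod => u; exact: mact_vec. Qed.

End CliffordAction.

(** * Joint eigenvectors of the products of paired generators *)

Section SpinEigenvectors.
Variables (R : realType) (k : nat).
Local Notation n := k.*2.+1.
Local Notation C := R[i].
Local Notation Sigma := (Sigma R k).
Local Notation signs := {ffun 'I_k -> bool}.
Implicit Types (v : Sigma) (sg : signs).

Definition sgn (b : bool) : R := if b then 1 else -1.

(* the tensor product of the eigenvectors (1, +-i) of T *)
Definition spin_vec sg : Sigma :=
  product_vector (fun l a => if a == 0 then 1 else ('i%C * (sgn (sg l))%:C)).

Lemma tensor_op_spin_vec (p : pred 'I_k) sg :
  tensor_op (fun l => if p l then mT R else 1%:M) (spin_vec sg) =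
  (\prod_(l | p l) sgn (sg l))%:C *: spin_vec sg.
Proof.
rewrite /spin_vec tensor_op_product.
transitivity (product_vector (fun l (a : 'I_2) => (if p l then (sgn (sg l))%:C else 1) *
    (if a == 0 then 1 else ('i%C * (sgn (sg l))%:C : C)))).
  congr product_vector; apply/funext => l; apply/funext => a.
  have ii : 'i%C * 'i%C = -1 :> C by rewrite -expr2 sqr_i.
  case: (p l); rewrite !big_ord_recl big_ord0 /= addr0.
    move: a; apply: ord2_case; rewrite /mT /mx2 !mxE /=.
      by rewrite mul0r add0r mulrA mulNr ii opprK mul1r mulr1.
    by rewrite mul0r addr0 mulr1 mulrCA; case: (sg l); rewrite ?mulr1 // -rmorphM mulrNN mulr1 mulr1.
  by move: a; apply: ord2_case; rewrite !mxE /= ?mulr1 ?mul0r ?add0r ?addr0 ?mul1r.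
apply/ffunP => s; rewrite !ffunE big_split -[RHS]/(_ * _); congr (_ * _).
by rewrite rmorph_prod [RHS]big_mkcond /=.
Qed.

Definition sgn_prod sg : R := \prod_l sgn (sg l).

Lemma gamma_last_spin_vec sg :
  gamma ord_max (spin_vec sg) = ('i%C * (sgn_prod sg)%:C) *: spin_vec sg.
Proof.
by rewrite /gamma ltnn (tensor_op_spin_vec xpredT) scalerA.
Qed.

Lemma inord_even (j : 'I_k) : @inord k.*2 j.*2 = j.*2 :> nat.
Proof. by rewrite inordK //; have := ltn_ord j; lia. Qed.

Lemma inord_odd (j : 'I_k) : @inord k.*2 j.*2.+1 = j.*2.+1 :> nat.
Proof. by rewrite inordK //; have := ltn_ord j; lia. Qed.

(** The pair carries g_1 and g_2 in slot k - 1 - j, with g_1 g_2 = - i T, and T in the later slots,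
    where T^2 = 1. *)
Lemma gamma_pair (j : 'I_k) v : gamma (inord j.*2) (gamma (inord j.*2.+1) v) =
  (- 'i%C) *: tensor_op (fun l => if l == rev_ord j then mT R else 1%:M) v.
Proof.
have jk := ltn_ord j.
rewrite !gammaE tensor_opZ scalerA tensor_op_comp /gamma_coef inord_even inord_odd.
rewrite !ifT ?mul1r ?scale1r; try lia.
rewrite (@eq_tensor_op _ _ _ (fun l => (if l == rev_ord j then - 'i%C else 1) *:
    (if l == rev_ord j then mT R else 1%:M))).
  rewrite tensor_op_scale; congr (_ *: _).
  by rewrite -big_mkcond big_pred1_eq.
move=> l; rewrite /gamma_factor.
have -> : j.*2./2 = j by lia.
have -> : j.*2.+1./2 = j by lia.
have -> : odd j.*2 = false by lia.
have -> : odd j.*2.+1 = true by lia.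
case: (eqVneq l (rev_ord j)) => [->|lj].
  have e : (rev_ord j + j).+1 = k by rewrite /=; lia.
  have -> : (k <= rev_ord j + j)%N = false by rewrite /=; lia.
  by rewrite e eqxx mg1_mg2.
rewrite scale1r; case: ifP => h; first exact: mT_sqr.
have -> : ((l + j).+1 == k)%N = false; last exact: mulmx1.
by apply/negP => /eqP e; case/eqP: lj; apply: val_inj => /=; lia.
Qed.

Definition half_angle (j : 'I_k) : R := j.+1%:R * (pi / n%:R).

Lemma mact_r (j : 'I_k) : multiplicative_act (chd_r R j).
Proof.
by apply: mactD; apply: mactZ; [exact: mact1 | apply: mactM; exact: mact_gen].
Qed.

Lemma clif_act_r (j : 'I_k) v : clif_act (chd_r R j) v =
  (cos (half_angle j))%:C *: v +
  (sin (half_angle j))%:C *: gamma (inord j.*2) (gamma (inord j.*2.+1) v).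
Proof. by rewrite /chd_r clif_actD !clif_actZ clif_act1 mact_gen !clif_act_gen. Qed.

Lemma clif_act_r_spin_vec (j : 'I_k) sg : clif_act (chd_r R j) (spin_vec sg) =
  cis (- (half_angle j * sgn (sg (rev_ord j)))) *: spin_vec sg.
Proof.
rewrite clif_act_r gamma_pair (tensor_op_spin_vec (fun l => l == rev_ord j)).
rewrite big_pred1_eq !scalerA -scalerDl; congr (_ *: _).
by rewrite /cis cosN sinN; apply/eqP; rewrite eq_complex /=; case: (sg _);
   rewrite /= ?mulr1 ?mulrN1 ?cosN ?sinN !(mulr0, mul0r, mulr1, mulrN1, mul1r, mulN1r, oppr0, addr0,
     add0r, subr0, sub0r, opprK) !eqxx.
Qed.

Lemma clif_act_alpha_spin_vec sg : clif_act (chd_alpha R k) (spin_vec sg) =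
  cis (- \sum_(j < k) half_angle j * sgn (sg (rev_ord j))) *: spin_vec sg.
Proof.
rewrite /chd_alpha; elim: (index_enum _) => [|j r IH].
  by rewrite !big_nil oppr0 cis0 scale1r clif_act1.
rewrite !big_cons mact_r IH clif_act_vZ clif_act_r_spin_vec scalerA -cisD.
by rewrite opprD addrC.
Qed.

(** True when the chosen lift of A is [- chd_alpha]. *)
Definition alpha_sign (s : bool) : bool := odd ((k * k.+1)./2) (+) ~~ s.

Lemma alpha_pmE s : chd_alpha_pm R k s = (sgn (~~ alpha_sign s)) *: chd_alpha R k.
Proof.
rewrite /chd_alpha_pm /alpha_sign -signr_odd; case: (odd _); case: s => /=;
  by rewrite ?mulN1r ?mul1r ?opprK ?scaleN1r ?scale1r.
Qed.

Definition alpha_phase s sg : R :=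
  pi * (alpha_sign s)%:R - \sum_(j < k) half_angle j * sgn (sg (rev_ord j)).

Lemma clif_act_alpha_pm s sg :
  clif_act (chd_alpha_pm R k s) (spin_vec sg) = cis (alpha_phase s sg) *: spin_vec sg.
Proof.
rewrite alpha_pmE clif_actZ clif_act_alpha_spin_vec scalerA /alpha_phase cisD.
congr (_ * _ *: _); case: (alpha_sign s); rewrite ?mulr1 ?mulr0 ?cis0 //.
by rewrite /cis cospi sinpi; apply/eqP; rewrite eq_complex /= !eqxx.
Qed.

(** The basis dual to [spin_vec]: in each slot (1, - i e) / 2 is dual to (1, i e) for the two signs
    e. *)
Definition spin_dual sg (t : {ffun 'I_k -> 'I_2}) : C :=
  \prod_l (2^-1 * (if t l == 0 then 1 else (- 'i%C * (sgn (sg l))%:C))).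

Definition spin_coord sg v : C := \sum_t spin_dual sg t * v t.

Lemma sum_bool (F : bool -> C) : \sum_b F b = F true + F false.
Proof. by rewrite big_bool. Qed.

Lemma mul_ii : 'i%C * 'i%C = -1 :> C. Proof. by rewrite -expr2 sqr_i. Qed.

Lemma half_add_half : 2^-1 + 2^-1 = 1 :> C.
Proof. by rewrite [RHS]splitr !div1r. Qed.

Lemma half_im_mul (z z' : C) : 2^-1 * (- 'i%C * z) * ('i%C * z') = 2^-1 * (z * z').
Proof. by rewrite -mulrA mulrACA mulNr mul_ii opprK mul1r. Qed.

Lemma Sigma_scaleE (c : C) v s : (c *: v) s = c * v s.
Proof. by rewrite ffunE. Qed.

Lemma spin_site_sum (a b : 'I_2) :
  \sum_(c : bool) 2^-1 * (if a == 0 then 1 else - 'i%C * (sgn c)%:C) *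
    (if b == 0 then 1 else 'i%C * (sgn c)%:C) = (a == b)%:R :> C.
Proof.
rewrite sum_bool /=; move: a b; apply: ord2_case; apply: ord2_case => /=.
- by rewrite !mulr1 half_add_half.
- by rewrite !mulr1 !rmorphN1 !mulrN1 mulrN addrN.
- by rewrite !mulr1 !rmorphN1 !mulrN1 opprK mulrN addNr.
- by rewrite !half_im_mul !rmorphN1 mulrNN !mulr1 half_add_half.
Qed.

Lemma spin_site_sum_dual (c c' : bool) :
  \sum_(a : 'I_2) 2^-1 * (if a == 0 then 1 else - 'i%C * (sgn c)%:C) *
    (if a == 0 then 1 else 'i%C * (sgn c')%:C) = (c == c')%:R :> C.
Proof.
rewrite !big_ord_recl big_ord0 addr0 /= !mulr1.
rewrite half_im_mul.
by case: c; case: c'; rewrite /= ?rmorphN1 ?mulrNN ?mulr1 ?mulrN1 ?mulrN ?half_add_half ?mulr1 ?addrN.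
Qed.

Lemma prod_eq_delta (T : eqType) (f g : 'I_k -> T) :
  \prod_l ((f l == g l)%:R : C) = ([forall l, f l == g l])%:R.
Proof.
case: forallP => [h|h]; first by apply: big1 => l _; rewrite h.
have [l fgl] : exists l, f l != g l.
  by apply: contrapT => h'; apply: h => l; apply/negPn/negP => fg; apply: h'; exists l.
by rewrite (bigD1 l) //= (negPf fgl) mul0r.
Qed.

Lemma ffun_forall_eq (T : eqType) (f g : {ffun 'I_k -> T}) : [forall l, f l == g l] = (f == g).
Proof.
by apply/forallP/eqP => [h|-> //]; apply/ffunP => l; exact/eqP.
Qed.

Lemma spin_expand v : v = \sum_sg spin_coord sg v *: spin_vec sg.
Proof.
apply/ffunP => s; rewrite sum_ffunE.
transitivity (\sum_t \sum_sg (spin_dual sg t * spin_vec sg s) * v t); last first.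
  rewrite exchange_big /=; apply: eq_bigr => sg _; rewrite Sigma_scaleE mulr_suml.
  by apply: eq_bigr => t _; rewrite mulrAC.
have K t : \sum_sg spin_dual sg t * spin_vec sg s = (t == s)%:R.
  under eq_bigr do rewrite ffunE -big_split /=.
  rewrite -(bigA_distr_bigA (fun l c => 2^-1 * (if t l == 0 then 1 else - 'i%C * (sgn c)%:C) *
    (if s l == 0 then 1 else 'i%C * (sgn c)%:C))).
  under eq_bigr do rewrite spin_site_sum.
  by rewrite prod_eq_delta ffun_forall_eq.
under eq_bigr do rewrite -mulr_suml K.
rewrite (bigD1 s) //= eqxx mul1r big1 ?addr0 // => t /negPf ->.
by rewrite mul0r.
Qed.

Lemma spin_coord_vec sg sg' : spin_coord sg (spin_vec sg') = (sg == sg')%:R.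
Proof.
rewrite /spin_coord; under eq_bigr do rewrite ffunE -big_split /=.
rewrite -(bigA_distr_bigA (fun l a => 2^-1 * (if a == 0 then 1 else - 'i%C * (sgn (sg l))%:C) *
    (if a == 0 then 1 else 'i%C * (sgn (sg' l))%:C))).
under eq_bigr do rewrite spin_site_sum_dual.
by rewrite prod_eq_delta ffun_forall_eq.
Qed.

Lemma spin_coordD sg v w : spin_coord sg (v + w) = spin_coord sg v + spin_coord sg w.
Proof.
by rewrite /spin_coord -big_split; apply: eq_bigr => t _; rewrite ffunE mulrDr.
Qed.

Lemma spin_coordZ sg (c : C) v : spin_coord sg (c *: v) = c * spin_coord sg v.
Proof.
by rewrite /spin_coord mulr_sumr; apply: eq_bigr => t _; rewrite ffunE -[c *: v t]/(c * v t) mulrCA.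
Qed.

Lemma spin_coord0 sg : spin_coord sg 0 = 0.
Proof. by rewrite -(scale0r (0 : Sigma)) spin_coordZ mul0r. Qed.

Lemma spin_coord_sum sg (I : Type) (r : seq I) (F : I -> Sigma) :
  spin_coord sg (\sum_(i <- r) F i) = \sum_(i <- r) spin_coord sg (F i).
Proof. by apply: big_morph; [exact: spin_coordD | exact: spin_coord0]. Qed.

Lemma spin_ext v w : (forall sg, spin_coord sg v = spin_coord sg w) -> v = w.
Proof.
by move=> e; rewrite (spin_expand v) (spin_expand w); apply: eq_bigr => sg _; rewrite e.
Qed.

Lemma spin_coord_last sg v :
  spin_coord sg (gamma ord_max v) = ('i%C * (sgn_prod sg)%:C) * spin_coord sg v.
Proof.
rewrite {1}(spin_expand v) gamma_sum spin_coord_sum (bigD1 sg) //= big1 => [|t ts].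
  by rewrite gammaZ gamma_last_spin_vec !spin_coordZ spin_coord_vec eqxx addr0 mulr1 mulrC.
by rewrite gammaZ gamma_last_spin_vec !spin_coordZ spin_coord_vec eq_sym (negPf ts) !mulr0.
Qed.

Lemma clif_act_sum x (I : Type) (r : seq I) (F : I -> Sigma) :
  clif_act x (\sum_(i <- r) F i) = \sum_(i <- r) clif_act x (F i).
Proof. by apply: big_morph; [exact: clif_act_vD | exact: clif_act_v0]. Qed.

Lemma spin_coord_alpha s sg v :
  spin_coord sg (clif_act (chd_alpha_pm R k s) v) = cis (alpha_phase s sg) * spin_coord sg v.
Proof.
rewrite {1}(spin_expand v) clif_act_sum spin_coord_sum (bigD1 sg) //= big1 => [|t ts].
  by rewrite clif_act_vZ clif_act_alpha_pm !spin_coordZ spin_coord_vec eqxx addr0 mulr1 mulrC.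
by rewrite clif_act_vZ clif_act_alpha_pm !spin_coordZ spin_coord_vec eq_sym (negPf ts) !mulr0.
Qed.

End SpinEigenvectors.

(** * Geometry of the manifold and equivariant spinor fields *)

Section Geometry.
Variables (R : realType) (k : nat) (M : FCHD R k).
Local Notation n := k.*2.+1.
Local Notation V := 'rV[R]_n.
Implicit Types (x y v : V) (i j : 'I_n).
Local Notation dot := (chd_dot M).

Lemma chd_dotC x y : dot x y = dot y x.
Proof. by rewrite hermC expr0 mul1r. Qed.

Lemma pair_ortho_recP (I : eqType) (f : I -> V) (s : seq I) :
  pair_ortho_rec dot (map f s) -> uniq s ->
  forall a b, a \in s -> b \in s -> a != b -> dot (f a) (f b) = 0.
Proof.
elim: s => //= c s IH /andP[] /=; rewrite andbT => /allP hc /IH{}IH /andP[cs /IH{}IH] a b.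
have hc' d : d \in s -> dot (f c) (f d) = 0 by move=> ds; apply/eqP/hc/map_f.
rewrite !inE => /orP[/eqP->|aS] /orP[/eqP->|bS]; rewrite ?eqxx //.
- by rewrite hc'.
- by rewrite chd_dotC hc'.
- exact: IH.
Qed.

Lemma dot_e i j : dot (chd_e M i) (chd_e M j) = (i == j)%:R.
Proof.
have /andP[/allP h1 h2] := chd_e_orthonormal M.
case: eqVneq => [->|ij].
  by apply/eqP/(h1 (chd_e M j)); apply/mapP; exists j; rewrite ?mem_enum.
by apply: (pair_ortho_recP h2) ij; rewrite ?enum_uniq ?mem_enum.
Qed.

Definition frame : 'M[R]_n := \matrix_i chd_e M i.

Lemma row_frame i : row i frame = chd_e M i.
Proof. exact: rowK. Qed.

Lemma dotDl x y z : dot (x + y) z = dot x z + dot y z.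
Proof. exact: linearDl. Qed.

Lemma dotZl c x y : dot (c *: x) y = c * dot x y.
Proof. exact: linearZl_LR. Qed.

Lemma dot0l x : dot 0 x = 0.
Proof. exact: linear0l. Qed.

Lemma dot_suml (I : Type) (r : seq I) (F : I -> V) y :
  dot (\sum_(a <- r) F a) y = \sum_(a <- r) dot (F a) y.
Proof.
elim: r => [|a r IH]; first by rewrite !big_nil dot0l.
by rewrite !big_cons dotDl IH.
Qed.

Lemma dot_frame (c : V) i : dot (c *m frame) (chd_e M i) = c 0 i.
Proof.
rewrite mulmx_sum_row dot_suml (bigD1 i) //= big1 => [|j ji].
  by rewrite dotZl row_frame dot_e eqxx /= mulr1 addr0.
by rewrite dotZl row_frame dot_e (negPf ji) /= mulr0.
Qed.

Lemma frame_unit : frame \in unitmx.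
Proof.
rewrite -row_free_unit -kermx_eq0; apply/eqP/row_matrixP => i.
rewrite row0; apply/rowP => j; rewrite -[LHS]dot_frame -row_mul mulmx_ker row0 dot0l.
by rewrite mxE.
Qed.

Lemma frame_expand x : x = \sum_i dot x (chd_e M i) *: chd_e M i.
Proof.
rewrite -{1}(mulmxKV frame_unit x) mulmx_sum_row; apply: eq_bigr => i _.
by rewrite row_frame -{2}(mulmxKV frame_unit x) dot_frame.
Qed.

(** The last vector is doubled: translation by a_n is g^n, which acts on spinors by alpha^n = 1 or
    -1, and only its square acts trivially in both cases. *)
Definition lattice : 'M[R]_n :=
  \matrix_i (if (i < k.*2)%N then chd_a M i else 2 *: chd_a M i).

Lemma row_lattice i : row i lattice = if (i < k.*2)%N then chd_a M i else 2 *: chd_a M i.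
Proof. exact: rowK. Qed.

Lemma lattice_unit : lattice \in unitmx.
Proof.
pose X := [tuple chd_a M i | i < n].
have bX : basis_of fullv X by exact: chd_a_basis.
pose D : 'M[R]_n := \matrix_(i, j) (coord X j (delta_mx 0 i) * if (j < k.*2)%N then 1 else 2^-1).
suff h : D *m lattice = 1%:M by have [] := mulmx1_unit h.
apply/row_matrixP => i; rewrite row_mul mulmx_sum_row row1.
rewrite [RHS](coord_basis bX (memvf _)); apply: eq_bigr => j _.
rewrite row_lattice mxE (mxE _ _ i j) -tnth_nth tnth_mktuple.
case: ifP => _; rewrite ?mulr1 // scalerA -mulrA mulVf ?mulr1 // pnatr_eq0.
Qed.

Definition height x : R := dot x (chd_e M ord_max).

Lemma heightD x y : height (x + y) = height x + height y.
Proof. exact: dotDl. Qed.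

Lemma heightZ c x : height (c *: x) = c * height x.
Proof. by rewrite /height dotZl. Qed.

Lemma height_sum (I : Type) (r : seq I) (P : pred I) (F : I -> V) :
  height (\sum_(a <- r | P a) F a) = \sum_(a <- r | P a) height (F a).
Proof. by rewrite -[in LHS]big_filter -[in RHS]big_filter /height dot_suml. Qed.

Lemma chd_A_e_last : chd_A M (chd_e M ord_max) = chd_e M ord_max.
Proof. by rewrite chd_e_last chd_A_last. Qed.

Lemma height_A x : height (chd_A M x) = height x.
Proof. by rewrite /height -{1}chd_A_e_last chd_dot_inv. Qed.

Lemma height_e i : height (chd_e M i) = (i == ord_max)%:R.
Proof. exact: dot_e. Qed.

(** A preserves height and permutes a_1, ..., a_(n-1) cyclically up to the wrap relation, so all
    these heights equal one [d]; the wrap relation gives d = - (n - 1) d. *)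
Lemma height_a i : (i < k.*2)%N -> height (chd_a M i) = 0.
Proof.
move=> ik; have k0 : (0 < k.*2)%N by exact: leq_ltn_trans ik.
have i0n : (0 < n)%N by [].
pose d := height (chd_a M (inord 0)).
have hd m : (m < k.*2)%N -> height (chd_a M (inord m)) = d.
  elim: m => // m IH mk; rewrite -(IH (ltnW mk)) -[RHS]height_A.
  by congr (height _); symmetry; apply: chd_A_next; rewrite ?inordK //; lia.
have hj j : (j < k.*2)%N -> height (chd_a M j) = d.
  by move=> jk; rewrite -(hd j jk) inord_val.
have lk : (k.*2.-1 < k.*2)%N by rewrite prednK.
have := height_A (chd_a M (inord k.*2.-1)); rewrite hd // chd_A_wrap; last first.
  by rewrite inordK ?prednK // ltnW.
rewrite -scaleN1r heightZ height_sum (eq_bigr (fun=> d)) => [|j jk]; last exact: hj.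
rewrite -(big_ord_widen n (fun=> d)) // sumr_const card_ord hj //.
rewrite mulN1r => /eqP; rewrite eq_sym -addr_eq0 -mulrS mulrn_eq0 /= => /eqP ->.
by [].
Qed.

Lemma chd_A_iter_rot m (j : 'I_k) : let t := 2 * pi * j.+1%:R / n%:R in
  (iter m (chd_A M) (chd_e M (inord j.*2)) =
    cos (m%:R * t) *: chd_e M (inord j.*2) + sin (m%:R * t) *: chd_e M (inord j.*2.+1)) /\
  (iter m (chd_A M) (chd_e M (inord j.*2.+1)) =
    - sin (m%:R * t) *: chd_e M (inord j.*2) + cos (m%:R * t) *: chd_e M (inord j.*2.+1)).
Proof.
move=> t; elim: m => [|m [IH1 IH2]].
  by rewrite mul0r cos0 sin0 oppr0 !scale0r !scale1r addr0 add0r.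
rewrite !iterS IH1 IH2 !linearD !linearZ /= chd_A_rot1 chd_A_rot2 -/t.
rewrite -natr1 mulrDl mul1r cosD sinD !scalerDr !scalerA addrACA [X in _ /\ X = _]addrACA -!scalerDl.
by split; congr (_ *: _ + _ *: _); ring.
Qed.

Lemma index_cases i : (exists j : 'I_k, i = inord j.*2 \/ i = inord j.*2.+1) \/ i = ord_max.
Proof.
have := ltn_ord i; rewrite ltnS leq_eqVlt => /orP[/eqP e|h]; first by right; apply: val_inj.
have jk : (i./2 < k)%N by lia.
left; exists (Ordinal jk) => /=; case: (boolP (odd i)) => oi; [right|left];
  by apply: val_inj; rewrite /= inordK //; lia.
Qed.

Lemma chd_A_order x : iter n (chd_A M) x = x.
Proof.
have itD m (y z : V) : iter m (chd_A M) (y + z) = iter m (chd_A M) y + iter m (chd_A M) z.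
  by elim: m => //= m ->; rewrite linearD.
have itZ m c (y : V) : iter m (chd_A M) (c *: y) = c *: iter m (chd_A M) y.
  by elim: m => //= m ->; rewrite linearZ.
have it0 m : iter m (chd_A M) (0 : V) = 0 by elim: m => //= m ->; rewrite linear0.
have e1 (j : 'I_k) : n%:R * (2 * pi * j.+1%:R / n%:R) = 2 * pi * j.+1%:R :> R.
  by rewrite mulrC divfK // pnatr_eq0.
have c1 (j : 'I_k) : cos (2 * pi * j.+1%:R) = 1 :> R /\ sin (2 * pi * j.+1%:R) = 0 :> R.
  by have := cis_2pi_int R j.+1; rewrite /cis => -[].
have he i : iter n (chd_A M) (chd_e M i) = chd_e M i.
  case: (index_cases i) => [[j [] ->]|->].
  - have [-> _] := chd_A_iter_rot n j; rewrite e1; have [-> ->] := c1 j.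
    by rewrite scale1r scale0r addr0.
  - have [_ ->] := chd_A_iter_rot n j; rewrite e1; have [-> ->] := c1 j.
    by rewrite scale1r oppr0 scale0r add0r.
  - have h m : iter m (chd_A M) (chd_e M ord_max) = chd_e M ord_max.
      by elim: m => //= m ->; exact: chd_A_e_last.
    exact: h.
rewrite {1}(frame_expand x) [RHS](frame_expand x).
rewrite (big_morph _ (itD n) (it0 n)); apply: eq_bigr => i _.
by rewrite itZ he.
Qed.

Lemma iter_chd_g m x : iter m (chd_g M) x =
  iter m (chd_A M) x + (m%:R / n%:R) *: chd_a M ord_max.
Proof.
elim: m => [|m IH]; first by rewrite mul0r scale0r addr0.
rewrite !iterS IH /chd_g linearD linearZ /= chd_A_last -addrA -scalerDl.
have -> : m.+1%:R = m%:R + 1 :> R by rewrite natr1.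
by rewrite mulrDl mul1r.
Qed.

Lemma iter_chd_g_n x : iter n (chd_g M) x = x + chd_a M ord_max.
Proof. by rewrite iter_chd_g chd_A_order divff ?pnatr_eq0 // scale1r. Qed.

(** Since g^n is translation by a_n, the inverse of g is g^(n-1) after translation by - a_n. *)
Definition chd_g_inv x : V := iter n.-1 (chd_g M) (x - chd_a M ord_max).

Lemma chd_g_add_last x y : chd_g M (x + y) = chd_g M x + chd_A M y.
Proof. by rewrite /chd_g linearD addrAC. Qed.

Lemma chd_g_invK : cancel (chd_g M) chd_g_inv.
Proof.
move=> x; rewrite /chd_g_inv -{1}chd_A_last -linearN /= -chd_g_add_last -iterSr.
by rewrite iter_chd_g_n subrK.
Qed.

Lemma chd_gK : cancel chd_g_inv (chd_g M).
Proof. by move=> x; rewrite /chd_g_inv -iterS iter_chd_g_n subrK. Qed.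

Lemma height_g x : height (chd_g M x) = height x + (n%:R)^-1.
Proof. by rewrite /chd_g heightD height_A heightZ -chd_e_last height_e eqxx mulr1. Qed.

End Geometry.

Local Opaque gamma clif_act inord chd_r.

Lemma sum_pairs (T : nmodType) (G : nat -> T) m :
  \sum_(i < m.*2) G i = \sum_(j < m) (G j.*2 + G j.*2.+1).
Proof.
elim: m => [|m IH]; first by rewrite !big_ord0.
by rewrite doubleS !big_ord_recr /= IH addrA.
Qed.

Lemma scale_combination (K : comNzRingType) (W : lmodType K) (d c s : K) (a b : W) :
  d *: (c *: a + s *: b) = c *: (d *: a) + s *: (d *: b).
Proof. by rewrite scalerDr !scalerA ![d * _]mulrC. Qed.

Lemma linear_combination (K : comNzRingType) (W : lmodType K) (f : W -> W) (c s : K) (a b a' b' : W) :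
  (forall v w, f (v + w) = f v + f w) -> (forall c v, f (c *: v) = c *: f v) ->
  f a = a' -> f b = b' -> f (c *: a + s *: b) = c *: a' + s *: b'.
Proof. by move=> fD fZ <- <-; rewrite fD !fZ. Qed.

(** * Conjugation of generators by the rotor of one coordinate plane *)

Section PairRotation.
Variables (K : comNzRingType) (W : lmodType K) (A B G : W -> W).
Hypotheses (AD : forall v w, A (v + w) = A v + A w) (AZ : forall c v, A (c *: v) = c *: A v).
Hypotheses (BD : forall v w, B (v + w) = B v + B w) (BZ : forall c v, B (c *: v) = c *: B v).
Hypotheses (GD : forall v w, G (v + w) = G v + G w) (GZ : forall c v, G (c *: v) = c *: G v).
Hypotheses (AA : forall v, A (A v) = - v) (BB : forall v, B (B v) = - v).
Hypotheses (BA : forall v, B (A v) = - A (B v)).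
Hypotheses (GA : forall v, G (A v) = - A (G v)) (GB : forall v, G (B v) = - B (G v)).
Variables (c s : K).
Let r v := c *: v + s *: A (B v).

Let AN v : A (- v) = - A v. Proof. by rewrite -scaleN1r AZ scaleN1r. Qed.
Lemma pair_rotation_other v : r (G v) = G (r v).
Proof.
have GAB : G (A (B v)) = A (B (G v)) by rewrite GA GB AN opprK.
by rewrite /r GD !GZ GAB.
Qed.

Hypothesis cs : c * c + s * s = 1.

Let Ar v : A (r v) = c *: A v - s *: B v.
Proof. by rewrite /r AD !AZ AA scalerN. Qed.

Let Br v : B (r v) = s *: A v + c *: B v.
Proof. by rewrite /r BD !BZ BA BB AN opprK addrC. Qed.

Let combine (p q : K) (a b : W) :
  p *: (c *: a - s *: b) + q *: (s *: a + c *: b) = (p * c + q * s) *: a + (q * c - p * s) *: b.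
Proof.
rewrite !scalerDr scalerN !scalerA addrACA -scalerDl; congr (_ + _).
by rewrite addrC -scalerBl.
Qed.

(** The double-angle rotation r A r^(-1) = (c^2 - s^2) A + 2 c s B, written so that no inverse of
    [r] appears. *)
Lemma pair_rotation_even v : r (A v) = (c * c - s * s) *: A (r v) + (c * s + s * c) *: B (r v).
Proof.
rewrite Ar Br combine {1}/r BA AN AA opprK; congr (_ *: _ + _ *: _).
  by rewrite -[LHS]mulr1 -cs; ring.
by rewrite -[LHS]mulr1 -cs; ring.
Qed.

Lemma pair_rotation_odd v : r (B v) = (- (c * s + s * c)) *: A (r v) + (c * c - s * s) *: B (r v).
Proof.
rewrite Ar Br combine {1}/r BB AN scalerN addrC -scaleNr; congr (_ *: _ + _ *: _).
  by rewrite -[LHS]mulr1 -cs; ring.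
by rewrite -[LHS]mulr1 -cs; ring.
Qed.

(** The contraction of two families rotated by the same angle is unchanged: the trace of an operator
    is invariant under rotation. *)
Lemma rotation_isometry (p q u w : W) :
  c *: (c *: p + s *: q) + s *: (c *: u + s *: w) +
  (- s *: (- s *: p + c *: q) + c *: (- s *: u + c *: w)) = p + w.
Proof.
rewrite !scalerDr !scalerA addrACA; congr (_ + _); rewrite addrACA -!scalerDl.
  rewrite (_ : c * c + _ = 1); last by rewrite mulrNN.
  by rewrite scale1r (_ : c * s + _ = 0) ?scale0r ?addr0 //; ring.
rewrite (_ : s * s + _ = 1); last by rewrite addrC.
by rewrite scale1r (_ : s * c + _ = 0) ?scale0r ?add0r //; ring.
Qed.

Lemma rotation_transfer (f : W -> W) (x y p q : W) : (forall v w, f (v + w) = f v + f w) ->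
  f (A x) = c *: A (f x) + s *: B (f x) -> f (B y) = - s *: A (f y) + c *: B (f y) ->
  f x = c *: p + s *: q -> f y = - s *: p + c *: q -> f (A x + B y) = A p + B q.
Proof.
move=> fD fA fB fx fy; rewrite fD fA fB fx fy !AD !BD !AZ !BZ.
exact: rotation_isometry.
Qed.

End PairRotation.

Section Equivariance.
Variables (R : realType) (k : nat).
Local Notation n := k.*2.+1.
Local Notation C := R[i].
Local Notation Sigma := (Sigma R k).
Implicit Types (v : Sigma) (i : 'I_n) (j l : 'I_k).

Lemma sum_horizontal (T : nmodType) (F : 'I_n -> T) :
  \sum_(i < n | (i < k.*2)%N) F i = \sum_(j < k) (F (inord j.*2) + F (inord j.*2.+1)).
Proof.
rewrite -(sum_pairs (fun i : nat => F (inord i))).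
rewrite (big_ord_widen n (fun i : nat => F (inord i))) //; apply: eq_bigr => i _.
by rewrite inord_val.
Qed.

Local Notation ga j := (gamma (inord j.*2)).
Local Notation gb j := (gamma (inord j.*2.+1)).

Lemma inord_pair_neq j : inord j.*2 != inord j.*2.+1 :> 'I_n.
Proof. by rewrite -val_eqE /= inord_even inord_odd; lia. Qed.

Lemma clif_act_r_other j i v : i != inord j.*2 -> i != inord j.*2.+1 ->
  clif_act (chd_r R j) (gamma i v) = gamma i (clif_act (chd_r R j) v).
Proof.
move=> h1 h2; rewrite !clif_act_r.
exact: (pair_rotation_other (gammaZ (inord j.*2)) (gammaD i) (gammaZ i)
  (fun v => gamma_anti v h1) (fun v => gamma_anti v h2)).
Qed.

Lemma clif_act_r_pair j v : let c := (cos (2 * half_angle R j))%:C in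
  let s := (sin (2 * half_angle R j))%:C in
  clif_act (chd_r R j) (ga j v) = c *: ga j (clif_act (chd_r R j) v) + s *: gb j (clif_act (chd_r R j) v) /\
  clif_act (chd_r R j) (gb j v) = - s *: ga j (clif_act (chd_r R j) v) + c *: gb j (clif_act (chd_r R j) v).
Proof.
move=> c s; have nab := inord_pair_neq j.
have nba : inord j.*2.+1 != inord j.*2 :> 'I_n by rewrite eq_sym.
pose ch := (cos (half_angle R j))%:C : C; pose sh := (sin (half_angle R j))%:C : C.
have csh : ch * ch + sh * sh = 1.
  by rewrite -!rmorphM -rmorphD -!expr2 cos2Dsin2.
have -> : c = ch * ch - sh * sh.
  by rewrite /c mulr_natl mulr2n cosD rmorphB !rmorphM.
have -> : s = ch * sh + sh * ch.
  by rewrite /s mulr_natl mulr2n sinD rmorphD !rmorphM addrC.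
rewrite !clif_act_r; split.
  exact: (pair_rotation_even (gammaD (inord j.*2)) (gammaZ (inord j.*2))
    (gammaD (inord j.*2.+1)) (gammaZ (inord j.*2.+1)) (gamma_sqr (inord j.*2))
    (gamma_sqr (inord j.*2.+1)) (fun v => gamma_anti v nba) csh).
exact: (pair_rotation_odd (gammaD (inord j.*2)) (gammaZ (inord j.*2))
    (gammaD (inord j.*2.+1)) (gammaZ (inord j.*2.+1)) (gamma_sqr (inord j.*2))
    (gamma_sqr (inord j.*2.+1)) (fun v => gamma_anti v nba) csh).
Qed.

Definition act_prod (r : seq 'I_k) v := clif_act (\prod_(j <- r) chd_r R j) v.

Lemma act_prod_nil v : act_prod [::] v = v.
Proof. by rewrite /act_prod big_nil clif_act1. Qed.

Lemma act_prod_cons j r v : act_prod (j :: r) v = clif_act (chd_r R j) (act_prod r v).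
Proof. by rewrite /act_prod big_cons mact_r. Qed.

Lemma act_prod_other r i v :
  (forall j, j \in r -> i != inord j.*2 /\ i != inord j.*2.+1) ->
  act_prod r (gamma i v) = gamma i (act_prod r v).
Proof.
elim: r => [|j r IH] h; first by rewrite !act_prod_nil.
rewrite !act_prod_cons IH => [|l lr]; last by apply: h; rewrite inE lr orbT.
by apply: clif_act_r_other; have [] := h j (mem_head _ _).
Qed.

Lemma inord_other j l : l != j ->
  [/\ inord l.*2 != inord j.*2 :> 'I_n, inord l.*2 != inord j.*2.+1 :> 'I_n,
   inord l.*2.+1 != inord j.*2 :> 'I_n & inord l.*2.+1 != inord j.*2.+1 :> 'I_n].
Proof.
by rewrite -val_eqE /= => lj; split; rewrite -val_eqE /= ?inord_even ?inord_odd; lia.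
Qed.

(** Only the rotor of index [j] moves the pair [j]; all others commute with both of its
    generators. *)
Lemma act_prod_pair r j v : uniq r -> j \in r -> let c := (cos (2 * half_angle R j))%:C in
  let s := (sin (2 * half_angle R j))%:C in
  act_prod r (ga j v) = c *: ga j (act_prod r v) + s *: gb j (act_prod r v) /\
  act_prod r (gb j v) = - s *: ga j (act_prod r v) + c *: gb j (act_prod r v).
Proof.
move=> + + c s; elim: r => //= l r IH /andP[lr ur]; rewrite inE !act_prod_cons.
have [jl _|jl /= jr] := eqVneq j l.
  rewrite -jl in lr *.
  have h j' : j' \in r -> j' != j by move=> j'r; apply: contra lr => /eqP <-.
  rewrite !act_prod_other => [|j' /h j'j|j' /h j'j].
  - exact: clif_act_r_pair.
  - by rewrite eq_sym in j'j; have [] := inord_other j'j.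
  - by rewrite eq_sym in j'j; have [] := inord_other j'j.
have [h1 h2 h3 h4] := inord_other jl.
have [-> ->] := IH ur jr.
by split; apply: (linear_combination _ _ (clif_act_vD _) (clif_act_vZ _));
  apply: clif_act_r_other.
Qed.

Variable t : bool.
Local Notation alpha := (chd_alpha_pm R k t).

Lemma alpha_act_prod v : clif_act alpha v =
  (sgn R (~~ alpha_sign k t))%:C *: act_prod (index_enum 'I_k) v.
Proof. by rewrite alpha_pmE clif_actZ. Qed.

Lemma alpha_last v : clif_act alpha (gamma ord_max v) = gamma ord_max (clif_act alpha v).
Proof.
rewrite !alpha_act_prod gammaZ act_prod_other // => j _.
by split; rewrite -val_eqE /= ?inord_even ?inord_odd; have := ltn_ord j; lia.
Qed.

Lemma alpha_pair j v : let c := (cos (2 * half_angle R j))%:C in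
  let s := (sin (2 * half_angle R j))%:C in
  clif_act alpha (ga j v) = c *: ga j (clif_act alpha v) + s *: gb j (clif_act alpha v) /\
  clif_act alpha (gb j v) = - s *: ga j (clif_act alpha v) + c *: gb j (clif_act alpha v).
Proof.
move=> c s; rewrite !alpha_act_prod !gammaZ.
have [-> ->] := act_prod_pair v (index_enum_uniq 'I_k) (mem_index_enum j).
by split; exact: scale_combination.
Qed.

(** alpha rotates the paired generators by the same angles by which the families [X] and [Y] are
    related, so the contraction with the generators is carried along. *)
Lemma alpha_horizontal (X Y : 'I_n -> Sigma) :
  (forall j, let c := (cos (2 * half_angle R j))%:C in let s := (sin (2 * half_angle R j))%:C in
    clif_act alpha (X (inord j.*2)) = c *: Y (inord j.*2) + s *: Y (inord j.*2.+1) /\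
    clif_act alpha (X (inord j.*2.+1)) = - s *: Y (inord j.*2) + c *: Y (inord j.*2.+1)) ->
  clif_act alpha (\sum_(i < n | (i < k.*2)%N) gamma i (X i)) =
  \sum_(i < n | (i < k.*2)%N) gamma i (Y i).
Proof.
move=> XY; rewrite (sum_horizontal (fun i => gamma i (X i))) (sum_horizontal (fun i => gamma i (Y i))).
rewrite (clif_act_sum _ _ (fun j => ga j (X (inord j.*2)) + gb j (X (inord j.*2.+1)))).
apply: eq_bigr => j _.
have [e1 e2] := XY j.
have [f1 _] := alpha_pair j (X (inord j.*2)).
have [_ f2] := alpha_pair j (X (inord j.*2.+1)).
apply: rotation_transfer f1 f2 e1 e2; [exact: gammaD | exact: gammaZ | exact: gammaD | exact: gammaZ
  | | exact: clif_act_vD].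
by rewrite -!rmorphM -rmorphD -!expr2 cos2Dsin2.
Qed.

End Equivariance.

Lemma iter_semiconj (T U : Type) (f : T -> U) (g : T -> T) (a : U -> U) m x :
  (forall y, f (g y) = a (f y)) -> f (iter m g x) = iter m a (f x).
Proof. by move=> fg; elim: m => //= m <-. Qed.

Lemma sum_anticommuting (R : realType) (W : lmodType R[i]) (m : nat) (T : 'I_m -> 'I_m -> W) :
  (forall i j, i != j -> T i j = - T j i) -> \sum_i \sum_j T i j = \sum_i T i i.
Proof.
move=> aT; have two : (2 : R[i]) != 0 by rewrite pnatr_eq0.
apply: (scalerI two); rewrite scaler_nat mulr2n {1}exchange_big -big_split /=.
rewrite scaler_sumr; apply: eq_bigr => i _; rewrite -big_split /= (bigD1 i) //= big1 ?addr0.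
  by rewrite scaler_nat mulr2n.
by move=> j ji; rewrite (aT i j) ?addrN // eq_sym.
Qed.

(** * Derivatives of spinor fields and equivariance *)

Section SpinorFields.
Variables (R : realType) (k : nat) (M : FCHD R k).
Local Notation n := k.*2.+1.
Local Notation V := 'rV[R]_n.
Local Notation C := R[i].
Local Notation Sigma := (Sigma R k).
Implicit Types (phi psi : V -> Sigma) (x y v w : V) (F : V -> C).

Definition component phi (t : {ffun 'I_k -> 'I_2}) : V -> C := fun y => phi y t.
Definition smS phi := forall t, csm (component phi t).
Definition pd v phi x : Sigma := [ffun t => dC v (component phi t) x].

Lemma pdE v phi x t : pd v phi x t = dC v (component phi t) x.
Proof. by rewrite ffunE. Qed.

Lemma smoothP phi : smooth phi <-> smS phi.
Proof.
split=> [h t | h t m]; first by split=> m; have [] := h t m.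
by have [] := h t.
Qed.

Lemma pderiveE v phi x : pderive v phi x = pd v phi x.
Proof. by apply/ffunP => t; rewrite !ffunE /dC !ddE. Qed.

Lemma component_pd v phi t : component (pd v phi) t = dC v (component phi t).
Proof. by apply/funext => x; rewrite /component /pd ffunE. Qed.

Lemma csm_dC v F : csm F -> csm (dC v F).
Proof. by move=> [sf sg]; split; [exact: (smf_dd v sf) | exact: (smf_dd v sg)]. Qed.

Lemma dC_sym v w F : csm F -> dC v (dC w F) = dC w (dC v F).
Proof.
move=> [sf sg]; apply/funext => x.
have E v' w' : dC v' (dC w' F) x = dd v' (dd w' (ReF F)) x +i* dd v' (dd w' (ImF F)) x by [].
by rewrite !E (dd_sym v w sf) (dd_sym v w sg).
Qed.

Lemma smS_pd v phi : smS phi -> smS (pd v phi).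
Proof. by move=> sp t; rewrite component_pd; exact: csm_dC. Qed.

Lemma pd_sym v w phi : smS phi -> pd v (pd w phi) = pd w (pd v phi).
Proof.
move=> sp; apply/funext => x; apply/ffunP => t.
apply: etrans (pdE v (pd w phi) x t) _; apply: etrans _ (esym (pdE w (pd v phi) x t)).
apply: etrans (congr1 (fun F => dC v F x) (component_pd w phi t)) _.
apply: etrans _ (esym (congr1 (fun F => dC w F x) (component_pd v phi t))).
exact: (congr1 (fun F => F x) (dC_sym v w (sp t))).
Qed.

Section MatrixOperator.
Variables (O : Sigma -> Sigma) (K : {ffun 'I_k -> 'I_2} -> {ffun 'I_k -> 'I_2} -> C).
Hypothesis OK : forall (v : Sigma) t, O v t = \sum_u K t u * v u.

Lemma component_op psi t : component (fun y => O (psi y)) t = fun y => \sum_u K t u * component psi u y.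
Proof. by apply/funext => y; rewrite /component OK. Qed.

Lemma smS_op psi : smS psi -> smS (fun y => O (psi y)).
Proof. by move=> sp t; rewrite component_op; apply: csm_sum => u; exact: csm_scale. Qed.

Lemma pd_op v psi : smS psi -> pd v (fun y => O (psi y)) = fun x => O (pd v psi x).
Proof.
move=> sp; apply/funext => x; apply/ffunP => t; rewrite OK pdE component_op.
rewrite dC_sum => [|u]; last exact: csm_scale.
by apply: eq_bigr => u _; rewrite dC_scale // pdE.
Qed.

End MatrixOperator.

Lemma gamma_matrix i (v : Sigma) t :
  gamma i v t = \sum_(u : {ffun 'I_k -> 'I_2}) (gamma_coef R i * \prod_l @gamma_factor R k i l (t l) (u
    l)) * v u.
Proof.
rewrite gammaE Sigma_scaleE ffunE mulr_sumr; apply: eq_bigr => u _.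
by rewrite mulrA.
Qed.

Lemma smS_gamma i psi : smS psi -> smS (fun y => gamma i (psi y)).
Proof. exact: (@smS_op (gamma i) _ (gamma_matrix i) psi). Qed.

Lemma pd_gamma i v psi : smS psi -> pd v (fun y => gamma i (psi y)) = fun x => gamma i (pd v psi x).
Proof. exact: (@pd_op (gamma i) _ (gamma_matrix i) v psi). Qed.

Lemma component_sum (I : Type) (r : seq I) (P : pred I) (F : I -> V -> Sigma) t :
  component (fun y => \sum_(i <- r | P i) F i y) t = fun y => \sum_(i <- r | P i) component (F i) t y.
Proof. by apply/funext => y; rewrite /component sum_ffunE. Qed.

Lemma pd_sum v (I : Type) (r : seq I) (P : pred I) (F : I -> V -> Sigma) :
  (forall i, smS (F i)) ->
  pd v (fun y => \sum_(i <- r | P i) F i y) = fun x => \sum_(i <- r | P i) pd v (F i) x.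
Proof.
move=> sF; apply/funext => x; apply/ffunP => t; rewrite pdE component_sum sum_ffunE.
rewrite (_ : (fun y => _) = fun y => \sum_(i <- [seq i <- r | P i]) component (F i) t y); last first.
  by apply/funext => y; rewrite big_filter.
rewrite dC_sum => [|i]; last exact: sF.
by rewrite big_filter; apply: eq_bigr => i _; rewrite pdE.
Qed.

Local Notation e i := (chd_e M i).

Lemma dirac_pd phi x : Defs.dirac M phi x = \sum_(i < n) gamma i (pd (e i) phi x).
Proof. by apply: eq_bigr => i _; rewrite pderiveE. Qed.

(** Mixed derivatives are symmetric while distinct generators anticommute, so only the diagonal
    terms survive, with sign -1. *)
Lemma dirac_sqr phi : smS phi -> forall x,
  Defs.dirac M (Defs.dirac M phi) x = - \sum_i pd (e i) (pd (e i) phi) x.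
Proof.
move=> sp x; rewrite dirac_pd.
have -> : Defs.dirac M phi = fun y => \sum_(i < n) gamma i (pd (e i) phi y).
  by apply/funext => y; exact: dirac_pd.
transitivity (\sum_j \sum_i gamma j (gamma i (pd (e j) (pd (e i) phi) x))).
  apply: eq_bigr => j _.
  have -> := @pd_sum (e j) _ (index_enum 'I_n) xpredT (fun i y => gamma i (pd (e i) phi y))
    (fun i => smS_gamma i (smS_pd (e i) sp)).
  rewrite gamma_sum; apply: eq_bigr => i _; congr (gamma _ _).
  exact: (congr1 (fun F : V -> Sigma => F x) (@pd_gamma i (e j) (pd (e i) phi) (smS_pd (e i) sp))).
rewrite sum_anticommuting => [|i j ij]; last first.
  by rewrite (gamma_anti _ ij) (pd_sym (e i) (e j) sp).
by rewrite -sumrN; apply: eq_bigr => i _; rewrite gamma_sqr.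
Qed.

Lemma scale_matrix (c : C) (v : Sigma) t : (c *: v) t = \sum_u (c * (t == u)%:R) * v u.
Proof.
rewrite Sigma_scaleE (bigD1 t) //= eqxx mulr1 big1 ?addr0 // => u ut.
by rewrite eq_sym (negPf ut) mulr0 mul0r.
Qed.

Lemma dirac_scale (c : C) phi : smS phi -> forall x,
  Defs.dirac M (fun y => c *: phi y) x = c *: Defs.dirac M phi x.
Proof.
move=> sp x; rewrite !dirac_pd scaler_sumr; apply: eq_bigr => i _.
by rewrite (pd_op (scale_matrix c) _ sp) gammaZ.
Qed.

Lemma eigen_laplace lam phi : smS phi -> (forall x, Defs.dirac M phi x = lam%:C *: phi x) ->
  forall t, [/\ forall x, lap (frame M) (ReF (component phi t)) x = - (lam ^+ 2) * ReF (component phi t) x &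
    forall x, lap (frame M) (ImF (component phi t)) x = - (lam ^+ 2) * ImF (component phi t) x].
Proof.
move=> sp dp t.
have h x : \sum_i dC (e i) (dC (e i) (component phi t)) x = - (lam ^+ 2)%:C * component phi t x.
  transitivity ((\sum_i pd (e i) (pd (e i) phi) x) t).
    by rewrite sum_ffunE; apply: eq_bigr => i _; rewrite pdE component_pd.
  have e1 : \sum_i pd (e i) (pd (e i) phi) x = - (lam ^+ 2)%:C *: phi x.
    rewrite -[LHS]opprK -dirac_sqr // (_ : Defs.dirac M phi = fun y => lam%:C *: phi y); last exact/funext.
    by rewrite dirac_scale // dp scalerA -scaleNr -rmorphM expr2.
  by rewrite e1 Sigma_scaleE.
have re_sum (F : 'I_n -> C) : complex.Re (\sum_i F i) = \sum_i complex.Re (F i) by exact: raddf_sum.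
have im_sum (F : 'I_n -> C) : complex.Im (\sum_i F i) = \sum_i complex.Im (F i) by exact: raddf_sum.
split=> x.
  have := congr1 (@complex.Re R) (h x); rewrite re_sum /lap /ReF /=.
  under [X in _ -> X = _]eq_bigr do rewrite row_frame.
  move=> ->; case: (component phi t x) => a b /=; rewrite oppr0 mul0r subr0 //.
have := congr1 (@complex.Im R) (h x); rewrite im_sum /lap /ImF /=.
under [X in _ -> X = _]eq_bigr do rewrite row_frame.
by move=> ->; case: (component phi t x) => a b /=; rewrite oppr0 mul0r addr0.
Qed.

Section SpinStructure.
Variables (s : bool) (h : (V -> V) -> clifford R n).
Hypotheses (h_spin : spin_structure M s h) (k_gt0 : (0 < k)%N).
Local Notation alpha := (chd_alpha_pm R k s).

Definition inv_field phi := (forall (j : 'I_n) x, (j < k.*2)%N -> phi (x + chd_a M j) = phi x) /\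
  (forall x, phi (chd_g M x) = clif_act alpha (phi x)).

(** Unitality is not a field of the structure; it follows by composing [id] with a translation on
    which [h] is 1, which exists because k > 0. *)
Lemma h_id : h id = 1.
Proof.
have j0 : (0 < k.*2)%N by lia.
pose j := @inord k.*2 0; have jk : (j < k.*2)%N by rewrite inordK.
have := spin_str_morph h_spin (chd_group_id M) (chd_group_tr M jk).
by rewrite (_ : id \o chd_tr M j = chd_tr M j) // (spin_str_tr h_spin jk) mulr1.
Qed.

(** The form phi (u x) = h u . phi x passes from the generators to composites and inverses, because
    elements of Spin(n) act multiplicatively. *)
Lemma spinor_fieldP phi : spinor_field M h phi <-> smS phi /\ inv_field phi.
Proof.
split=> [[/smoothP sp ip] | [sp [pa pg]]].
  split=> //; split=> [j x jk | x].
    have K : cancel (chd_tr M j) (fun y => y - chd_a M j) by move=> y; rewrite /chd_tr addrK.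
    have K' : cancel (fun y => y - chd_a M j) (chd_tr M j) by move=> y; rewrite /chd_tr subrK.
    have := ip _ _ (chd_group_tr M jk) K K' (x + chd_a M j).
    by rewrite (spin_str_tr h_spin jk) clif_act1 addrK.
  have := ip _ _ (chd_group_g M) (chd_g_invK M) (chd_gK M) (chd_g M x).
  by rewrite (spin_str_g h_spin) chd_g_invK.
split; first exact/smoothP.
have key u : chd_group M u -> forall x, phi (u x) = clif_act (h u) (phi x).
  elim=> {u} [x|j jk x|x|u v gu IHu gv IHv x|u v gu IHu uv vu x].
  - by rewrite h_id clif_act1.
  - by rewrite (spin_str_tr h_spin jk) clif_act1 pa.
  - by rewrite (spin_str_g h_spin) pg.
  - by rewrite (spin_str_morph h_spin gu gv) (mact_spin (spin_str_spin h_spin gu)) -IHv -IHu.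
  - have gv := chd_group_inv gu uv vu.
    have hvu : h v * h u = 1.
      by rewrite -(spin_str_morph h_spin gv gu) -h_id; congr h; apply/funext => y; exact: uv.
    by rewrite -{2}(vu x) IHu -(mact_spin (spin_str_spin h_spin gv)) hvu clif_act1.
by move=> u v gu uv vu x; rewrite -key // vu.
Qed.

(** The phase of alpha on [spin_vec sg] in units of - pi / n: the rotor of index j contributes j + 1
    units up to sign, a change of sign of the lift n units. *)
Definition phase_int (sg : {ffun 'I_k -> bool}) : int :=
  \sum_(j < k) j.+1%:Z * (if sg (rev_ord j) then 1 else -1) - n%:Z * (alpha_sign k s)%:Z.

Lemma alpha_phaseE sg : alpha_phase R s sg = - (pi / n%:R * (phase_int sg)%:~R).
Proof.
have n0 : n%:R != 0 :> R by rewrite pnatr_eq0.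
rewrite /alpha_phase /phase_int rmorphB rmorph_sum /= mulrBr opprB; congr (_ - _).
  by rewrite rmorphM /= -!pmulrn mulrA divfK.
rewrite mulr_sumr; apply: eq_bigr => j _; rewrite /half_angle rmorphM /= -pmulrn mulrA.
by rewrite -[j.+1%:R * pi / _]mulrA; move: (pi / _) (j.+1%:R) => p q; case: (sg _) => /=;
  rewrite ?rmorphN1; ring.
Qed.

(** Translation by 2 a_n is g^(2n), and alpha^(2n) has eigenphases - 2 pi [phase_int], hence acts
    trivially. *)
Lemma inv_field_lattice phi : inv_field phi ->
  forall j x, phi (x + row j (lattice M)) = phi x.
Proof.
move=> [pa pg] j x; rewrite row_lattice; case: ifPn => jk; first exact: pa.
have -> : j = ord_max by apply: val_inj => /=; have := ltn_ord j; lia.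
have it m y : phi (iter m (chd_g M) y) = iter m (clif_act alpha) (phi y).
  exact: iter_semiconj.
rewrite scaler_nat mulr2n addrA -!iter_chd_g_n -iterD it.
apply: spin_ext => sg.
have ic m (v : Sigma) : spin_coord sg (iter m (clif_act alpha) v) =
  cis (m%:R * alpha_phase R s sg) * spin_coord sg v.
  elim: m => [|m IH]; first by rewrite mul0r cis0 mul1r.
  rewrite iterS spin_coord_alpha IH mulrA -cisD; congr (cis _ * _).
  by rewrite mulrS mulrDl mul1r.
rewrite ic alpha_phaseE natrD.
have -> : (n%:R + n%:R) * - (pi / n%:R * (phase_int sg)%:~R) = 2 * pi * (- phase_int sg)%:~R :> R.
  have n0 : n%:R != 0 :> R by rewrite pnatr_eq0.
  by rewrite mulrNz; move: (phase_int sg)%:~R n%:R n0 => p q q0; field.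
by rewrite cis_2pi_int mul1r.
Qed.

Lemma eigenspinorP lam phi : eigenspinor M h lam phi <->
  [/\ smS phi, inv_field phi & forall x, Defs.dirac M phi x = lam%:C *: phi x].
Proof.
split=> [[/spinor_fieldP[sp ip] dp]|[sp ip dp]]; first by [].
by split=> //; apply/spinor_fieldP.
Qed.

Lemma eigenspinor_ceig lam phi t : eigenspinor M h lam phi ->
  ceig (lattice M) (frame M) (lam ^+ 2) (component phi t).
Proof.
move=> /eigenspinorP[sp ip dp]; have [l1 l2] := eigen_laplace sp dp t.
have per := inv_field_lattice ip; have [s1 s2] := sp t.
by split; split=> // j x; rewrite /ReF /ImF /component per.
Qed.

End SpinStructure.

End SpinorFields.

(** * Eigenspaces of the Dirac operator *)

(** A subspace of maximal dimension inside [P] contains every vector of [P], since otherwise a line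
    could be added to it. The predicate may thus be undecidable. *)
Lemma closed_is_vspace (K : fieldType) (X : vectType K) (P : X -> Prop) :
  P 0 -> (forall a x y, P x -> P y -> P (a *: x + y)) ->
  exists U : {vspace X}, forall x, x \in U <-> P x.
Proof.
move=> P0 PD; pose Q d := `[< exists2 U : {vspace X}, \dim U = d & forall x, x \in U -> P x >].
have Q0 : exists d, Q d.
  exists 0%N; apply/asboolP; exists 0%VS; first exact: dimv0.
  by move=> x; rewrite memv0 => /eqP ->.
have Qb d : Q d -> (d <= \dim {:X})%N by move=> /asboolP[U <- _]; rewrite dimvS ?subvf.
case: (ex_maxnP Q0 Qb) => d /asboolP[U dU UP] dmax; exists U => x; split; first exact: UP.
move=> Px; have QU : Q (\dim (U + <[x]>)).
  apply/asboolP; exists (U + <[x]>)%VS => // y /memv_addP[u uU [v /vlineP[a ->] ->]].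
  by rewrite addrC; apply: PD => //; exact: UP.
have /eqP E : U == (U + <[x]>)%VS.
  by rewrite -(dimv_leqif_eq (addvSl _ _)) eqn_leq dimvS ?addvSl //= dU dmax.
by rewrite E; apply: (subvP (addvSr _ _)); exact: memv_line.
Qed.

(* f^2 is injective modulo ker f, so f : U -> V and f : V -> U have the same rank *)
Lemma swapped_rank (K : fieldType) (X : vectType K) (f : 'End(X)) (U V : {vspace X}) :
  (f @: U <= V)%VS -> (f @: V <= U)%VS -> (forall x, f (f x) = 0 -> f x = 0) ->
  (\dim (f @: U) = \dim (f @: V))%N.
Proof.
move=> fU fV f2.
have le U' V' : (f @: U' <= V')%VS -> (\dim (f @: U') <= \dim (f @: V'))%N.
  move=> h; rewrite -(@limg_dim_eq _ _ _ f (f @: U')); first by rewrite dimvS // limgS.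
  apply/eqP; rewrite -subv0; apply/subvP => x /memv_capP[/memv_imgP[u _ ->]].
  by rewrite memv_ker memv0 => /eqP /f2 ->.
by apply/eqP; rewrite eqn_leq !le.
Qed.

Lemma dim_supported (K : fieldType) (I : finType) (A : {pred I}) (U : {vspace {ffun I -> K^o}}) :
  (forall x : {ffun I -> K^o}, x \in U <-> forall i, i \notin A -> x i = 0) -> \dim U = #|A|.
Proof.
move=> UP; pose d i : {ffun I -> K^o} := [ffun j => (j == i)%:R].
have sumd (c : 'I_#|A| -> K) (l : 'I_#|A|) : (\sum_(i < #|A|) c i *: d (enum_val i)) (enum_val l) = c l.
  rewrite sum_ffunE (bigD1 l) //= big1 => [|i il].
    by rewrite !ffunE eqxx addr0 /GRing.scale /= mulr1.
  rewrite !ffunE (_ : (_ == _) = false) /GRing.scale /= ?mulr0 //.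
  by apply/negbTE; apply: contra il => /eqP /enum_val_inj ->.
pose X := [tuple d (enum_val i) | i < #|A|].
suff h : basis_of U X by have := size_basis h.
rewrite /basis_of eqEsubv; apply/andP; split; first (apply/andP; split).
- apply/span_subvP => x /tnthP[i ->]; rewrite tnth_mktuple; apply/UP => j jA.
  by rewrite ffunE; case: eqP jA => // ->; rewrite enum_valP.
- apply/subvP => x /UP xU.
  have -> : x = \sum_(i < #|A|) x (enum_val i) *: d (enum_val i).
    apply/ffunP => j; have [jA|jA] := boolP (j \in A).
      by rewrite -(enum_rankK_in jA jA) sumd.
    rewrite xU // sum_ffunE big1 // => i _; rewrite !ffunE (_ : (j == _) = false).
      by rewrite /GRing.scale /= mulr0.
    by apply: contraNF jA => /eqP ->; exact: enum_valP.
  apply: memv_suml => i _; apply: memvZ; apply: memv_span.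
  by apply/tnthP; exists i; rewrite tnth_mktuple.
- apply/freeP => c h l; rewrite -(sumd c l).
  rewrite (_ : \sum_i _ = \sum_i c i *: X`_i); first by rewrite h ffunE.
  by apply: eq_bigr => i _; rewrite -tnth_nth tnth_mktuple.
Qed.

Definition box (k N : nat) : seq 'rV[int]_k.*2.+1 :=
  [seq \row_j ((f j : nat)%:Z - N%:Z) | f : {ffun 'I_k.*2.+1 -> 'I_(N.*2.+1)}].

Lemma box_uniq k N : uniq (box k N).
Proof.
rewrite map_inj_uniq ?enum_uniq // => f g /rowP e; apply/ffunP => j.
by have := e j; rewrite !mxE => /addIr [] /val_inj.
Qed.

Lemma mem_box k N (m : 'rV[int]_k.*2.+1) : (forall j, `|m 0 j| <= N%:Z) -> m \in box k N.
Proof.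
move=> h; apply/mapP; exists [ffun j => inord `|(m 0 j + N%:Z)%R|%N]; first by rewrite mem_enum.
apply/rowP => j; rewrite mxE ffunE; have := h j; move: (m 0 j) => z zN.
by rewrite inordK; lia.
Qed.

Section Frequencies.
Variables (R : realType) (k : nat).
Local Notation n := k.*2.+1.
Local Notation V := 'rV[R]_n.
Local Notation C := R[i].
Variables (B E : 'M[R]_n).
Hypotheses (B_unit : B \in unitmx) (E_unit : E \in unitmx).
Implicit Types (m p q : 'rV[int]_n) (x y v : V).

Lemma chiD m x y : chi B m (x + y) = chi B m x * chi B m y.
Proof. by rewrite /chi (wave_add (@freq_linear _ _ B m)) cisD. Qed.

Lemma chi0 m : chi B m 0 = 1.
Proof. by rewrite /chi (wave0 (@freq_linear _ _ B m)) cis0. Qed.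

Lemma row_basis_expand (A : 'M[R]_n) x : A \in unitmx -> x = \sum_i (x *m invmx A) 0 i *: row i A.
Proof. by move=> uA; rewrite -mulmx_sum_row mulmxKV. Qed.

Lemma eq_linear_rows (w w' : V -> R) : linear w -> linear w' ->
  (forall j, w (row j B) = w' (row j B)) -> w =1 w'.
Proof.
move=> lw lw' e x; rewrite (row_basis_expand x B_unit) (wave_sum lw) (wave_sum lw').
by apply: eq_bigr => i _; rewrite (wave_scale lw) (wave_scale lw') e.
Qed.

Lemma freq_inj m p : freq B m =1 freq B p -> m = p.
Proof.
move=> e; apply/rowP => j; have := e (row j B); rewrite !freq_row // => h.
by apply: (@intr_inj R); apply: (mulfI _ h); rewrite mulf_neq0 ?pnatr_eq0 // gt_eqF ?pi_gt0.
Qed.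

Lemma chi_separates m p : m != p -> exists v, chi B m v != chi B p v.
Proof.
move=> mp; have [j /eqP mpj] : exists j, m 0 j <> p 0 j.
  by apply/existsNP => h; case/eqP: mp; apply/rowP.
pose d : R := (m 0 j - p 0 j)%:~R.
have d0 : d != 0 by rewrite intr_eq0 subr_eq0.
(* At this vector the two phases differ by exactly pi, so the characters take opposite values. *)
exists ((2 * d)^-1 *: row j B); apply/eqP => h.
have : chi B m ((2 * d)^-1 *: row j B) / chi B p ((2 * d)^-1 *: row j B) = 1.
  by rewrite h divff // cis_neq0.
rewrite /chi; set a := freq B m _; set b := freq B p _.
have -> : (cis b)^-1 = cis (- b) by rewrite -[RHS]mulr1 -(divff (cis_neq0 b)) mulrA cisN mul1r.
rewrite -cisD; have -> : a - b = pi.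
  rewrite /a /b !(wave_scale (@freq_linear _ _ B _)) !freq_row // -mulrBr -mulrBr -intrB -/d.
  have half (u w : R) : u != 0 -> (2 * u)^-1 * (2 * w * u) = w by move=> u0; field.
  exact: half.
by move/(congr1 (@complex.Re R)); rewrite /cis /= cospi => e1; have : (0 : R) < 1 := ltr01; lra.
Qed.

(** Independence of characters: for [v] separating m from q, the relation translated by [v] minus
    chi_q(v) times the relation no longer involves q. *)
Lemma chi_free (s : seq 'rV[int]_n) (c : 'rV[int]_n -> C) : uniq s ->
  (forall y, \sum_(m <- s) c m * chi B m y = 0) -> forall m, m \in s -> c m = 0.
Proof.
elim: s c => [//|q s IH] c /= /andP[qs us] h.
have cs m : m \in s -> c m = 0.
  move=> ms; have [v nv] : exists v, chi B m v != chi B q v.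
    by apply: chi_separates; apply: contraNneq qs => <-.
  have /eqP : c m * (chi B m v - chi B q v) = 0.
    apply: (IH (fun m => c m * (chi B m v - chi B q v)) us) => // y.
    have h1 := h (y + v); have := congr1 (fun z => chi B q v * z) (h y).
    rewrite big_cons in h1; rewrite big_cons mulr0 mulrDr => h2.
    transitivity ((c q * chi B q (y + v) + \sum_(j <- s) c j * chi B j (y + v)) -
      (chi B q v * (c q * chi B q y) + chi B q v * \sum_(j <- s) c j * chi B j y)); last first.
      by rewrite h1 h2 subr0.
    rewrite chiD (_ : c q * _ = chi B q v * (c q * chi B q y)); last by ring.
    rewrite [RHS]addrC opprD addrACA addrA addNr add0r [RHS]addrC mulr_sumr -sumrB.
    by apply: eq_bigr => j _; rewrite chiD; ring.
  by rewrite mulf_eq0 subr_eq0 (negPf nv) orbF => /eqP.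
move=> m; rewrite inE => /predU1P[->|]; last exact: cs.
have := h 0; rewrite big_cons chi0 mulr1 big1_seq ?addr0 // => j /andP[_ js].
by rewrite (cs j js) mul0r.
Qed.

Lemma freq_sqr_ge0 m : 0 <= freq_sqr B E m.
Proof. by apply: sumr_ge0 => i _; exact: sqr_ge0. Qed.

(** 2 pi m_j is the value of [freq m] at row j of B, and on each frame vector this form is bounded
    by the square root of [freq_sqr m]. Finiteness of levels, the spectral gap and summability all
    rest on this. *)
Lemma coefficient_bound : exists2 K : R, 0 < K & forall m j, (m 0 j)%:~R ^+ 2 <= K * freq_sqr B E m.
Proof.
pose c j := \sum_i `|(row j B *m invmx E) 0 i|.
exists (1 + \sum_j (c j / (2 * pi)) ^+ 2).
  by rewrite ltr_pwDl // sumr_ge0 // => j _; exact: sqr_ge0.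
move=> m j; have p2 : 0 < 2 * pi :> R by rewrite mulr_gt0 ?pi_gt0.
have h : `|freq B m (row j B)| <= c j * Num.sqrt (freq_sqr B E m).
  rewrite {1}(row_basis_expand (row j B) E_unit) (wave_sum (@freq_linear _ _ B m)).
  apply: le_trans (ler_norm_sum _ _ _) _; rewrite mulr_suml; apply: ler_sum => i _.
  rewrite (wave_scale (@freq_linear _ _ B m)) normrM ler_wpM2l //.
  rewrite -sqrtr_sqr ler_wsqrtr // /freq_sqr (bigD1 i) //= lerDl sumr_ge0 // => l _; exact: sqr_ge0.
have e : (m 0 j)%:~R ^+ 2 = (`|freq B m (row j B)| / (2 * pi)) ^+ 2.
  by rewrite freq_row // normrM (gtr0_norm p2) mulrAC divff ?gt_eqF // mul1r real_normK ?num_real.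
rewrite e; apply: le_trans (_ : (c j * Num.sqrt (freq_sqr B E m) / (2 * pi)) ^+ 2 <= _).
  rewrite ler_sqr ?nnegrE ?divr_ge0 ?mulr_ge0 ?sqrtr_ge0 ?sumr_ge0 ?(ltW p2) ?pi_ge0 //.
  by rewrite ler_pM2r ?invr_gt0.
rewrite mulrAC exprMn sqr_sqrtr ?freq_sqr_ge0 // ler_wpM2r ?freq_sqr_ge0 //.
by rewrite (bigD1 j) //= addrCA lerDl addr_ge0 // sumr_ge0 // => i _; exact: sqr_ge0.
Qed.

Lemma freq_sqr_gt0 m : m != 0 -> 0 < freq_sqr B E m.
Proof.
move=> m0; have [K K0 hK] := coefficient_bound.
have [j mj] : exists j, m 0 j != 0.
  apply: contrapT => nh; case/eqP: m0; apply/rowP => j; rewrite mxE.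
  by apply/eqP/negPn/negP => mj; apply: nh; exists j.
have := hK m j; rewrite -(pmulr_rgt0 _ K0); apply: lt_le_trans.
by rewrite exprn_even_gt0 // intr_eq0.
Qed.

Lemma freq_level_finite L : exists2 s : seq 'rV[int]_n, uniq s & forall m,
  (m \in s) = (freq_sqr B E m == L).
Proof.
have [K K0 hK] := coefficient_bound.
pose N := `|Num.ceil (K * L)|%N.
exists [seq m <- box k N | freq_sqr B E m == L]; first by rewrite filter_uniq // box_uniq.
move=> m; rewrite mem_filter; case: eqP => //= mL; apply: mem_box => j.
have := hK m j; rewrite mL => h.
have KL : K * L <= N%:R.
  by apply: le_trans (ceil_ge _) _; rewrite natr_absz ler_int ler_norm.
have {}h : m 0 j ^+ 2 <= N%:Z.
  by rewrite -(ler_int R) rmorphXn /=; apply: le_trans h _.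
by move: h; nia.
Qed.

End Frequencies.

(** * The Dirac operator and S on a single Fourier mode *)

Section CliffordSymbol.
Variables (R : realType) (W : lmodType R[i]) (n : nat) (G : 'I_n -> W -> W) (l : 'I_n).
Local Notation C := R[i].
Hypotheses (GD : forall i v w, G i (v + w) = G i v + G i w) (GZ : forall i c v, G i (c *: v) = c *: G i v).
Hypotheses (GG : forall i v, G i (G i v) = - v) (Ganti : forall i j v,
  i != j -> G i (G j v) = - G j (G i v)).
Variables (P : pred 'I_n) (a : 'I_n -> C).
Hypothesis Pl : forall i, P i = (i != l).

Definition horizontal_symbol v := \sum_(i | P i) a i *: G i v.
Definition full_symbol v := \sum_i a i *: G i v.
Definition vertical_horizontal v := G l (horizontal_symbol v).
Local Notation H := horizontal_symbol.
Local Notation D := full_symbol.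
Local Notation S := vertical_horizontal.

Lemma clifford_map0 i : G i 0 = 0.
Proof. by rewrite -[X in G i X](scale0r (0 : W)) GZ scale0r. Qed.

Lemma clifford_map_sum i (I : Type) (r : seq I) (Q : pred I) (F : I -> W) :
  G i (\sum_(x <- r | Q x) F x) = \sum_(x <- r | Q x) G i (F x).
Proof. by apply: (big_morph (G i) (GD i)); exact: clifford_map0. Qed.

Lemma clifford_mapN i v : G i (- v) = - G i v.
Proof. by rewrite -scaleN1r GZ scaleN1r. Qed.

Lemma horizontal_symbolZ c v : H (c *: v) = c *: H v.
Proof. by rewrite scaler_sumr; apply: eq_bigr => i _; rewrite GZ !scalerA mulrC. Qed.

Lemma horizontal_symbolD v w : H (v + w) = H v + H w.
Proof. by rewrite -big_split; apply: eq_bigr => i _; rewrite GD scalerDr. Qed.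

Lemma horizontal_symbol_last v : H (G l v) = - G l (H v).
Proof.
rewrite clifford_map_sum -sumrN; apply: eq_bigr => i; rewrite Pl => il.
by rewrite (Ganti _ il) GZ scalerN.
Qed.

Lemma full_symbolE v : D v = H v + a l *: G l v.
Proof.
by rewrite addrC /full_symbol (bigD1 l) //=; congr (_ + _); apply: eq_bigl => i; rewrite Pl.
Qed.

(** H anticommutes with G_l and G_l^2 = -1, so D S = - G_l H^2 - a_l H, which is the opposite of S
    D. *)
Lemma vertical_horizontal_anti v : D (S v) = - S (D v).
Proof.
rewrite !full_symbolE /vertical_horizontal horizontal_symbol_last horizontal_symbolD GD
  horizontal_symbolZ horizontal_symbol_last.
by rewrite GG scalerN [G l (_ *: _)]GZ clifford_mapN GG opprK opprD.
Qed.

Lemma vertical_horizontalD v w : S (v + w) = S v + S w.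
Proof. by rewrite /vertical_horizontal horizontal_symbolD GD. Qed.

Lemma vertical_horizontalZ c v : S (c *: v) = c *: S v.
Proof. by rewrite /vertical_horizontal horizontal_symbolZ GZ. Qed.

Lemma horizontal_symbol_sqr v : H (H v) = - (\sum_(i | P i) a i ^+ 2) *: v.
Proof.
pose T i j := if P i && P j then (a i * a j) *: G i (G j v) else 0.
transitivity (\sum_i \sum_j T i j).
  rewrite /H big_mkcond; apply: eq_bigr => i _; case: ifPn => Pi; last first.
    by rewrite big1 // => j _; rewrite /T (negPf Pi).
  rewrite clifford_map_sum scaler_sumr big_mkcond; apply: eq_bigr => j _.
  by rewrite /T Pi /=; case: ifP => // _; rewrite GZ scalerA.
rewrite sum_anticommuting => [|i j ij]; last first.
  by rewrite /T andbC; case: ifP; rewrite ?oppr0 // mulrC (Ganti _ ij) scalerN.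
rewrite scaleNr scaler_suml -sumrN [RHS]big_mkcond; apply: eq_bigr => i _.
by rewrite /T andbb; case: ifP => // _; rewrite GG scalerN expr2.
Qed.

(** S^2 = H^2. The coefficients will be i times real frequencies, so this scalar is a sum of real
    squares. *)
Lemma vertical_horizontal_sqr v : S (S v) = - (\sum_(i | P i) a i ^+ 2) *: v.
Proof. by rewrite /vertical_horizontal horizontal_symbol_last clifford_mapN GG opprK
  horizontal_symbol_sqr. Qed.

End CliffordSymbol.

Definition horizontal (k : nat) : pred 'I_k.*2.+1 := fun j => (j < k.*2)%N.

Lemma horizontalP (k : nat) (j : 'I_k.*2.+1) : horizontal j = (j != ord_max).
Proof. by rewrite -val_eqE /horizontal /=; have := ltn_ord j; lia. Qed.

Section Superpositions.
Variables (R : realType) (k : nat) (M : FCHD R k).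
Local Notation n := k.*2.+1.
Local Notation V := 'rV[R]_n.
Local Notation C := R[i].
Local Notation Sigma := (Sigma R k).
Local Notation signs := {ffun 'I_k -> bool}.
Local Notation e i := (chd_e M i).
Local Notation B := (lattice M).
Variable s : seq 'rV[int]_n.
Hypothesis s_uniq : uniq s.
Local Notation N := (size s).
Implicit Types (i : 'I_N) (sg : signs) (y v : V).

Definition nthm i : 'rV[int]_n := nth 0 s i.
Local Notation X := {ffun 'I_N * signs -> C^o}.
Implicit Types (x : X).

(** Fields on one level are coded by coefficients with respect to characters times [spin_vec], so
    that eigenspaces become subspaces of the finite-dimensional space [X]. *)
Definition amplitude x i : Sigma := \sum_sg (x (i, sg) : C) *: spin_vec R sg.
Definition of_amplitudes (u : 'I_N -> Sigma) : X := [ffun p => spin_coord p.2 (u p.1)].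
Definition superposition x y : Sigma := \sum_i chi B (nthm i) y *: amplitude x i.

Lemma spin_coord_amplitude x i sg : spin_coord sg (amplitude x i) = x (i, sg).
Proof.
rewrite /amplitude spin_coord_sum (bigD1 sg) //= big1 => [|t ts].
  by rewrite spin_coordZ spin_coord_vec eqxx mulr1 addr0.
by rewrite spin_coordZ spin_coord_vec eq_sym (negPf ts) mulr0.
Qed.

Lemma amplitude_of u i : amplitude (of_amplitudes u) i = u i.
Proof. by apply: spin_ext => sg; rewrite spin_coord_amplitude ffunE. Qed.

Lemma amplitude_linear (c : C) x z i : amplitude (c *: x + z) i = c *: amplitude x i + amplitude z i.
Proof.
apply: spin_ext => sg; rewrite spin_coord_amplitude spin_coordD spin_coordZ !spin_coord_amplitude.
by rewrite !ffunE.
Qed.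

Lemma amplitude0 i : amplitude 0 i = 0.
Proof. by apply: spin_ext => sg; rewrite spin_coord_amplitude ffunE spin_coord0. Qed.

Lemma amplitude_ext x z : (forall i, amplitude x i = amplitude z i) -> x = z.
Proof. by move=> h; apply/ffunP => -[i sg]; rewrite -!spin_coord_amplitude h. Qed.

Lemma superposition_linear (c : C) x z y :
  superposition (c *: x + z) y = c *: superposition x y + superposition z y.
Proof.
rewrite /superposition scaler_sumr -big_split; apply: eq_bigr => i _.
by rewrite amplitude_linear scalerDr !scalerA mulrC.
Qed.

Definition wave_sum_field (u : 'I_N -> Sigma) y : Sigma := \sum_i chi B (nthm i) y *: u i.

Lemma component_wave_sum u t : component (wave_sum_field u) t = fun y =>
  \sum_(i <- index_enum 'I_N) u i t * chi B (nthm i) y.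
Proof.
apply/funext => y; rewrite /component sum_ffunE; apply: eq_bigr => i _.
by rewrite Sigma_scaleE mulrC.
Qed.

Lemma csm_chi m : csm (chi B m).
Proof. exact: csm_wave (@freq_linear _ _ B m). Qed.

Lemma wave_sum_smS u : smS (wave_sum_field u).
Proof. by move=> t; rewrite component_wave_sum; apply: csm_sum => i; apply: csm_scale; exact: csm_chi. Qed.

Lemma pd_wave_sum v u : pd v (wave_sum_field u) =
  wave_sum_field (fun i => (0 +i* freq B (nthm i) v) *: u i).
Proof.
apply/funext => y; apply/ffunP => t; apply: etrans (pdE v (wave_sum_field u) y t) _.
apply: etrans (congr1 (fun F => dC v F y) (component_wave_sum u t)) _.
rewrite dC_sum; last by move=> i; apply: csm_scale; exact: csm_chi.
apply: etrans _ (esym (congr1 (fun F => F y) (component_wave_sum _ t))).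
apply: eq_bigr => i _; rewrite dC_scale; last exact: csm_chi.
by rewrite (dC_wave (@freq_linear _ _ B (nthm i))) Sigma_scaleE mulrCA mulrA.
Qed.

Lemma chi_free_ord (c : 'I_N -> C) : (forall y, \sum_i c i * chi B (nthm i) y = 0) -> forall i, c i = 0.
Proof.
move=> h i; pose c' m := if insub (index m s) is Some j then c j else 0.
have cE j : c' (nthm j) = c j by rewrite /c' /nthm index_uniq // valK.
rewrite -cE; apply: (@chi_free R k B (lattice_unit M) s c' s_uniq); last by rewrite mem_nth.
move=> y; rewrite (big_nth 0) big_mkord -[RHS](h y); apply: eq_bigr => j _.
by rewrite -cE.
Qed.

Lemma wave_sum_inj u u' : wave_sum_field u =1 wave_sum_field u' -> u =1 u'.
Proof.
move=> h i; apply/ffunP => t; apply/eqP; rewrite -subr_eq0; apply/eqP.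
apply: (@chi_free_ord (fun i => u i t - u' i t)) => y.
have := congr1 (fun v : Sigma => v t) (h y).
have E w := congr1 (fun F => F y) (component_wave_sum w t); rewrite /component in E.
rewrite !E => /eqP; rewrite -subr_eq0 -sumrB => /eqP h'.
by rewrite -[RHS]h'; apply: eq_bigr => j _; rewrite mulrBl.
Qed.

Lemma superposition_inj x z : superposition x =1 superposition z -> x = z.
Proof. by move=> h; apply: amplitude_ext; exact: wave_sum_inj. Qed.

Lemma superposition_of u : superposition (of_amplitudes u) = wave_sum_field u.
Proof. by apply/funext => y; apply: eq_bigr => i _; rewrite amplitude_of. Qed.

Lemma trig_coefficients (L : R) F : (forall m, (m \in s) = (freq_sqr B (frame M) m == L)) ->
  trig B (frame M) L F -> exists c : 'I_N -> C, forall y, F y = \sum_i c i * chi B (nthm i) y.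
Proof.
move=> sL [l [lL FE]]; exists (fun i => \sum_(p <- l | p.1 == nthm i) p.2) => y.
rewrite FE; under [RHS]eq_bigr do rewrite big_distrl /= big_mkcond.
rewrite exchange_big /=; apply: eq_big_seq => p pl.
have ps : p.1 \in s by rewrite sL lL.
have ip : (index p.1 s < N)%N by rewrite index_mem.
rewrite (bigD1 (Ordinal ip)) //= big1 => [|i ni].
  by rewrite /nthm /= nth_index // eqxx addr0.
case: eqP => // pi; case/eqP: ni; apply: val_inj => /=.
by rewrite pi /nthm index_uniq.
Qed.

Definition freq_coef i (j : 'I_n) : C := 0 +i* freq B (nthm i) (e j).
Definition dirac_symbol i := full_symbol (@gamma R k) (freq_coef i).
Definition swap_symbol i := vertical_horizontal (@gamma R k) ord_max (@horizontal k) (freq_coef i).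

Let GD : forall (i : 'I_n) (v w : Sigma), gamma i (v + w) = gamma i v + gamma i w := @gammaD R k.
Let GZ : forall (i : 'I_n) (c : C) (v : Sigma), gamma i (c *: v) = c *: gamma i v := @gammaZ R k.
Let GG : forall (i : 'I_n) (v : Sigma), gamma i (gamma i v) = - v := @gamma_sqr R k.
Let Ganti : forall (i j : 'I_n) (v : Sigma), i != j -> gamma i (gamma j v) =
  - gamma j (gamma i v) := @gamma_anti R k.

Lemma swap_symbol_linear i (c : C) (u v : Sigma) :
  swap_symbol i (c *: u + v) = c *: swap_symbol i u + swap_symbol i v.
Proof.
apply: etrans (@vertical_horizontalD R Sigma n (@gamma R k) ord_max GD (@horizontal k) (freq_coef i) _ _) _.
exact: (congr1 (fun z => z + _) (@vertical_horizontalZ R Sigma n (@gamma R k) ord_max GZ (@horizontal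
  k) (freq_coef i) _ _)).
Qed.

Lemma swap_symbolZ i (c : C) (u : Sigma) : swap_symbol i (c *: u) = c *: swap_symbol i u.
Proof. exact: (@vertical_horizontalZ R Sigma n (@gamma R k) ord_max GZ (@horizontal k) (freq_coef i)). Qed.

Lemma swap_symbol0 i : swap_symbol i 0 = 0.
Proof. by have := swap_symbolZ i 0 0; rewrite !scale0r. Qed.

Lemma dirac_swap_symbol i (u : Sigma) : dirac_symbol i (swap_symbol i u) =
  - swap_symbol i (dirac_symbol i u).
Proof.
exact: (@vertical_horizontal_anti R Sigma n (@gamma R k) ord_max GD GZ GG Ganti (@horizontal k)
  (freq_coef i) (@horizontalP k)).
Qed.

Lemma dirac_symbol_linear i (c : C) (u v : Sigma) :
  dirac_symbol i (c *: u + v) = c *: dirac_symbol i u + dirac_symbol i v.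
Proof.
rewrite /dirac_symbol /full_symbol scaler_sumr -big_split /=; apply: eq_bigr => j _.
by rewrite GD GZ scalerDr !scalerA mulrC.
Qed.

Lemma dirac_symbol0 i : dirac_symbol i 0 = 0.
Proof. by have := dirac_symbol_linear i (-1) 0 0; rewrite scaler0 addr0 scaleN1r addNr. Qed.

Lemma freq_coef_sqr i j : freq_coef i j ^+ 2 = - (freq B (nthm i) (e j) ^+ 2)%:C.
Proof.
rewrite /freq_coef; move: (freq _ _ _) => a.
by apply/eqP; rewrite eq_complex expr2 /= !mul0r !mulr0 addr0 sub0r oppr0 -expr2 !eqxx.
Qed.

Lemma swap_symbol_sqr i (u : Sigma) : swap_symbol i (swap_symbol i u) =
  (\sum_(j < n | horizontal j) freq B (nthm i) (e j) ^+ 2)%:C *: u.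
Proof.
apply: etrans (@vertical_horizontal_sqr R Sigma n (@gamma R k) ord_max GD GZ GG Ganti (@horizontal k)
  (freq_coef i) (@horizontalP k) u) _.
congr (_ *: _); rewrite rmorph_sum -sumrN; apply: eq_bigr => j _.
by rewrite freq_coef_sqr opprK.
Qed.

Definition vertical_index i := forall j : 'I_n, (j < k.*2)%N -> freq B (nthm i) (e j) = 0.

Lemma horizontal_symbol_vertical i (u : Sigma) : vertical_index i ->
  horizontal_symbol (@gamma R k) (@horizontal k) (freq_coef i) u = 0.
Proof.
move=> vi; rewrite /horizontal_symbol big1 // => j jk.
by rewrite /freq_coef vi // [0 +i* 0](_ : _ = 0) // scale0r.
Qed.

Lemma swap_symbol_vertical i (u : Sigma) : vertical_index i -> swap_symbol i u = 0.
Proof.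
by move=> vi; rewrite /swap_symbol /vertical_horizontal (horizontal_symbol_vertical u vi) gamma0.
Qed.

Lemma dirac_symbol_vertical i (u : Sigma) : vertical_index i ->
  dirac_symbol i u = freq_coef i ord_max *: gamma ord_max u.
Proof.
move=> vi; apply: etrans (@full_symbolE R Sigma n (@gamma R k) ord_max (@horizontal k) (freq_coef i)
  (@horizontalP k) u) _.
by rewrite (horizontal_symbol_vertical u vi) add0r.
Qed.

(** S^2 multiplies by the squared horizontal frequency, so S is injective on every mode that is not
    vertical. This provides the hypothesis on f (f x) in [swapped_rank]. *)
Lemma swap_symbol_eq0 i (u : Sigma) : swap_symbol i (swap_symbol i u) = 0 -> u = 0 \/ vertical_index i.
Proof.
rewrite swap_symbol_sqr => h0; have [u0|u0] := eqVneq u 0; [by left | right].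
move/eqP: h0; rewrite scaler_eq0 (negPf u0) orbF => /eqP [] /eqP.
rewrite psumr_eq0 => [/allP z|j _]; last exact: sqr_ge0.
move=> j jk; have := z j (mem_index_enum _); rewrite /horizontal jk /=.
by rewrite sqrf_eq0 => /eqP.
Qed.

Lemma dirac_wave_sum u y :
  Defs.dirac M (wave_sum_field u) y = wave_sum_field (fun i => dirac_symbol i (u i)) y.
Proof.
rewrite dirac_pd.
transitivity (\sum_j \sum_i chi B (nthm i) y *: (freq_coef i j *: gamma j (u i))).
  apply: eq_bigr => j _; rewrite pd_wave_sum gamma_sum; apply: eq_bigr => i _.
  by rewrite !gammaZ.
by rewrite exchange_big; apply: eq_bigr => i _; rewrite scaler_sumr.
Qed.

End Superpositions.

Local Opaque amplitude of_amplitudes swap_symbol dirac_symbol.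

Section Eigenspaces.
Variables (R : realType) (k : nat) (M : FCHD R k).
Local Notation n := k.*2.+1.
Local Notation V := 'rV[R]_n.
Local Notation C := R[i].
Local Notation Sigma := (Sigma R k).
Local Notation signs := {ffun 'I_k -> bool}.
Local Notation e i := (chd_e M i).
Local Notation B := (lattice M).
Variables (sp : bool) (h : (V -> V) -> clifford R n).
Hypotheses (h_spin : spin_structure M sp h) (k_gt0 : (0 < k)%N).
Local Notation alpha := (chd_alpha_pm R k sp).
Local Notation g := (chd_g M).
Local Notation inv_field := (inv_field M sp).
Implicit Types (phi : V -> Sigma) (x y v : V) (u : Sigma).

Lemma dd_g v f x : dd v (fun y => f (g y)) x = dd (chd_A M v) f (g x).
Proof.
rewrite !ddE /derive.
suff -> : (fun t : R => t^-1 *: (((fun y => f (g y)) \o shift x) (t *: v) - f (g x))) =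
  (fun t : R => t^-1 *: ((f \o shift (g x)) (t *: chd_A M v) - f (g x))) by [].
by apply/funext => t /=; rewrite [t *: v + x]addrC chd_g_add_last linearZ [g x + _]addrC.
Qed.

Lemma pd_g v phi x : pd v (fun y => phi (g y)) x = pd (chd_A M v) phi (g x).
Proof.
apply/ffunP => t; rewrite !pdE; have E f := dd_g v f x.
exact: (congr2 (fun a b => a +i* b) (E (ReF (component phi t))) (E (ImF (component phi t)))).
Qed.

Lemma pd_translate v phi (a : V) x : pd v (fun y => phi (y + a)) x = pd v phi (x + a).
Proof.
apply/ffunP => t; rewrite !pdE.
exact: (congr1 (fun F => F x) (dC_translate v (component phi t) a)).
Qed.

Local Opaque pd.

Lemma linear_matrix (O : Sigma -> Sigma) : (forall (c : C) u w, O (c *: u + w) = c *: O u + O w) ->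
  exists K : {ffun 'I_k -> 'I_2} -> {ffun 'I_k -> 'I_2} -> C, forall u t, O u t = \sum_t' K t t' * u t'.
Proof.
move=> OL; have O0 : O 0 = 0 by have := OL (-1) 0 0; rewrite scaler0 addr0 scaleN1r addNr.
pose d t' : Sigma := [ffun t => (t == t')%:R].
exists (fun t t' => O (d t') t) => u t.
have eu : u = \sum_t' u t' *: d t'.
  apply/ffunP => t'; rewrite sum_ffunE (bigD1 t') //= big1 ?addr0 => [|t'' ne].
    by rewrite Sigma_scaleE ffunE eqxx mulr1.
  by rewrite Sigma_scaleE ffunE eq_sym (negPf ne) mulr0.
rewrite {1}eu; transitivity ((\sum_t' u t' *: O (d t')) t); last first.
  by rewrite sum_ffunE; apply: eq_bigr => t' _; rewrite Sigma_scaleE mulrC.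
congr (_ _ t); elim: (index_enum _) => [|a r IH]; first by rewrite !big_nil.
by rewrite !big_cons OL IH.
Qed.

Lemma pd_dir2 v w (c d : R) phi x : smS phi ->
  pd (c *: v + d *: w) phi x = c%:C *: pd v phi x + d%:C *: pd w phi x.
Proof.
move=> sph; apply/ffunP => t; rewrite [RHS]ffunE (Sigma_scaleE _ (pd v phi x)) (Sigma_scaleE _ (pd w
  phi x)).
rewrite (pdE (c *: v + d *: w) phi x t) (pdE v phi x t) (pdE w phi x t).
have [sr si] := sph t.
have E f : smf f -> dd (c *: v + d *: w) f x = c * dd v f x + d * dd w f x.
  by move=> sf; rewrite !ddE deriveDv ?deriveZv //; exact: smf_diff.
rewrite /dC (E _ sr) (E _ si); apply/eqP; rewrite eq_complex /= !mul0r !subr0 !addr0.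
by rewrite !eqxx.
Qed.

(* [e_n] times the horizontal part of the Dirac operator: it commutes with the group action and
   anticommutes with the whole Dirac operator. *)
Definition swap_field phi y : Sigma :=
  gamma ord_max (\sum_(i < n | (i < k.*2)%N) gamma i (pd (e i) phi y)).

(** Twice the rotor angle is the rotation angle of A: alpha covers A. *)
Lemma half_angle2 (j : 'I_k) : 2 * half_angle R j = 2 * pi * j.+1%:R / n%:R.
Proof. by rewrite /half_angle; move: n%:R^-1 => q; ring. Qed.

(** By the chain rule the derivative along A v at g x is alpha applied to the derivative along v at
    x. The horizontal derivatives thus rotate as [alpha_horizontal] requires, and e_n commutes with
    alpha. *)
Lemma inv_field_swap phi : smS phi -> inv_field phi -> inv_field (swap_field phi).
Proof.
move=> sph [pa pg]; split=> [j x jk | x].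
  have E v : pd v phi (x + chd_a M j) = pd v phi x.
    rewrite -pd_translate; congr (pd _ _ x); apply/funext => y; exact: pa.
  apply: (congr1 (gamma ord_max)); apply: eq_bigr => i _.
  exact: (congr1 (gamma i) (E (e i))).
have [K hK] := linear_matrix (clif_act_linear alpha).
have E v : pd (chd_A M v) phi (g x) = clif_act alpha (pd v phi x).
  rewrite -pd_g; have -> : (fun y => phi (g y)) = fun y => clif_act alpha (phi y) by exact/funext.
  exact: (congr1 (fun F : V -> Sigma => F x) (@pd_op R k (clif_act alpha) K hK v phi sph)).
rewrite /swap_field alpha_last; apply: (congr1 (gamma ord_max)); apply/esym.
apply: (alpha_horizontal (X := fun i => pd (e i) phi x) (Y := fun i => pd (e i) phi (g x))) => j.
rewrite half_angle2 => c d.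
have cN (a : R) : - a%:C = (- a)%:C by apply/eqP; rewrite eq_complex /= oppr0 !eqxx.
split; apply: etrans (esym (E _)) _.
  apply: etrans (congr1 (fun v => pd v phi (g x)) (chd_A_rot1 M j)) _.
  exact: (@pd_dir2 (e (inord j.*2)) (e (inord j.*2.+1)) _ _ phi (g x) sph).
rewrite /d cN; apply: etrans (congr1 (fun v => pd v phi (g x)) (chd_A_rot2 M j)) _.
exact: (@pd_dir2 (e (inord j.*2)) (e (inord j.*2.+1)) _ _ phi (g x) sph).
Qed.

(** Since e_n acts on [spin_vec sg] as i times [sgn_prod], an eigenspinor depending on the height
    only has frequency - lam [sgn_prod] there. As g raises the height by 1 / n, this is its
    equivariance. *)
Definition vertical_sign lam (sg : signs) : Prop :=
  cis (- (lam * sgn_prod R sg) / n%:R) = cis (alpha_phase R sp sg).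
Definition vertical_mult lam : nat := #|[pred sg : signs | `[< vertical_sign lam sg >] ]|.

Lemma sgn_prod_sqr (sg : signs) : sgn_prod R sg * sgn_prod R sg = 1 :> R.
Proof.
rewrite -big_split /= big1 // => j _.
by rewrite /sgn; case: (sg j); rewrite ?mulrNN mulr1.
Qed.

Section Level.
Variables (L : R) (s : seq 'rV[int]_n).
Hypotheses (L_gt0 : 0 < L) (s_uniq : uniq s).
Hypothesis sL : forall m, (m \in s) = (freq_sqr B (frame M) m == L).
Local Notation N := (size s).
Local Notation X := {ffun 'I_N * signs -> C^o}.
Implicit Types (i : 'I_N) (c : X).
Local Notation nthm := (@nthm k s).
Local Notation wave_sum_field := (@wave_sum_field R k M s).
Local Notation superposition := (@superposition R k M s).
Local Notation amplitude := (@amplitude R k s).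
Local Notation w i := (freq B (nthm i) (e ord_max)).
Local Notation dirac_symbol := (@dirac_symbol R k M s).
Local Notation swap_symbol := (@swap_symbol R k M s).

Lemma swap_wave_sum (u : 'I_N -> Sigma) :
  swap_field (wave_sum_field u) = wave_sum_field (fun i => swap_symbol i (u i)).
Proof.
apply/funext => y; rewrite /swap_field.
transitivity (gamma ord_max (\sum_(j | horizontal j) \sum_i chi B (nthm i) y *: (freq_coef M i j *:
  gamma j (u i)))).
  congr (gamma _ _); apply: eq_bigr => j _; rewrite pd_wave_sum gamma_sum; apply: eq_bigr => i _.
  by rewrite !gammaZ.
rewrite exchange_big gamma_sum; apply: eq_bigr => i _.
by rewrite -scaler_sumr gammaZ.
Qed.

(** Independence of the characters splits the Dirac equation into one linear equation per mode;
    equivariance still couples the modes. *)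
Lemma eigen_superposition lam c : eigenspinor M h lam (superposition c) <->
  inv_field (superposition c) /\ forall i, dirac_symbol i (amplitude c i) = lam%:C *: amplitude c i.
Proof.
have E y : lam%:C *: superposition c y = wave_sum_field (fun i => lam%:C *: amplitude c i) y.
  by rewrite scaler_sumr; apply: eq_bigr => i _; rewrite !scalerA mulrC.
have E' y : Defs.dirac M (superposition c) y = wave_sum_field (fun i => dirac_symbol i (amplitude c i)) y.
  exact: (dirac_wave_sum M (amplitude c) y).
split=> [/(eigenspinorP h_spin k_gt0)[_ ic dc] | [ic dc]].
  by split=> //; apply: (wave_sum_inj s_uniq) => y; exact: etrans (esym (E' y)) (etrans (dc y) (E y)).
apply/(eigenspinorP h_spin k_gt0); split=> [||y] //; first exact: (wave_sum_smS M (amplitude c)).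
by rewrite E E'; apply: eq_bigr => i _; rewrite dc.
Qed.

Lemma eigen_linear lam (a : C) c d : eigenspinor M h lam (superposition c) ->
  eigenspinor M h lam (superposition d) -> eigenspinor M h lam (superposition (a *: c + d)).
Proof.
move=> /eigen_superposition[[pa pg] dc] /eigen_superposition[[pa' pg'] dd].
apply/eigen_superposition; split.
  split=> [j x jk|x]; first by rewrite !superposition_linear pa // pa'.
  by rewrite !superposition_linear pg pg' clif_act_linear.
move=> i; apply: etrans (congr1 (dirac_symbol i) (amplitude_linear a c d i)) _.
apply: etrans (dirac_symbol_linear M i a _ _) _; rewrite dc dd.
by rewrite (amplitude_linear a c d i) scalerDr !scalerA mulrC.
Qed.

(** Completeness: the components solve the Laplace equation for lam^2, so [ceig_trig] applies to
    each of them. *)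
Lemma eigen_exists lam phi : lam ^+ 2 = L -> eigenspinor M h lam phi ->
  exists c, phi = superposition c.
Proof.
move=> lL ep.
have hc t : exists a : 'I_N -> C, forall y, component phi t y = \sum_i a i * chi B (nthm i) y.
  apply: (trig_coefficients s_uniq sL); apply: ceig_trig; rewrite ?lattice_unit ?frame_unit //.
  by rewrite -lL; exact: (eigenspinor_ceig h_spin k_gt0).
have [a ha] := choice hc.
exists (of_amplitudes (fun i => [ffun t => a t i])); rewrite superposition_of.
apply/funext => y; apply/ffunP => t; rewrite [LHS](ha t y).
apply: etrans _ (esym (congr1 (fun F => F y) (component_wave_sum M _ t))).
by apply: eq_bigr => i _; rewrite ffunE.
Qed.

Definition swap c : X := of_amplitudes (fun i => swap_symbol i (amplitude c i)).

Lemma amplitude_swap c i : amplitude (swap c) i = swap_symbol i (amplitude c i).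
Proof. exact: amplitude_of. Qed.

Lemma amplitude_swap_linear (a : C) (c d : X) i :
  amplitude (swap (a *: c + d)) i = a *: amplitude (swap c) i + amplitude (swap d) i.
Proof.
apply: etrans (amplitude_swap (a *: c + d) i) _.
apply: etrans (congr1 (swap_symbol i) (amplitude_linear a c d i)) _.
apply: etrans (swap_symbol_linear M i a _ _) _.
exact: (congr2 (fun p q => a *: p + q) (esym (amplitude_swap c i)) (esym (amplitude_swap d i))).
Qed.

Lemma swap_linear : linear swap.
Proof.
move=> a c d; apply: amplitude_ext => i.
exact: etrans (amplitude_swap_linear a c d i) (esym (amplitude_linear a (swap c) (swap d) i)).
Qed.
HB.instance Definition _ := GRing.isLinear.Build C X X _ swap swap_linear.

Lemma swap_eigen lam c : eigenspinor M h lam (superposition c) ->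
  eigenspinor M h (- lam) (superposition (swap c)).
Proof.
move=> /eigen_superposition[ic dc]; apply/eigen_superposition; split.
  rewrite superposition_of -swap_wave_sum.
  exact: (inv_field_swap (wave_sum_smS M (amplitude c)) ic).
move=> i; rewrite (amplitude_swap c i) (dirac_swap_symbol M i) (dc i) (swap_symbolZ M i).
by rewrite rmorphN scaleNr.
Qed.

Lemma swap_swap_eq0 c : swap (swap c) = 0 -> swap c = 0.
Proof.
move=> z; apply: amplitude_ext => i; rewrite amplitude0 amplitude_swap.
have := congr1 (fun d => amplitude d i) z; rewrite amplitude0 !amplitude_swap.
move=> /(swap_symbol_eq0 (M := M))[->|]; first exact: swap_symbol0.
exact: swap_symbol_vertical.
Qed.

Lemma row_frame_eq (w1 w2 : V -> R) : linear w1 -> linear w2 ->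
  (forall j, w1 (e j) = w2 (e j)) -> w1 =1 w2.
Proof.
move=> l1 l2 h12; apply: (eq_linear_rows (frame_unit M) l1 l2) => j.
by rewrite row_frame.
Qed.

Lemma height_linear (t : R) : linear (fun y => t * height M y).
Proof. by move=> a x y; rewrite heightD heightZ /GRing.scale /=; ring. Qed.

Lemma vertical_freq (m : 'rV[int]_n) :
  (forall j : 'I_n, (j < k.*2)%N -> freq B m (e j) = 0) ->
  forall y, freq B m y = freq B m (e ord_max) * height M y.
Proof.
move=> vm; apply: (row_frame_eq (@freq_linear _ _ B m) (height_linear _)) => j.
rewrite height_e; case: eqVneq => [->|jm]; first by rewrite mulr1.
by rewrite mulr0 vm //; move: jm; rewrite -val_eqE /=; have := ltn_ord j; lia.
Qed.

Lemma spin_coord_superposition sg c y :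
  spin_coord sg (superposition c y) = \sum_i chi B (nthm i) y * (c (i, sg) : C).
Proof.
rewrite spin_coord_sum; apply: eq_bigr => i _.
by rewrite spin_coordZ spin_coord_amplitude.
Qed.

Lemma superposition_translate c (j : 'I_n) y : (j < k.*2)%N ->
  superposition c (y + chd_a M j) = superposition c y.
Proof.
move=> jk; apply: eq_bigr => i _; rewrite chiD.
have -> : chd_a M j = row j B by rewrite row_lattice jk.
by rewrite [chi _ _ (row j _)]/chi freq_row ?lattice_unit // cis_2pi_int mulr1.
Qed.

Definition vertical_pair lam (p : 'I_N * signs) : Prop :=
  [/\ vertical_index M p.1, w p.1 = - (lam * sgn_prod R p.2) & vertical_sign lam p.2].

Lemma spin_coord_dirac_vertical i sg (u : Sigma) : vertical_index M i ->
  spin_coord sg (dirac_symbol i u) = (- (w i * sgn_prod R sg))%:C * spin_coord sg u.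
Proof.
move=> vi; rewrite (dirac_symbol_vertical u vi) spin_coordZ spin_coord_last mulrA; congr (_ * _).
rewrite /freq_coef; move: (w i) (sgn_prod R sg) => a b.
by apply/eqP; rewrite eq_complex /=; apply/andP; split; apply/eqP; ring.
Qed.

Lemma chi_vertical i y : vertical_index M i -> chi B (nthm i) (g y) = cis (w i / n%:R) * chi B (nthm i) y.
Proof.
move=> vi; by rewrite /chi (vertical_freq vi (g y)) (vertical_freq vi y) height_g mulrDr cisD mulrC.
Qed.

Lemma vertical_pair_inj lam i i' (sg : signs) : vertical_index M i -> vertical_index M i' ->
  w i = - (lam * sgn_prod R sg) -> w i' = - (lam * sgn_prod R sg) -> i = i'.
Proof.
move=> vi vi' wi wi'; apply: val_inj; apply/eqP.
rewrite -(nth_uniq 0 (ltn_ord i) (ltn_ord i') s_uniq); apply/eqP.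
apply: (freq_inj (lattice_unit M)) => y.
by apply: etrans (vertical_freq vi y) _; rewrite -[RHS](esym (vertical_freq vi' y)) wi wi'.
Qed.

(** In the kernel of S only vertical modes occur, on which both the Dirac operator and g are
    diagonal in the basis [spin_vec]; the conditions can be read coordinate by coordinate. *)
Lemma vertical_eigenP lam c : (eigenspinor M h lam (superposition c) /\ swap c = 0) <->
  forall p, ~ vertical_pair lam p -> c p = 0.
Proof.
split=> [[/eigen_superposition[[_ pg] dc] c0] [i sg] np | hc].
  apply/eqP/negPn/negP => cp; apply: np.
  have amp i' : (c (i', sg) : C) != 0 -> vertical_index M i' /\ w i' = - (lam * sgn_prod R sg).
    move=> ci'; have a0 : amplitude c i' != 0.
      by apply: contraNneq ci' => a0; rewrite -spin_coord_amplitude a0 spin_coord0.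
    have vi : vertical_index M i'.
      have s0 : swap_symbol i' (amplitude c i') = 0 by rewrite -amplitude_swap c0 amplitude0.
      have : swap_symbol i' (swap_symbol i' (amplitude c i')) = 0 by rewrite s0 swap_symbol0.
      by move=> /swap_symbol_eq0[az|//]; rewrite az eqxx in a0.
    split=> //; have := congr1 (spin_coord sg) (dc i').
    rewrite (spin_coord_dirac_vertical _ _ vi) spin_coordZ => /mulIf.
    rewrite spin_coord_amplitude => /(_ ci') [] <-.
    by rewrite mulNr opprK -mulrA sgn_prod_sqr mulr1.
  have [vi wi] := amp i cp; split=> //=.
  (* Vertical characters of equal slope coincide, so only the index [i] contributes; equivariance at
     the point 0 then gives the phase condition. *)
  have one y : \sum_i' chi B (nthm i') y * (c (i', sg) : C) = chi B (nthm i) y * (c (i, sg) : C).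
    rewrite (bigD1 i) //= big1 ?addr0 // => i' ni.
    have [->|ci'] := eqVneq (c (i', sg) : C) 0; first by rewrite mulr0.
    by have [vi' wi'] := amp _ ci'; case/eqP: ni; exact: (vertical_pair_inj vi' vi wi' wi).
  have := congr1 (spin_coord sg) (pg 0).
  rewrite spin_coord_alpha !spin_coord_superposition !one (chi_vertical _ vi) chi0 mulr1 mul1r.
  by move/(mulIf cp); rewrite wi.
have cz i : amplitude c i = 0 \/ vertical_index M i.
  have [vi|nvi] := pselect (vertical_index M i); [by right|left].
  by apply: spin_ext => sg; rewrite spin_coord_amplitude spin_coord0; apply: hc => -[].
split; last first.
  apply: amplitude_ext => i; rewrite amplitude_swap amplitude0.
  have [->|vi] := cz i; last exact: swap_symbol_vertical.
  exact: swap_symbol0.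
apply/eigen_superposition; split.
  split=> [j x jk|x]; first exact: superposition_translate.
  apply: spin_ext => sg; rewrite spin_coord_alpha !spin_coord_superposition mulr_sumr;
    apply: eq_bigr => i _.
  have [[vi wi vs]|/hc ->] := pselect (vertical_pair lam (i, sg)); last by rewrite !mulr0.
  by rewrite (chi_vertical _ vi) wi vs mulrA.
move=> i; have [->|vi] := cz i.
  by rewrite scaler0 dirac_symbol0.
apply: spin_ext => sg; rewrite (spin_coord_dirac_vertical _ _ vi) spin_coordZ spin_coord_amplitude.
have [[_ wi vs]|/hc ->] := pselect (vertical_pair lam (i, sg)); last by rewrite !mulr0.
by rewrite wi mulNr opprK -mulrA sgn_prod_sqr mulr1.
Qed.

Lemma vertical_sign_int lam (sg : signs) : vertical_sign lam sg ->
  exists a : int, - (lam * sgn_prod R sg) = pi * a%:~R.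
Proof.
have n0 : (n%:R : R) != 0 by rewrite pnatr_eq0.
rewrite /vertical_sign alpha_phaseE => e1.
have : cis (- (lam * sgn_prod R sg) / n%:R + pi / n%:R * (phase_int sp sg)%:~R) = 1.
  by rewrite cisD e1 cisN.
move=> /cis_eq1[q hq]; exists (2 * n%:Z * q - phase_int sp sg).
have aux (t d p r : R) : d != 0 -> t / d + pi / d * p = 2 * pi * r -> t = pi * (2 * d * r - p).
  move=> d0 e2; have -> : t = (t / d + pi / d * p) * d - pi * p by field.
  by rewrite e2; ring.
have -> : (2 * n%:Z * q - phase_int sp sg)%:~R = 2 * n%:R * q%:~R - (phase_int sp sg)%:~R :> R.
  by rewrite intrB !intrM.
exact: aux n0 hq.
Qed.

Lemma vertical_index_exists lam (sg : signs) : lam ^+ 2 = L -> vertical_sign lam sg ->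
  exists i, vertical_index M i /\ w i = - (lam * sgn_prod R sg).
Proof.
move=> lL vs; have [a ta] := vertical_sign_int vs.
set t := - (lam * sgn_prod R sg) in ta *.
(* The last lattice vector has height 2, so the integer [a] yields the slope 2 pi a / 2 = pi a. *)
pose m : 'rV[int]_n := \row_j (if (j < k.*2)%N then 0 else a).
have hm y : freq B m y = t * height M y.
  apply: (eq_linear_rows (lattice_unit M) (@freq_linear _ _ B m) (height_linear t)) => j.
  rewrite freq_row ?lattice_unit // row_lattice mxE; case: ifPn => jk.
    by rewrite height_a // !mulr0.
  have -> : j = ord_max by apply: val_inj => /=; have := ltn_ord j; lia.
  by rewrite heightZ -chd_e_last height_e eqxx ta mulr1; ring.
have ms : m \in s.
  rewrite sL /freq_sqr; apply/eqP.
  rewrite (bigD1 ord_max) //= big1 => [|j jm].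
    rewrite row_frame hm height_e eqxx addr0 mulr1 sqrrN exprMn lL.
    by rewrite [sgn_prod R sg ^+ 2]expr2 sgn_prod_sqr mulr1.
  by rewrite row_frame hm height_e (negPf jm) mulr0 expr0n.
have im : (index m s < N)%N by rewrite index_mem.
have nm : nthm (Ordinal im) = m by apply: nth_index; rewrite -index_mem.
exists (Ordinal im); rewrite /vertical_index nm; split=> [j jk|]; rewrite hm height_e.
  by rewrite -val_eqE /= ltn_eqF // mulr0.
by rewrite eqxx mulr1.
Qed.

(** The signs determine the slope and hence the character, so projection to [signs] is injective;
    [vertical_index_exists] makes it onto. *)
Lemma vertical_pair_card lam : lam ^+ 2 = L ->
  #|[pred p | `[< vertical_pair lam p >] ]| = vertical_mult lam.
Proof.
move=> lL; rewrite /vertical_mult -(@card_in_imset _ _ (@snd 'I_N signs)); last first.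
  move=> [i sg] [i' sg']; rewrite -!topredE /= => /asboolP[vi wi _] /asboolP[vi' wi' _] e1.
  by move: vi wi vi' wi'; rewrite -e1 /= => vi wi vi' wi'; rewrite (vertical_pair_inj vi vi' wi wi').
apply: eq_card => sg; rewrite [RHS]inE; apply/imsetP/asboolP.
  by move=> [[i sg']]; rewrite -topredE /= => /asboolP[_ _ vs] ->.
move=> vs; have [i [vi wi]] := vertical_index_exists lL vs.
by exists (i, sg) => //; rewrite -topredE /=; apply/asboolP; split.
Qed.

Lemma superposition_sum (m : nat) (a : 'I_m -> C) (b : 'I_m -> X) y :
  superposition (\sum_i a i *: b i) y = \sum_i a i *: superposition (b i) y.
Proof.
have s0 : superposition 0 y = 0.
  have := superposition_linear M (-1) (0 : X) 0 y.
  by rewrite scaler0 addr0 scaleN1r addNr.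
elim: (index_enum _) => [|i r IH]; first by rewrite !big_nil.
by rewrite !big_cons superposition_linear IH.
Qed.

Lemma eigen_mult_dim lam (W : {vspace X}) : lam ^+ 2 = L ->
  (forall c, c \in W <-> eigenspinor M h lam (superposition c)) -> eigen_mult M h lam (\dim W).
Proof.
move=> lL hW; exists (fun i : 'I_(\dim W) => superposition (vbasis W)`_i) => [i|phi ep].
  by apply/hW; apply: vbasis_mem; rewrite mem_nth // size_tuple.
have [c pc] := eigen_exists lL ep; have cW : c \in W by apply/hW; rewrite -pc.
exists (\row_i coord (vbasis W) i c); split=> [y|d hd].
  rewrite pc [in LHS](coord_vbasis cW) superposition_sum; apply: eq_bigr => i _.
  by rewrite mxE.
apply/rowP => i; rewrite mxE.
have -> : c = \sum_j d 0 j *: (vbasis W)`_j.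
  apply: (superposition_inj (M := M) s_uniq) => y.
  by rewrite superposition_sum -hd pc.
by rewrite coord_sum_free // (basis_free (vbasisP W)).
Qed.

(** Rank-nullity for S on each eigenspace: the kernel has dimension [vertical_mult lam], and the
    rank is common to lam and - lam by [swapped_rank]. *)
Lemma level_mult : exists rho : nat, forall lam, lam ^+ 2 = L ->
  eigen_mult M h lam (vertical_mult lam + rho) /\ (vertical_mult lam + rho <= N * 2 ^ k)%N.
Proof.
have hW lam : exists W : {vspace X}, forall c, c \in W <-> eigenspinor M h lam (superposition c).
  apply: closed_is_vspace => [|a c d]; last exact: eigen_linear.
  by have [] := (vertical_eigenP lam 0).2 (fun p _ => ffunE _ p).
have [W WP] := choice hW.
pose f := linfun swap.
have fW lam : (f @: W lam <= W (- lam))%VS.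
  apply/subvP => d /memv_imgP[c cW ->]; rewrite lfunE /=; apply/WP.
  by apply: swap_eigen; apply/WP.
pose r lam := \dim (f @: W lam).
have rN lam : r (- lam) = r lam.
  apply: (@swapped_rank _ _ f); [|exact: fW|].
    by have := fW (- lam); rewrite opprK.
  by move=> c; rewrite !lfunE /=; exact: swap_swap_eq0.
have dimW lam : lam ^+ 2 = L -> \dim (W lam) = (vertical_mult lam + r lam)%N.
  move=> lL; rewrite -(limg_ker_dim f) -vertical_pair_card //; congr (_ + _)%N.
  apply: (@dim_supported R[i] ('I_N * signs)%type [pred p | `[< vertical_pair lam p >] ] (W lam :&:
    lker f)%VS) => c; rewrite memv_cap; split.
    move=> /andP[/WP ec]; rewrite memv_ker lfunE /= => /eqP c0 p; rewrite inE => /asboolP.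
    exact: (vertical_eigenP lam c).1.
  move=> hc; have [ec c0] : eigenspinor M h lam (superposition c) /\ swap c = 0.
    by apply/vertical_eigenP => p np; apply: hc; rewrite inE; apply/asboolP.
  by apply/andP; split; [apply/WP | rewrite memv_ker lfunE /= c0].
(* [lam] is the square root of [L] up to sign and [r] is even, so one number serves both
   eigenvalues. *)
exists (r (Num.sqrt L)) => lam lL.
have -> : r (Num.sqrt L) = r lam.
  by rewrite -lL sqrtr_sqr; case: (ger0P lam) => // _; rewrite rN.
rewrite -dimW //; split; first by apply: eigen_mult_dim => // c; exact: WP.
(* The dimension of the whole coefficient space is a crude bound; absolute convergence of the eta
   series will rest on it. *)
apply: leq_trans (dimvS (subvf _)) _.
rewrite (@dim_supported _ _ predT) => [|c]; last first.
  by split=> [_ i|_]; [rewrite inE | exact: memvf].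
by rewrite card_prod card_ord card_ffun card_bool card_ord.
Qed.

End Level.
End Eigenspaces.

(** * Continuation of Dirichlet series with periodic coefficients *)

Section ComplexCalculus.
Variable R : realType.
Local Notation C := R[i].
Implicit Types (z w c d : C) (u : R -> C) (s t : R).

(* The l1 norm takes values in [R], unlike the norm of [R[i]]. *)
Definition norm1 z : R := `|complex.Re z| + `|complex.Im z|.

Lemma norm1_ge0 z : 0 <= norm1 z.
Proof. exact: addr_ge0. Qed.

Lemma norm1_0 : norm1 0 = 0.
Proof. by rewrite /norm1 /= normr0 addr0. Qed.

Lemma norm1D z w : norm1 (z + w) <= norm1 z + norm1 w.
Proof. by case: z w => a b [c d]; rewrite /norm1 /= addrACA lerD ?ler_normD. Qed.

Lemma norm1N z : norm1 (- z) = norm1 z.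
Proof. by case: z => a b; rewrite /norm1 /= !normrN. Qed.

Lemma norm1B z w : norm1 (z - w) <= norm1 z + norm1 w.
Proof. by rewrite -(norm1N w); exact: norm1D. Qed.

Lemma norm1M z w : norm1 (z * w) <= norm1 z * norm1 w.
Proof.
case: z w => a b [c d]; rewrite /norm1 /= mulrDl !mulrDr -!normrM.
rewrite (le_trans (lerD (ler_normB _ _) (ler_normD _ _))) //.
by rewrite le_eqVlt; apply/orP; left; apply/eqP; ring.
Qed.

Lemma norm1_real t : norm1 t%:C = `|t|.
Proof. by rewrite /norm1 /= normr0 addr0. Qed.

Lemma norm1_sum (I : Type) (r : seq I) (F : I -> C) :
  norm1 (\sum_(i <- r) F i) <= \sum_(i <- r) norm1 (F i).
Proof.
elim: r => [|i r IH]; first by rewrite !big_nil norm1_0.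
by rewrite !big_cons (le_trans (norm1D _ _)) // lerD2l.
Qed.

Lemma norm1_eq0 z : norm1 z <= 0 -> z = 0.
Proof.
case: z => a b; rewrite /norm1 /= => h.
have [a0 b0] : `|a| = 0 /\ `|b| = 0 by have := normr_ge0 a; have := normr_ge0 b; lra.
by rewrite (normr0_eq0 a0) (normr0_eq0 b0).
Qed.

Lemma norm_le_norm1 z : `|z| <= (norm1 z)%:C.
Proof.
have -> : z = (complex.Re z)%:C + 'i%C * (complex.Im z)%:C.
  by case: z => a b; apply/eqP; rewrite eq_complex /=; apply/andP; split; apply/eqP; ring.
have normC (a : R) : `|a%:C : C| = `|a|%:C by rewrite normc_def /= expr0n addr0 sqrtr_sqr.
apply: le_trans (ler_normD _ _) _; rewrite normrM !normC.
have -> : `|'i%C : C| = 1 by rewrite normc_def /= expr0n expr1n add0r sqrtr1.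
rewrite mul1r -rmorphD /norm1 /= !mul0r !mul1r ?(subr0, addr0, add0r, sub0r, mulr0, oppr0).
by [].
Qed.

Lemma norm1_le_norm z : (norm1 z)%:C <= 2 * `|z|.
Proof.
have re a b : `|a +i* b : C| = (Num.sqrt (a ^+ 2 + b ^+ 2))%:C by rewrite normc_def.
case: z => a b; rewrite re /norm1 /= -[2](rmorph_nat (real_complex R)) -rmorphM lecR.
have p : `|a| <= Num.sqrt (a ^+ 2 + b ^+ 2) by rewrite -sqrtr_sqr ler_wsqrtr // lerDl sqr_ge0.
have q : `|b| <= Num.sqrt (a ^+ 2 + b ^+ 2) by rewrite -sqrtr_sqr ler_wsqrtr // lerDr sqr_ge0.
lra.
Qed.

Lemma norm1_cexp z : norm1 (cexp z) <= 2 * expR (complex.Re z).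
Proof.
rewrite (le_trans (norm1M _ _)) // norm1_real ger0_norm ?expR_ge0 // mulrC ler_wpM2r ?expR_ge0 //.
rewrite /norm1 /=; have := cos_max (complex.Im z); have := sin_max (complex.Im z); lra.
Qed.

Definition cder u t d := is_derive t 1 (fun s => complex.Re (u s)) (complex.Re d) /\
  is_derive t 1 (fun s => complex.Im (u s)) (complex.Im d).

Lemma cder_eq u t d d' : cder u t d -> d = d' -> cder u t d'.
Proof. by move=> h <-. Qed.

Lemma cder_cst c t : cder (fun=> c) t 0.
Proof. by split; exact: is_derive_cst. Qed.

Lemma cderD u v t d d' : cder u t d -> cder v t d' -> cder (fun s => u s + v s) t (d + d').
Proof.
have re (a b : C) : complex.Re (a + b) = complex.Re a + complex.Re b by case: a; case: b.
have im (a b : C) : complex.Im (a + b) = complex.Im a + complex.Im b by case: a; case: b.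
move=> [u1 u2] [v1 v2]; split.
  by rewrite re; under eq_fun do rewrite re; exact: is_derive_addf.
by rewrite im; under eq_fun do rewrite im; exact: is_derive_addf.
Qed.

Lemma cderM u v t d d' : cder u t d -> cder v t d' -> cder (fun s => u s * v s) t (d * v t + u t * d').
Proof.
have re (a b : C) : complex.Re (a * b) = complex.Re a * complex.Re b + (-1) * (complex.Im a * complex.Im b).
  by case: a => ? ?; case: b => ? ? /=; ring.
have im (a b : C) : complex.Im (a * b) = complex.Re a * complex.Im b + complex.Im a * complex.Re b.
  by case: a => ? ?; case: b => ? ? /=; ring.
move=> [u1 u2] [v1 v2]; split.
  under eq_fun do rewrite re.
  apply: is_derive_eq (is_derive_addf (is_derive_mulf u1 v1) (is_derive_scalef (-1) (is_derive_mulf u2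
    v2))) _.
  by case: (u t) (v t) d d' {u1 u2 v1 v2} => ? ? [? ?] [? ?] [? ?] /=; ring.
under eq_fun do rewrite im.
apply: is_derive_eq (is_derive_addf (is_derive_mulf u1 v2) (is_derive_mulf u2 v1)) _.
by case: (u t) (v t) d d' {u1 u2 v1 v2} => ? ? [? ?] [? ?] [? ?] /=; ring.
Qed.

Lemma cderZ c u t d : cder u t d -> cder (fun s => c * u s) t (c * d).
Proof. by move=> h; apply: cder_eq (cderM (cder_cst c t) h) _; rewrite mul0r add0r. Qed.

Lemma cderB u v t d d' : cder u t d -> cder v t d' -> cder (fun s => u s - v s) t (d - d').
Proof.
move=> hu hv; have := cderD hu (cderZ (-1) hv); rewrite mulN1r.
by under eq_fun do rewrite mulN1r.
Qed.

Lemma cder_sum (I : Type) (r : seq I) (F : I -> R -> C) t (d : I -> C) :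
  (forall i, cder (F i) t (d i)) -> cder (fun s => \sum_(i <- r) F i s) t (\sum_(i <- r) d i).
Proof.
move=> h; elim: r => [|i r IH].
  by rewrite big_nil; under eq_fun do rewrite big_nil; exact: cder_cst.
by rewrite big_cons; under eq_fun do rewrite big_cons; exact: cderD.
Qed.

Lemma cder_real (f : R -> R) t (e : R) : is_derive t 1 f e -> cder (fun s => (f s)%:C) t e%:C.
Proof. by split=> //; exact: is_derive_cst. Qed.

Lemma cder_shift u t d s : cder u (t + s) d -> cder (fun t => u (t + s)) t d.
Proof.
have ds : is_derive t 1 (fun t : R => t + s) 1.
  by apply: is_derive_eq (is_derive_addf (is_derive_id t 1) (is_derive_cst s t 1)) _; rewrite addr0.
move=> [h1 h2]; split; rewrite -[_ d]mulr1.
  exact: (@is_derive1_comp R (fun t => complex.Re (u t)) (fun t => t + s) t _ _ h1 ds).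
exact: (@is_derive1_comp R (fun t => complex.Im (u t)) (fun t => t + s) t _ _ h2 ds).
Qed.

Lemma cder_exp u t d : cder u t d -> cder (fun s => cexp (u s)) t (d * cexp (u t)).
Proof.
move=> [h1 h2].
have e1 : is_derive t 1 (fun s => expR (complex.Re (u s))) (expR (complex.Re (u t)) * complex.Re d).
  exact: is_derive1_comp.
have e2 : is_derive t 1 (fun s => cos (complex.Im (u s))) (- sin (complex.Im (u t)) * complex.Im d).
  exact: (@is_derive1_comp R cos).
have e3 : is_derive t 1 (fun s => sin (complex.Im (u s))) (cos (complex.Im (u t)) * complex.Im d).
  exact: (@is_derive1_comp R sin).
have h : cder (fun s => cos (complex.Im (u s)) +i* sin (complex.Im (u s))) t
  ((- sin (complex.Im (u t)) * complex.Im d) +i* (cos (complex.Im (u t)) * complex.Im d)) by [].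
apply: cder_eq (cderM (cder_real e1) h) _.
rewrite /cexp; case: d {e1 e2 e3 h1 h2 h} => ? ? /=; apply/eqP; rewrite eq_complex /=.
by apply/andP; split; apply/eqP; ring.
Qed.

Lemma cder_poly (q : {poly C}) u t d : cder u t d -> cder (fun s => q.[u s]) t (q^`().[u t] * d).
Proof.
move=> h; elim/poly_ind: q => [|q c IH].
  by rewrite derivC horner0 mul0r; under eq_fun do rewrite horner0; exact: cder_cst.
under eq_fun do rewrite hornerMXaddC.
apply: cder_eq (cderD (cderM IH h) (cder_cst c t)) _.
rewrite addr0 derivD derivC addr0 derivM derivX mulr1 hornerD hornerMX; ring.
Qed.

Lemma mvt_norm (f f' : R -> R) (a b K : R) : a < b ->
  (forall t, a <= t <= b -> is_derive t 1 f (f' t)) ->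
  (forall t, a <= t <= b -> `|f' t| <= K) -> `|f b - f a| <= K * (b - a).
Proof.
move=> ab df bf.
have cf : {within `[a, b], continuous f}.
  by apply: derivable_within_continuous => t; rewrite in_itv /= => /df[].
have dfo t : t \in `]a, b[ -> is_derive t 1 f (f' t).
  by rewrite in_itv /= => /andP[/ltW at_ /ltW tb]; apply: df; rewrite at_ tb.
have [c] := MVT ab dfo cf; rewrite in_itv /= => /andP[/ltW ac /ltW cb] ->.
by rewrite normrM (gtr0_norm (_ : 0 < b - a)) ?subr_gt0 // ler_pM2r ?subr_gt0 // bf // ac cb.
Qed.

Lemma cmvt u (u' : R -> C) (a b K : R) : a < b ->
  (forall t, a <= t <= b -> cder u t (u' t)) ->
  (forall t, a <= t <= b -> norm1 (u' t) <= K) -> norm1 (u b - u a) <= 2 * K * (b - a).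
Proof.
move=> ab du bu.
have h1 : `|complex.Re (u b) - complex.Re (u a)| <= K * (b - a).
  apply: (mvt_norm ab (fun t h => (du t h).1)) => t h.
  by apply: le_trans (bu t h); rewrite lerDl.
have h2 : `|complex.Im (u b) - complex.Im (u a)| <= K * (b - a).
  apply: (mvt_norm ab (fun t h => (du t h).2)) => t h.
  by apply: le_trans (bu t h); rewrite lerDr.
rewrite /norm1; case: (u b) h1 h2 => ? ?; case: (u a) => ? ? /= h1 h2.
by apply: le_trans (lerD h1 h2) _; rewrite le_eqVlt; apply/orP; left; apply/eqP; ring.
Qed.

Lemma taylor2 u (u' u'' : R -> C) (K : R) :
  (forall t, cder u t (u' t)) -> (forall t, cder u' t (u'' t)) ->
  (forall t, 0 <= t <= 1 -> norm1 (u'' t) <= K) -> norm1 (u 1 - u 0 - u' 0) <= 4 * K.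
Proof.
move=> du du' bu.
pose v t := u t - u' 0 * t%:C.
have dv t : cder v t (u' t - u' 0).
  apply: cderB => //; rewrite -[X in cder _ _ X]mulr1; apply: cderZ.
  exact: (cder_real (is_derive_id _ _)).
have bv t : 0 <= t <= 1 -> norm1 (u' t - u' 0) <= 2 * K.
  move=> /andP[t0 t1]; have [<-|tn0] := eqVneq 0 t.
    by rewrite subrr norm1_0 mulr_ge0 // (le_trans (norm1_ge0 _) (bu 0 _)) // lexx ler01.
  have tp : 0 < t by rewrite lt_neqAle tn0.
  have K0 : 0 <= K by rewrite (le_trans (norm1_ge0 _) (bu 0 _)) // lexx ler01.
  apply: le_trans (cmvt tp (fun s _ => du' s) (_ : forall s, _ -> norm1 (u'' s) <= K)) _.
    by move=> s /andP[s0 st]; apply: bu; rewrite s0 (le_trans st).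
  by rewrite subr0 ler_piMr // mulr_ge0.
have := cmvt ltr01 (fun t _ => dv t) bv.
have -> : v 1 - v 0 = u 1 - u 0 - u' 0 by rewrite /v mulr1 mulr0 subr0; ring.
by move=> h; apply: le_trans h _; lra.
Qed.

Fixpoint difference (N : nat) u : R -> C :=
  if N is N'.+1 then difference N' (fun t => u t - u (t + 1)) else u.

Lemma difference_shift N u t : difference N.+1 u t = difference N u t - difference N u (t + 1).
Proof. by elim: N u t => [//|N IH] u t; rewrite [LHS]IH. Qed.

Lemma difference_cder N (F : R -> R -> C) (F' : R -> C) (x : R) :
  (forall t, cder (fun y => F y t) x (F' t)) ->
  forall t, cder (fun y => difference N (F y) t) x (difference N F' t).
Proof.
elim: N F F' => [//|N IH] F F' dF t /=.
by apply: (IH (fun y t => F y t - F y (t + 1))) => s; exact: cderB.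
Qed.

(** Each difference is a mean value estimate on [t, t + 1] and replaces one derivative at the cost
    of a factor 2; [K] decreases so that the left end dominates. *)
Lemma difference_bound N (u : nat -> R -> C) (K : R -> R) :
  (forall i t, 1 <= t -> cder (u i) t (u i.+1 t)) ->
  (forall s t, 1 <= s -> s <= t -> K t <= K s) ->
  (forall t, 1 <= t -> norm1 (u N t) <= K t) ->
  forall t, 1 <= t -> norm1 (difference N (u 0%N) t) <= 2 ^+ N * K t.
Proof.
elim: N u K => [|N IH] u K du mK bu t t1; first by rewrite expr0 mul1r bu.
rewrite exprSr -mulrA /=; have ge1 (s : R) : 1 <= s -> 1 <= s + 1 by move=> ?; lra.
apply: (IH (fun i t => u i t - u i (t + 1)) (fun t => 2 * K t)) => //.
- move=> i s s1; apply: cderB; first exact: du.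
  by apply: cder_shift; apply: du; exact: ge1.
- by move=> s r s1 sr; rewrite ler_pM2l // mK.
- move=> s s1; rewrite -norm1N opprB.
  have := @cmvt (u N) (u N.+1) s (s + 1) (K s); rewrite addrAC subrr add0r mulr1.
  apply; first by rewrite ltrDl.
    by move=> r /andP[sr _]; apply: du; lra.
  by move=> r /andP[sr _]; apply: le_trans (bu _ _) (mK _ _ _ _) => //; lra.
Qed.

End ComplexCalculus.

(** * Complex powers, their logarithmic derivatives and differences *)

Section ScaledPowers.
Variables (R : realType) (a : R).
Local Notation C := R[i].
Hypothesis a_ge1 : 1 <= a.
Implicit Types (z w : C) (t : R) (q : {poly C}).

Lemma cexpD z w : cexp (z + w) = cexp z * cexp w.
Proof.
case: z w => p q [r s]; rewrite /cexp /= expRD cosD sinD.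
by apply/eqP; rewrite eq_complex /=; apply/andP; split; apply/eqP; ring.
Qed.

Lemma cexp0 : cexp (0 : C) = 1.
Proof. by rewrite /cexp /= expR0 cos0 sin0 mul1r. Qed.

Definition scaled_ln t : R := ln (a * t).
Local Notation L := scaled_ln.

Lemma a_gt0 : 0 < a.
Proof. by apply: lt_le_trans a_ge1. Qed.

Lemma scaled_ln_derive t : 0 < t -> is_derive t 1 L t^-1.
Proof.
move=> t0; have h := is_derive_scalef a (is_derive_id t 1).
have h' := is_derive1_ln (mulr_gt0 a_gt0 t0).
apply: is_derive_eq (is_derive1_comp (f := @ln R) (g := fun s => a * s) h' h) _.
by rewrite mulr1 invfM mulrAC mulVf ?mul1r // gt_eqF // a_gt0.
Qed.

Lemma cexp_scaled_ln t : 0 < t -> cexp (- (L t)%:C) = ((a * t)^-1)%:C :> C.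
Proof.
move=> t0; rewrite /cexp /= oppr0 cos0 sin0 expRN lnK ?posrE ?mulr_gt0 ?a_gt0 //.
by rewrite [X in _ * X](_ : _ = 1) ?mulr1.
Qed.

(* The functions [q(ln (a t)) (a t)^(-w)], with [q] a polynomial, are stable under differentiation. *)
Definition log_power q w t : C := q.[(L t)%:C] * cexp (- w * (L t)%:C).

Lemma cder_log_power q w t : 0 < t ->
  cder (log_power q w) t (a%:C * log_power (q^`() - w *: q) (w + 1) t).
Proof.
move=> t0; have hL := cder_real (scaled_ln_derive t0).
apply: cder_eq (cderM (cder_poly q hL) (cder_exp (cderZ (- w) hL))) _.
rewrite /log_power opprD mulrDl mulN1r cexpD cexp_scaled_ln // hornerD hornerN hornerZ.
move: (q^`().[_]) (q.[_]) (cexp _) => x y e.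
have -> : (t^-1)%:C = a%:C * ((a * t)^-1)%:C :> C.
  by rewrite -rmorphM invfM mulrA divff ?mul1r // gt_eqF // a_gt0.
by ring.
Qed.

Fixpoint log_poly q w i : {poly C} :=
  if i is j.+1 then (log_poly q w j)^`() - (w + j%:R) *: log_poly q w j else q.

Lemma cder_log_poly q w i t : 1 <= t ->
  cder (fun t => a%:C ^+ i * log_power (log_poly q w i) (w + i%:R) t) t
    (a%:C ^+ i.+1 * log_power (log_poly q w i.+1) (w + i.+1%:R) t).
Proof.
move=> t1; have t0 : 0 < t by apply: lt_le_trans t1.
apply: cder_eq (cderZ _ (cder_log_power _ _ t0)) _.
by rewrite /= mulrA -exprSr -addrA natr1.
Qed.

(** Three coefficients suffice: the polynomials have degree at most 2, as only two derivatives in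
    the exponent enter the Taylor estimate. *)
Definition poly_norm q : R := \sum_(i < 3) norm1 q`_i.

Lemma poly_norm_ge0 q : 0 <= poly_norm q.
Proof. by apply: sumr_ge0 => i _; exact: norm1_ge0. Qed.

Lemma poly_norm_step q c : (size q <= 3)%N ->
  poly_norm (q^`() - c *: q) <= (2 + norm1 c) * poly_norm q.
Proof.
move=> sq; rewrite /poly_norm !big_ord_recr !big_ord0 /= !coefD !coefN !coefZ !coef_deriv !add0r.
have -> : q`_3 = 0 by rewrite nth_default.
rewrite mul0rn sub0r norm1N !mulr1n.
have M2 : norm1 (q`_2 *+ 2) <= 2 * norm1 q`_2.
  by rewrite mulr2n (le_trans (norm1D _ _)) //; lra.
have h0 := le_trans (norm1B q`_1 (c * q`_0)) (lerD (lexx _) (norm1M c q`_0)).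
have h1 := le_trans (norm1B (q`_2 *+ 2) (c * q`_1)) (lerD M2 (norm1M c q`_1)).
have h2 := norm1M c q`_2.
have := norm1_ge0 q`_0; have := norm1_ge0 q`_1; have := norm1_ge0 q`_2; have := norm1_ge0 c.
move: (norm1 c) (norm1 q`_0) (norm1 q`_1) (norm1 q`_2) h0 h1 h2 => c' x y v.
by move: (norm1 _) (norm1 _) (norm1 _) => X Y Z; nra.
Qed.

Lemma size_log_poly q w i : (size q <= 3)%N -> (size (log_poly q w i) <= 3)%N.
Proof.
move=> sq; elim: i => [//|i IH] /=.
apply: leq_trans (size_polyD _ _) _; rewrite geq_max size_polyN; apply/andP; split.
  exact: leq_trans (size_poly _ _) (leq_trans (leq_pred _) IH).
exact: leq_trans (size_scale_leq _ _) IH.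
Qed.

Lemma poly_norm_log_poly q w (rho : R) N : (size q <= 3)%N -> norm1 w <= rho ->
  poly_norm (log_poly q w N) <= (2 + rho + N%:R) ^+ N * poly_norm q.
Proof.
move=> sq wr; have r0 : 0 <= rho by apply: le_trans wr; exact: norm1_ge0.
suff h i : (i <= N)%N -> poly_norm (log_poly q w i) <= (2 + rho + N%:R) ^+ i * poly_norm q by exact: h.
elim: i => [|i IH] iN; first by rewrite expr0 mul1r.
apply: le_trans (poly_norm_step _ (size_log_poly w i sq)) _.
rewrite exprS -mulrA; apply: ler_pM; rewrite ?poly_norm_ge0 ?addr_ge0 ?norm1_ge0 //;
  last exact: IH (ltnW iN).
rewrite -[leRHS]addrA lerD2l; apply: le_trans (norm1D _ _) _; apply: lerD => //.
by rewrite -(rmorph_nat (real_complex R)) norm1_real ger0_norm // ler_nat ltnW.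
Qed.

(** As 1 + ln T <= T, the polynomial in the logarithm costs at most T^2; against T^(-4) a summable
    inverse square remains. This is the origin of the constant 4. *)
Lemma norm1_log_power q w t : 1 <= t -> (size q <= 3)%N -> 4 <= complex.Re w ->
  norm1 (log_power q w t) <= 2 * poly_norm q / t ^+ 2.
Proof.
move=> t1 sq w4; have t0 : 0 < t by apply: lt_le_trans t1.
have at1 : 1 <= a * t by rewrite -[1]mulr1 ler_pM.
have L0 : 0 <= L t by rewrite ln_ge0.
pose T := a * t; have LT : 1 + L t <= T.
  by rewrite -[T]lnK ?posrE ?(lt_le_trans ltr01) // expR_ge1Dx.
have hq : norm1 q.[(L t)%:C] <= poly_norm q * T ^+ 2.
  rewrite (horner_coef_wide _ sq) (le_trans (norm1_sum _ _)) // mulr_suml; apply: ler_sum => i _.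
  apply: le_trans (norm1M _ _) _; rewrite ler_wpM2l ?norm1_ge0 // -rmorphXn norm1_real ger0_norm
    ?exprn_ge0 //.
  apply: le_trans (_ : (1 + L t) ^+ i <= _); first by rewrite lerXn2r ?nnegrE ?addr_ge0 // lerDr.
  apply: le_trans (_ : T ^+ i <= _); first by rewrite lerXn2r ?nnegrE ?addr_ge0 // (le_trans _ LT)
    ?addr_ge0.
  by apply: (ler_weXn2l at1); have := ltn_ord i; lia.
have he : norm1 (cexp (- w * (L t)%:C)) <= 2 * (T ^+ 4)^-1.
  apply: le_trans (norm1_cexp _) _; rewrite ler_pM2l // -[T]lnK ?posrE ?(lt_le_trans ltr01) //.
  rewrite -expRM_natl -expRN ler_expR; case: w w4 => x y /= x4.
  by rewrite mulr0 subr0 -/T mulNr lerN2 -[ln T]/(L t) ler_wpM2r.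
apply: le_trans (norm1M _ _) _.
apply: le_trans (ler_pM (norm1_ge0 _) (norm1_ge0 _) hq he) _.
have T0 : 0 < T by apply: lt_le_trans at1.
have -> : poly_norm q * T ^+ 2 * (2 * (T ^+ 4)^-1) = 2 * poly_norm q / T ^+ 2.
  by field; rewrite gt_eqF.
rewrite ler_wpM2l ?mulr_ge0 ?poly_norm_ge0 // lef_pV2 ?posrE ?exprn_gt0 //.
rewrite lerXn2r ?nnegrE ?(ltW t0) ?(ltW T0) //.
by rewrite /T ler_peMl // ltW.
Qed.

(** [N] differences act like [N] derivatives and raise the exponent from w to w + N. The bound is
    uniform for w in a bounded set. *)
Lemma difference_log_power q (rho : R) N : (size q <= 3)%N ->
  exists2 K, 0 <= K & forall w t, norm1 w <= rho -> 4 <= complex.Re w + N%:R -> 1 <= t ->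
    norm1 (difference N (log_power q w) t) <= K / t ^+ 2.
Proof.
move=> sq.
have K0 : 0 <= a ^+ N * (2 * ((2 + `|rho| + N%:R) ^+ N * poly_norm q)).
  by rewrite !mulr_ge0 ?exprn_ge0 ?poly_norm_ge0 ?addr_ge0 // (ltW a_gt0).
exists (2 ^+ N * (a ^+ N * (2 * ((2 + `|rho| + N%:R) ^+ N * poly_norm q)))).
  by rewrite mulr_ge0 ?exprn_ge0.
move=> w t wr wN t1; rewrite -mulrA.
have -> : difference N (log_power q w) t = difference N (fun t =>
  a%:C ^+ 0 * log_power (log_poly q w 0) (w + 0%:R) t) t.
  by congr (difference N _ t); apply/funext => s; rewrite expr0 mul1r addr0.
apply: (difference_bound (u := fun i t => a%:C ^+ i * log_power (log_poly q w i) (w + i%:R) t)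
  (K := fun t => a ^+ N * (2 * ((2 + `|rho| + N%:R) ^+ N * poly_norm q)) / t ^+ 2)) => //.
- by move=> i s s1; exact: cder_log_poly.
- move=> s r s1 sr; have s0 : 0 < s by apply: lt_le_trans s1.
  have r0 : 0 < r by apply: lt_le_trans sr.
  rewrite (ler_wpM2l K0) // lef_pV2 ?posrE ?exprn_gt0 //.
  by rewrite lerXn2r // nnegrE ltW.
- move=> s s1; apply: le_trans (norm1M _ _) _.
  rewrite -rmorphXn norm1_real ger0_norm ?exprn_ge0 ?(ltW a_gt0) // -mulrA.
  rewrite ler_pM2l ?exprn_gt0 ?a_gt0 //.
  apply: le_trans (norm1_log_power s1 (size_log_poly w N sq) _) _.
    by case: w {wr} wN => x y; rewrite /= -(rmorph_nat (real_complex R)).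
  have s0 : 0 < s by apply: lt_le_trans s1.
  have s2 : 0 <= (s ^+ 2)^-1 by rewrite invr_ge0 exprn_ge0 // ltW.
  rewrite (ler_wpM2r s2) // ler_pM2l //.
  by apply: poly_norm_log_poly => //; exact: le_trans (ler_norm _).
Qed.

(** The [b]-th derivative of (a t)^(- z) with respect to z. *)
Definition logp (b : nat) z t : C := log_power ((- 'X) ^+ b) z t.

Lemma logpE b z t : logp b z t = (- (L t)%:C) ^+ b * cexp (- z * (L t)%:C).
Proof. by rewrite /logp /log_power horner_exp hornerN hornerX. Qed.

Lemma size_logp b : (b <= 2)%N -> (size ((- 'X) ^+ b : {poly C}) <= 3)%N.
Proof.
move=> b2; apply: leq_trans (size_poly_exp_leq _ _) _.
by rewrite size_polyN size_polyX mul1n ltnS.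
Qed.

Lemma cder_logp b z h t (x : R) :
  cder (fun y => logp b (z + y%:C * h) t) x (h * logp b.+1 (z + x%:C * h) t).
Proof.
under eq_fun do rewrite logpE.
have hx : cder (fun y : R => - (z + y%:C * h) * (L t)%:C) x (- (h * (L t)%:C)).
  have h1 := cderD (cder_cst z x) (cderZ h (cder_real (is_derive_id x 1))).
  have h2 := cderZ (- (L t)%:C) h1.
  have -> : (fun y : R => - (z + y%:C * h) * (L t)%:C) = (fun y => - (L t)%:C * (z + h * y%:C)).
    by apply/funext => y; ring.
  by apply: cder_eq h2 _; rewrite mulr1 add0r; ring.
apply: cder_eq (cderZ _ (cder_exp hx)) _.
by rewrite logpE exprS; ring.
Qed.

End ScaledPowers.

Section ComplexLimits.
Variable R : realType.
Local Notation C := R[i].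
Implicit Types (s : nat -> C) (S : C).

(** The limit is the supremum of the lower bounds s_m - K / (m + 1). *)
Lemma real_rate_limit (s : nat -> R) (K : R) :
  (forall m p, (m <= p)%N -> `|s p - s m| <= K / m.+1%:R) ->
  exists S : R, forall m, `|s m - S| <= K / m.+1%:R.
Proof.
move=> h; have K0 : 0 <= K by have := h 0%N 0%N (leqnn _); rewrite subrr normr0 divr1.
pose E : set R := [set x | exists m, x = s m - K / m.+1%:R].
have Eub m : ubound E (s m + K / m.+1%:R).
  move=> x [p ->]; have pos q : 0 <= K / q.+1%:R by rewrite divr_ge0.
  have := pos m; have := pos p; case: (leqP m p) => [mp|/ltnW pm].
    by have := h _ _ mp; rewrite ler_norml => /andP[]; move: (K / m.+1%:R) (K / p.+1%:R) => *; lra.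
  by have := h _ _ pm; rewrite ler_norml => /andP[]; move: (K / m.+1%:R) (K / p.+1%:R) => *; lra.
have sE : has_sup E by split; [exists (s 0%N - K / 1%:R), 0%N | exists (s 0%N + K / 1%:R); exact: Eub].
exists (sup E) => m; rewrite ler_distl; apply/andP; split.
  by rewrite lerBlDr; apply: ge_sup; [exact: sE.1 | exact: Eub].
by rewrite -lerBlDr; apply: ub_le_sup; [exact: sE.2 | exists m].
Qed.

Lemma complex_rate_limit s (K : R) :
  (forall m p, (m <= p)%N -> norm1 (s p - s m) <= K / m.+1%:R) ->
  exists S, forall m, norm1 (s m - S) <= 2 * K / m.+1%:R.
Proof.
move=> h.
have [a ha] : exists a, forall m, `|complex.Re (s m) - a| <= K / m.+1%:R.
  apply: real_rate_limit => m p mp; apply: le_trans (h m p mp).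
  by rewrite /norm1; case: (s p) => ? ?; case: (s m) => ? ? /=; rewrite lerDl.
have [b hb] : exists b, forall m, `|complex.Im (s m) - b| <= K / m.+1%:R.
  apply: real_rate_limit => m p mp; apply: le_trans (h m p mp).
  by rewrite /norm1; case: (s p) => ? ?; case: (s m) => ? ? /=; rewrite lerDr.
exists (a +i* b) => m; have := lerD (ha m) (hb m); rewrite /norm1; case: (s m) => x y /= hh.
by apply: le_trans hh _; rewrite -mulrDl (_ : K + K = 2 * K) //; ring.
Qed.

(** Telescoping, from 1 / x^2 <= 2 / x - 2 / (x + 1) for x >= 1. *)
Lemma sum_inverse_squares m p : (m <= p)%N ->
  \sum_(m <= i < p) ((i.+1%:R : R) ^+ 2)^-1 <= 2 / m.+1%:R.
Proof.
move=> mp.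
suff : \sum_(m <= i < p) ((i.+1%:R : R) ^+ 2)^-1 <= 2 / m.+1%:R - 2 / p.+1%:R.
  by move/le_trans; apply; rewrite lerBlDr lerDl divr_ge0.
elim: p mp => [|p IH].
  by rewrite leqn0 => /eqP ->; rewrite big_geq // subrr.
rewrite leq_eqVlt => /predU1P[->|].
  by rewrite big_geq // subrr.
rewrite ltnS => mp; rewrite big_nat_recr //=; apply: le_trans (lerD (IH mp) (lexx _)) _.
rewrite -addrA lerD2l.
have -> : p.+2%:R = p.+1%:R + 1 :> R by rewrite natr1.
have x1 : 1 <= p.+1%:R :> R by rewrite ler1n.
move: (p.+1%:R : R) x1 => x x1; have x0 : 0 < x by lra.
rewrite -subr_ge0.
have -> : - (2 / (x + 1)) - (- (2 / x) + (x ^+ 2)^-1) = (x - 1) / (x ^+ 2 * (x + 1)).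
  by field; rewrite !gt_eqF //; lra.
by rewrite divr_ge0 ?mulr_ge0 ?exprn_ge0 //; lra.
Qed.

Lemma series_rate (a : nat -> C) (K : R) : 0 <= K -> (forall i, norm1 (a i) <= K / i.+1%:R ^+ 2) ->
  forall m p, (m <= p)%N -> norm1 (\sum_(i < p) a i - \sum_(i < m) a i) <= 2 * K / m.+1%:R.
Proof.
move=> K0 ha m p mp; rewrite -!(big_mkord xpredT a) (big_cat_nat (leq0n m) mp) //= addrAC subrr add0r.
apply: le_trans (norm1_sum _ _) _.
apply: le_trans (_ : \sum_(m <= i < p) K * (i.+1%:R ^+ 2)^-1 <= _).
  by apply: ler_sum => i _; exact: ha.
rewrite -mulr_sumr [2 * K]mulrC -mulrA ler_wpM2l //; exact: sum_inverse_squares.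
Qed.

End ComplexLimits.

(** * Summation by parts for periodic coefficients of mean zero *)

Section PeriodicSeries.
Variables (R : realType) (a : R) (P : nat) (chi0 : nat -> R[i]).
Local Notation C := R[i].
Hypotheses (a_ge1 : 1 <= a) (P_gt0 : (0 < P)%N).
Hypothesis chi0_per : forall i, chi0 (i + P)%N = chi0 i.
Hypothesis chi0_mean : \sum_(i < P) chi0 i = 0.
Implicit Types (A : nat -> C) (u : R -> C) (z h S : C).

Definition partial_sums A i := \sum_(j < i) A j.
Definition mean_partial A : C := (P%:R)^-1 * \sum_(i < P) partial_sums A i.+1.
(** Partial sums of a periodic sequence of mean zero are again periodic; subtracting their mean
    restores mean zero, so that summation by parts can be repeated. *)
Definition centered_sums A i := partial_sums A i.+1 - mean_partial A.

Lemma centered_sums_per A : (forall i, A (i + P)%N = A i) -> \sum_(i < P) A i = 0 ->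
  (forall i, centered_sums A (i + P)%N = centered_sums A i) /\ \sum_(i < P) centered_sums A i = 0.
Proof.
move=> pA mA; split=> [i|].
  congr (_ - _); rewrite /partial_sums -addSn addnC -!(big_mkord xpredT A).
  rewrite (big_cat_nat (n := P)) ?leq_addr //= big_mkord mA add0r.
  by rewrite -{1}[P]add0n big_addn addKn; apply: eq_bigr => j _; exact: pA.
rewrite [LHS](_ : _ = \sum_(i < P) (partial_sums A i.+1 - mean_partial A)) //.
rewrite sumrB sumr_const card_ord -mulr_natl /mean_partial mulrA mulfV ?mul1r ?subrr //.
by rewrite pnatr_eq0 -lt0n.
Qed.

Definition iter_sums N := iter N centered_sums chi0.
Definition iter_mean N : C := mean_partial (iter_sums N).

Lemma iter_sums_per N : (forall i, iter_sums N (i + P)%N = iter_sums N i) /\ \sum_(i < P) iter_sums N i = 0.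
Proof. by elim: N => [|N [p m]] //=; exact: centered_sums_per. Qed.

Lemma periodic_bounded A : (forall i, A (i + P)%N = A i) -> exists2 K, 0 <= K & forall i, norm1 (A i) <= K.
Proof.
move=> pA; exists (\sum_(i < P) norm1 (A i)); first by apply: sumr_ge0 => i _; exact: norm1_ge0.
move=> i; have -> : A i = A (i %% P)%N.
  rewrite {1}(divn_eq i P) addnC; elim: (i %/ P)%N => [|d IH]; first by rewrite mul0n addn0.
  by rewrite mulSn addnCA addnC pA.
by rewrite (bigD1 (Ordinal (ltn_pmod i P_gt0))) //= lerDl sumr_ge0 // => j _; exact: norm1_ge0.
Qed.

(* [N] summations by parts applied to [\sum_i chi0 i * u (i + 1)], up to terms at the upper end. *)
Definition expansion N m u : C :=
  \sum_(j < N) iter_mean j * difference j u 1 +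
  \sum_(i < m) iter_sums N i * difference N u i.+1%:R.

Lemma abel_step N m u : expansion N m u =
  expansion N.+1 m u + (partial_sums (iter_sums N) m - iter_mean N) * difference N u m.+1%:R.
Proof.
rewrite /expansion [X in _ = X + _ + _]big_ord_recr /= -!addrA; congr (_ + _).
elim: m => [|m IH].
  by rewrite /partial_sums !big_ord0 add0r sub0r mulNr subrr.
rewrite big_ord_recr /= IH [X in _ = _ + (X + _)]big_ord_recr /= -!addrA; congr (_ + (_ + _)).
have -> : difference N (fun t => u t - u (t + 1)) m.+1%:R = difference N.+1 u m.+1%:R by [].
rewrite difference_shift natr1 /= -/(iter_sums N) /centered_sums /partial_sums big_ord_recr /=
  -/(iter_mean N).
by rewrite /partial_sums; ring.
Qed.

Local Notation lp b z := (logp a b z).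

(** The explicit rate lets identities and Taylor estimates pass to the limit through
    [small_rate]. *)
Definition limit_at N z S := exists K : R, forall m, norm1 (expansion N m (lp 0 z) - S) <= K / m.+1%:R.

Lemma logp_difference_bound b N (rho : R) : (b <= 2)%N -> exists2 K, 0 <= K &
  forall z t, norm1 z <= rho -> 4 <= complex.Re z + N%:R -> 1 <= t ->
  norm1 (difference N (lp b z) t) <= K / t ^+ 2.
Proof. by move=> b2; exact: difference_log_power (size_logp _ b2). Qed.

Lemma expansion_rate b N (rho : R) : (b <= 2)%N -> exists2 K, 0 <= K &
  forall z m p, norm1 z <= rho -> 4 <= complex.Re z + N%:R -> (m <= p)%N ->
  norm1 (expansion N p (lp b z) - expansion N m (lp b z)) <= K / m.+1%:R.
Proof.
move=> b2; have [K K0 hK] := logp_difference_bound N rho b2.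
have [K' K'0 hK'] := periodic_bounded (iter_sums_per N).1.
exists (2 * (K' * K)); first by rewrite !mulr_ge0.
move=> z m p zr zN mp; rewrite /expansion opprD addrACA subrr add0r.
apply: (@series_rate R (fun i => iter_sums N i * difference N (lp b z) i.+1%:R)) => //;
  first by rewrite mulr_ge0.
move=> i; apply: le_trans (norm1M _ _) _; rewrite -mulrA ler_pM ?norm1_ge0 //.
by apply: hK => //; rewrite ler1n.
Qed.

Lemma limit_at_exists N z : 4 <= complex.Re z + N%:R -> exists S, limit_at N z S.
Proof.
move=> zN; have [K _ hK] := @expansion_rate 0 N (norm1 z) isT.
have [S hS] := @complex_rate_limit R (fun m => expansion N m (lp 0 z)) K
  (fun m p mp => hK z m p (lexx _) zN mp).
by exists S, (2 * K).
Qed.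

(** The two expansions differ by the end term of [abel_step], a bounded factor times a difference of
    order 1 / m^2. *)
Lemma limit_at_succ N z S : 4 <= complex.Re z + N%:R -> limit_at N z S -> limit_at N.+1 z S.
Proof.
move=> zN [K hK]; have [D D0 hD] := @logp_difference_bound 0 N (norm1 z) isT.
have [K' K'0 hK'] := periodic_bounded (iter_sums_per N.+1).1.
exists (K + (K' + norm1 (iter_mean N)) * D) => m.
have -> : expansion N.+1 m (lp 0 z) - S = (expansion N m (lp 0 z) - S) -
    (partial_sums (iter_sums N) m - iter_mean N) * difference N (lp 0 z) m.+1%:R.
  by rewrite (abel_step N m); ring.
apply: le_trans (norm1B _ _) _; rewrite [leRHS]mulrDl lerD //.
apply: le_trans (norm1M _ _) _; rewrite -mulrA ler_pM ?norm1_ge0 //.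
  case: m => [|m]; first by rewrite /partial_sums big_ord0 sub0r norm1N lerDr.
  by apply: le_trans (hK' m) _; rewrite lerDl norm1_ge0.
apply: le_trans (hD z _ (lexx _) zN _) _; first by rewrite ler1n.
rewrite ler_wpM2l // lef_pV2 ?posrE ?exprn_gt0 ?ltr0n //.
by rewrite expr2 ler_peMr ?ler1n.
Qed.

Lemma limit_at_le N N' z S : (N <= N')%N -> 4 <= complex.Re z + N%:R -> limit_at N z S -> limit_at N' z S.
Proof.
move=> NN' zN h; elim: N' NN' => [|N' IH]; first by rewrite leqn0 => /eqP <-.
rewrite leq_eqVlt => /predU1P[<- //|NN']; apply: limit_at_succ; last exact: IH.
by apply: le_trans zN _; rewrite lerD2l ler_nat.
Qed.

Lemma small_rate (K x : R) : (forall m : nat, x <= K / m.+1%:R) -> x <= 0.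
Proof.
move=> h; rewrite leNgt; apply/negP => x0.
have := h (`|Num.ceil (`|K| / x)|)%N; apply/negP; rewrite -ltNge ltr_pdivrMr // mulrC -ltr_pdivrMr //.
have le1 : K / x <= `|K| / x by rewrite ler_pM2r ?invr_gt0 // ler_norm.
apply: le_lt_trans le1 _.
by apply: le_lt_trans (ceil_ge _) _; rewrite -natr1 natr_absz ltr_pwDr // ler_int ler_norm.
Qed.

Lemma limit_at_unique N z S S' : limit_at N z S -> limit_at N z S' -> S = S'.
Proof.
move=> [K hK] [K' hK']; apply/eqP; rewrite -subr_eq0; apply/eqP/norm1_eq0.
apply: (@small_rate (K + K')) => m.
have -> : S - S' = (expansion N m (lp 0 z) - S') - (expansion N m (lp 0 z) - S) by ring.
by apply: le_trans (norm1B _ _) _; rewrite mulrDl addrC lerD.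
Qed.

Lemma continuation_exists : exists f : C -> C, forall z N, 4 <= complex.Re z + N%:R -> limit_at N z (f z).
Proof.
have ex z : exists S, forall N, 4 <= complex.Re z + N%:R -> limit_at N z S.
  pose N0 := `|Num.ceil (4 - complex.Re z)|%N.
  have z0 : 4 <= complex.Re z + N0%:R.
    rewrite -lerBlDl; apply: le_trans (ceil_ge _) _.
    by rewrite natr_absz ler_int ler_norm.
  have [S hS] := limit_at_exists z0; exists S => N zN.
  have [S' hS'] := limit_at_exists zN; have -> // : S = S'.
  apply: (@limit_at_unique (maxn N0 N) z).
    exact: limit_at_le (leq_maxl _ _) z0 hS.
  exact: limit_at_le (leq_maxr _ _) zN hS'.
by have [f hf] := choice ex; exists f.
Qed.

Lemma expansion_cder N m (F : R -> R -> C) (F' : R -> C) (x : R) :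
  (forall t, cder (fun y => F y t) x (F' t)) ->
  cder (fun y => expansion N m (F y)) x (expansion N m F').
Proof.
move=> dF; apply: cderD; apply: cder_sum => i; apply: cderZ; exact: difference_cder.
Qed.

Lemma differenceZ N (c : C) u t : difference N (fun t => c * u t) t = c * difference N u t.
Proof. by elim: N u t => [//|N IH] u t; rewrite !difference_shift !IH mulrBr. Qed.

Lemma expansionZ N m (c : C) u : expansion N m (fun t => c * u t) = c * expansion N m u.
Proof.
rewrite /expansion mulrDr !mulr_sumr; congr (_ + _); apply: eq_bigr => i _;
by rewrite differenceZ mulrCA.
Qed.

Lemma logp_bound b t (rho : R) : exists2 K, 0 <= K & forall z, norm1 z <= rho -> norm1 (lp b z t) <= K.
Proof.
pose l := (- (scaled_ln a t)%:C) ^+ b.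
exists (norm1 l * (2 * expR (rho * `|scaled_ln a t|))).
  by rewrite mulr_ge0 ?norm1_ge0 // mulr_ge0 ?expR_ge0.
move=> z zr; rewrite logpE -/l; apply: le_trans (norm1M _ _) _; rewrite ler_wpM2l ?norm1_ge0 //.
apply: le_trans (norm1_cexp _) _; rewrite ler_pM2l // ler_expR.
case: z zr => x y zr; rewrite /= mulr0 subr0.
apply: le_trans (ler_norm _) _; rewrite normrM normrN ler_wpM2r //.
by apply: le_trans zr; rewrite /norm1 /= lerDl.
Qed.

Lemma difference_logp_bound N b t (rho : R) : exists2 K, 0 <= K &
  forall z, norm1 z <= rho -> norm1 (difference N (lp b z) t) <= K.
Proof.
elim: N t => [|N IH] t; first exact: logp_bound.
have [K K0 hK] := IH t; have [K' K'0 hK'] := IH (t + 1).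
exists (K + K'); first by rewrite addr_ge0.
move=> z zr; rewrite difference_shift; apply: le_trans (norm1B _ _) _.
by rewrite lerD ?hK ?hK'.
Qed.

(** For m = 0 only the finitely many boundary terms remain; [expansion_rate] controls the rest
    uniformly in m. *)
Lemma expansion_bound N (rho : R) : exists2 K, 0 <= K & forall z m, norm1 z <= rho ->
  4 <= complex.Re z + N%:R -> norm1 (expansion N m (lp 2 z)) <= K.
Proof.
have [K K0 hK] := @expansion_rate 2 N rho isT.
have hD j : exists D, 0 <= D /\ forall z, norm1 z <= rho -> norm1 (difference j (lp 2 z) 1) <= D.
  by have [D D0 hD] := difference_logp_bound j 2 1 rho; exists D.
have [D DP] := choice hD.
exists (K + \sum_(j < N) norm1 (iter_mean j) * D j).
  by rewrite addr_ge0 // sumr_ge0 // => j _; rewrite mulr_ge0 ?norm1_ge0 ?(DP j).1.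
move=> z m zr zN; rewrite -[expansion N m _](subrK (expansion N 0 (lp 2 z))).
apply: le_trans (norm1D _ _) _; rewrite lerD //.
  by have := hK z 0%N m zr zN (leq0n m); rewrite divr1.
rewrite /expansion big_ord0 addr0; apply: le_trans (norm1_sum _ _) _; apply: ler_sum => j _.
by apply: le_trans (norm1M _ _) _; rewrite ler_wpM2l ?norm1_ge0 // (DP j).2.
Qed.

Section Continuation.
Variable f : C -> C.
Hypothesis f_limit : forall z N, 4 <= complex.Re z + N%:R -> limit_at N z (f z).

Lemma expansion_taylor N m z h (K : R) : 
  (forall x : R, 0 <= x <= 1 -> norm1 (expansion N m (lp 2 (z + x%:C * h))) <= K) ->
  norm1 (expansion N m (lp 0 (z + h)) - expansion N m (lp 0 z) - h * expansion N m (lp 1 z)) <=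
  4 * (norm1 h ^+ 2 * K).
Proof.
move=> hK; pose e b (x : R) := expansion N m (lp b (z + x%:C * h)).
have de b x : cder (e b) x (h * e b.+1 x).
  have := @expansion_cder N m (fun y t => lp b (z + y%:C * h) t) (fun t => h * lp b.+1 (z + x%:C * h) t) x.
  by rewrite expansionZ; apply=> t; exact: cder_logp.
have := @taylor2 R (e 0%N) (fun x => h * e 1%N x) (fun x => h * (h * e 2%N x)) (norm1 h ^+ 2 * K) (de 0%N)
  (fun x => cderZ h (de 1%N x)).
rewrite /e !mul1r !mul0r !addr0; apply=> x x01.
apply: le_trans (norm1M _ _) _; rewrite expr2 -mulrA ler_wpM2l ?norm1_ge0 //.
apply: le_trans (norm1M _ _) _; rewrite ler_wpM2l ?norm1_ge0 //; exact: hK.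
Qed.

(** The expansions are smooth in z with second derivative bounded uniformly in m, so their quadratic
    Taylor estimate survives in the limit; complex differentiability follows. *)
Lemma continuation_quadratic p : exists d K, 0 <= K /\ forall h, norm1 h <= 1 ->
  norm1 (f (p + h) - f p - h * d) <= K * norm1 h ^+ 2.
Proof.
(* 5 instead of 4 leaves room for increments [h] of size at most 1. *)
have [N pN] : exists N : nat, 5 <= complex.Re p + N%:R.
  exists `|Num.ceil (5 - complex.Re p)|%N.
  by rewrite -lerBlDl; apply: le_trans (ceil_ge _) _; rewrite natr_absz ler_int ler_norm.
have near h : norm1 h <= 1 -> norm1 (p + h) <= norm1 p + 1 /\ 4 <= complex.Re (p + h) + N%:R.
  move=> h1; split; first by apply: le_trans (norm1D _ _) _; rewrite lerD2l.
  move: h1 pN; rewrite /norm1; case: p => x y; case: h => b c /=; move: (N%:R : R) => q.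
  by have := normr_ge0 c; have := ler_norm (- b); rewrite normrN; lra.
have p4 : 4 <= complex.Re p + N%:R by lra.
have [K1 _ hK1] := @expansion_rate 1 N (norm1 p) isT.
have [d hd] := @complex_rate_limit R (fun m => expansion N m (lp 1 p)) K1
  (fun m q mq => hK1 p m q (lexx _) p4 mq).
have [K2 K20 hK2] := expansion_bound N (norm1 p + 1).
exists d, (4 * K2); split=> [|h h1]; first by rewrite mulr_ge0.
have [Kp hKp] := f_limit p4; have [_ ph4] := near h h1; have [Kh hKh] := f_limit ph4.
rewrite -subr_le0; apply: (@small_rate (Kh + Kp + norm1 h * (2 * K1))) => m.
pose e b z := expansion N m (lp b z).
have T : norm1 (e 0%N (p + h) - e 0%N p - h * e 1%N p) <= 4 * (norm1 h ^+ 2 * K2).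
  apply: expansion_taylor => x /andP[x0 x1].
  have xh : norm1 (x%:C * h) <= 1.
    apply: le_trans (norm1M _ _) _; rewrite norm1_real ger0_norm //.
    by rewrite -[1]mulr1 ler_pM // norm1_ge0.
  by have [q1 q2] := near _ xh; exact: hK2.
have -> : f (p + h) - f p - h * d = (e 0%N (p + h) - e 0%N p - h * e 1%N p) -
   (e 0%N (p + h) - f (p + h)) + (e 0%N p - f p) + h * (e 1%N p - d) by ring.
have tri (X Y Z U : C) (x y v u : R) : norm1 X <= x -> norm1 Y <= y -> norm1 Z <= v -> norm1 U <= u ->
    norm1 (X - Y + Z + U) <= x + y + v + u.
  move=> hX hY hZ hU; apply: le_trans (norm1D _ _) (lerD _ hU).
  by apply: le_trans (norm1D _ _) (lerD (le_trans (norm1B _ _) (lerD hX hY)) hZ).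
rewrite lerBlDr.
apply: le_trans (tri _ _ _ _ _ _ _ _ T (hKh m) (hKp m) (le_trans (norm1M h _) (ler_wpM2l (norm1_ge0 h)
  (hd m)))) _.
move: (m.+1%:R^-1 : R) (norm1 h) => v u.
by rewrite le_eqVlt; apply/orP; left; apply/eqP; ring.
Qed.

(** At z = 0 the function is the constant 1, all of whose differences vanish; only the first
    boundary term, the mean of the partial sums, is left. *)
Lemma continuation0 : f 0 = mean_partial chi0.
Proof.
have z4 : 4 <= complex.Re (0 : C) + 4%:R by rewrite add0r.
have [K hK] := f_limit z4; apply/esym/eqP; rewrite -subr_eq0; apply/eqP/norm1_eq0.
apply: (@small_rate K) => m; have := hK m.
have d1 j (c : C) t : difference j.+1 (fun=> c) t = 0.
  by elim: j t => [|j IH] t; rewrite difference_shift ?IH /= ?subrr.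
have -> : lp 0 0 = fun=> 1.
  by apply/funext => t; rewrite logpE expr0 oppr0 mul0r mul1r cexp0.
have -> // : expansion 4 m (fun=> 1) = mean_partial chi0.
rewrite /expansion [X in _ + X]big1 ?addr0 => [|i _]; last by rewrite (d1 3%N) mulr0.
rewrite big_ord_recl big1 ?addr0 => [|i _]; first by rewrite /= mulr1.
by rewrite lift0 d1 mulr0.
Qed.

Lemma continuation_series z : 4 <= complex.Re z ->
  exists K : R, forall m, norm1 (\sum_(i < m) chi0 i * cpow (a * i.+1%:R) (- z) - f z) <= K / m.+1%:R.
Proof.
move=> z4; have z40 : 4 <= complex.Re z + 0%:R by rewrite addr0.
have [K hK] := f_limit z40; exists K => m; have := hK m.
rewrite /expansion big_ord0 add0r; under eq_bigr do rewrite /= logpE expr0 mul1r.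
by [].
Qed.

End Continuation.

End PeriodicSeries.

Lemma quadratic_derivable (R : realType) (f : R[i] -> R[i]) (z d : R[i]) (K : R) : 0 <= K ->
  (forall h, norm1 h <= 1 -> norm1 (f (z + h) - f z - h * d) <= K * norm1 h ^+ 2) ->
  derivable (f : (R[i])^o -> (R[i])^o) z 1.
Proof.
move=> K0 hf; apply/cvg_ex; exists d; apply/cvgrPdist_le => /= e e0.
have [eI eR] : complex.Im e = 0 /\ 0 < complex.Re e by move: e0; rewrite ltcE /= => /andP[/eqP].
have {eI} eE : e = (complex.Re e)%:C by case: e eI {e0 eR} => ? ? /= ->.
move: (complex.Re e) eR eE => er er0 eE.
(* The bound 1/2 ensures [norm1 h <= 1], because [norm1 h] is at most twice the modulus r; the other
   one makes the error 4 K r at most [er]. *)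
pose del : R := Num.min (2^-1) (er / (4 * K + 1)).
have del0 : 0 < del by rewrite lt_min invr_gt0 ltr0n divr_gt0 //; lra.
near=> h.
have hdel : `|h| <= del%:C by near: h; apply: (@dnbhs0_le _ (R[i])^o); rewrite ltcR.
have h0 : h != 0 by near: h; exact: (@nbhs_dnbhs_neq (R[i])^o 0).
have [r hr] : exists r : R, `|h| = r%:C by rewrite normc_def; eexists.
have r0 : 0 < r by rewrite -ltcR -hr normr_gt0.
have rdel : r <= del by rewrite -lecR -hr.
have h1 : norm1 h <= 2 * r by have := norm1_le_norm h; rewrite hr -[2](rmorph_nat (real_complex R))
  -rmorphM lecR.
have [r1 r2] : r <= 2^-1 /\ r <= er / (4 * K + 1) by move: rdel; rewrite le_min => /andP[].
have := hf h; rewrite (_ : norm1 h <= 1); last by lra.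
move=> /(_ isT) hq.
rewrite [X in f X - _](_ : _ = z + h); last by rewrite /GRing.scale /= mulr1 addrC.
have -> : d - h^-1 *: (f (z + h) - f z) = - (h^-1 * (f (z + h) - f z - h * d)).
  by rewrite mulrBr mulKf // opprB.
rewrite normrN normrM normfV hr -fmorphV.
apply: le_trans (ler_wpM2l _ (norm_le_norm1 _)) _; first by rewrite ler0c invr_ge0 ltW.
rewrite -rmorphM eE lecR; apply: le_trans (ler_wpM2l _ hq) _; first by rewrite invr_ge0 ltW.
apply: le_trans (_ : r^-1 * (K * (2 * r) ^+ 2) <= _).
  by rewrite ler_wpM2l ?invr_ge0 ?(ltW r0) // ler_wpM2l // lerXn2r ?nnegrE ?norm1_ge0 ?mulr_ge0 ?(ltW r0).
have -> : r^-1 * (K * (2 * r) ^+ 2) = 4 * K * r by field; rewrite gt_eqF.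
apply: le_trans (_ : (4 * K + 1) * r <= _); first by rewrite ler_wpM2r ?(ltW r0) // lerDl.
by rewrite mulrC -ler_pdivlMr //; lra.
Unshelve. all: by end_near.
Qed.

(** * The spectral asymmetry *)

Lemma sum_signs (R : comNzRingType) (k : nat) (F : 'I_k -> bool -> R) :
  \sum_(sg : {ffun 'I_k -> bool}) \prod_l F l (sg l) = \prod_l (F l true + F l false).
Proof. by rewrite -bigA_distr_bigA; apply: eq_bigr => l _; rewrite big_bool. Qed.

Definition dvd_indicator (P : nat) (x : int) : nat := (P%:Z %| x)%Z.

Section Phases.
Variables (k : nat) (s : bool).
Local Notation signs := {ffun 'I_k -> bool}.
Local Notation n := k.*2.+1.

Definition sgz_bool (b : bool) : int := if b then 1 else -1.
Definition sign_prod (sg : signs) : int := \prod_l sgz_bool (sg l).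
Definition eigen_residue (sg : signs) : int := sign_prod sg * phase_int s sg.

Lemma sign_prod_sqr sg : sign_prod sg * sign_prod sg = 1.
Proof.
rewrite -big_split /= big1 // => j _.
by rewrite /sgz_bool; case: (sg j); rewrite ?mulrNN mulr1.
Qed.

(* At least two factors are needed: the coordinate left untouched by j kills the sum. *)
Lemma sum_sign_prod_coord (j : 'I_k) : (1 < k)%N -> \sum_sg sign_prod sg * sgz_bool (sg j) = 0.
Proof.
move=> k1; pose F (l : 'I_k) b := sgz_bool b * (if l == j then sgz_bool b else 1).
transitivity (\sum_(sg : signs) \prod_l F l (sg l)).
  apply: eq_bigr => sg _; rewrite big_split /= -/(sign_prod sg); congr (_ * _).
  by rewrite (bigD1 j) //= eqxx big1 ?mulr1 // => l /negPf ->.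
rewrite sum_signs; have [l lj] : exists l, l != j.
  have [j0|j0] := eqVneq (j : nat) 0%N; [exists (Ordinal k1) | exists (Ordinal (ltnW k1))].
    by rewrite -val_eqE /= j0.
  by rewrite -val_eqE /= eq_sym.
by rewrite (bigD1 l) //= /F (negPf lj) /sgz_bool !mulr1 subrr mul0r.
Qed.

Lemma sum_sign_prod : (0 < k)%N -> \sum_sg sign_prod sg = 0.
Proof.
move=> k0; rewrite (sum_signs (fun _ => sgz_bool)) (bigD1 (Ordinal k0)) //=.
by rewrite /sgz_bool subrr mul0r.
Qed.

Lemma sum_eigen_residue : (1 < k)%N -> \sum_sg eigen_residue sg = 0.
Proof.
move=> k1; under eq_bigr do rewrite /eigen_residue /phase_int mulrBr mulr_sumr.
rewrite sumrB -mulr_suml sum_sign_prod ?mul0r ?subr0 ?(ltnW k1) //.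
rewrite exchange_big big1 // => j _.
under eq_bigr do rewrite mulrCA -/(sgz_bool _).
by rewrite -mulr_sumr sum_sign_prod_coord ?mulr0.
Qed.

Variable R : realType.

Lemma sgn_prodE sg : sgn_prod R sg = (sign_prod sg)%:~R.
Proof.
rewrite /sgn_prod /sign_prod rmorph_prod; apply: eq_bigr => l _.
by rewrite /sgn /sgz_bool; case: (sg l); rewrite ?rmorphN1.
Qed.

(** The phase condition reads l e = p modulo 2n with e = [sign_prod sg] and p = [phase_int s sg]. As
    e is its own inverse, it becomes l = e p, the residue p_sg. *)
Lemma vertical_signP (l : int) sg :
  vertical_sign s (pi * l%:~R : R) sg <-> ((n.*2)%:Z %| l - eigen_residue sg)%Z.
Proof.
have n0 : (n%:R : R) != 0 by rewrite pnatr_eq0.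
have p0 : (pi : R) != 0 by rewrite gt_eqF ?pi_gt0.
pose p := phase_int s sg; pose e := sign_prod sg.
have e2 : e * e = 1 by exact: sign_prod_sqr.
have angle : - (pi * l%:~R * sgn_prod R sg) / n%:R - - (pi / n%:R * p%:~R) = pi / n%:R * (p - l * e)%:~R.
  by rewrite sgn_prodE -/e intrB intrM; field.
rewrite /vertical_sign alpha_phaseE -/p; split=> [h|/dvdzP[q hq]].
  have : cis (- (pi * l%:~R * sgn_prod R sg) / n%:R - - (pi / n%:R * p%:~R)) = 1.
    by rewrite cisD h opprK -[X in _ * cis X]opprK mulrC cisN.
  rewrite angle => /cis_eq1[q /(congr1 (fun x => x * n%:R / pi))].
  have -> : pi / n%:R * (p - l * e)%:~R * n%:R / pi = (p - l * e)%:~R :> R.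
    have aux (u v w : R) : v != 0 -> w != 0 -> w / v * u * v / w = u by move=> v0 w0; field; rewrite v0 w0.
    exact: aux.
  have -> : 2 * pi * q%:~R * n%:R / pi = (2 * q * n%:Z)%:~R :> R.
    have aux (u v w : R) : w != 0 -> 2 * w * u * v / w = 2 * u * v by move=> w0; field; rewrite w0.
    by rewrite !intrM aux.
  move=> /intr_inj hq; apply/dvdzP; exists (- (q * e)).
  rewrite /eigen_residue -/p -/e -[l]mulr1 -e2.
  have -> : (n.*2)%:Z = 2 * n%:Z by rewrite -mul2n PoszM.
  have -> : p = l * e + 2 * q * n%:Z by rewrite -hq; ring.
  by ring.
have hp : p - l * e = 2 * (- (q * e)) * n%:Z.
  have l0 : l = q * (2 * n%:Z) + e * p by rewrite -[LHS](subrK (eigen_residue sg)) hq -mul2n PoszM.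
  rewrite l0 (_ : _ * e = e * e * p + q * e * 2 * n%:Z); last by ring.
  by rewrite e2; ring.
have {}angle : - (pi * l%:~R * sgn_prod R sg) / n%:R = 2 * pi * (- (q * e))%:~R + - (pi / n%:R * p%:~R).
  apply/eqP; rewrite -subr_eq angle hp !intrM; apply/eqP.
  by move: ((- (q * e))%:~R : R) => u; field.
by rewrite angle cisD cis_2pi_int mul1r.
Qed.

Definition residue_count (l : int) : nat := (\sum_(sg : signs) dvd_indicator n.*2 (l - eigen_residue sg))%N.

Lemma vertical_multE (l : int) : vertical_mult k s (pi * l%:~R : R) = residue_count l.
Proof.
rewrite /vertical_mult -sum1_card big_mkcond; apply: eq_bigr => sg _.
rewrite -topredE /= /dvd_indicator; case: asboolP => [/vertical_signP -> //|nv].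
by case: (boolP (_ %| _)%Z) => // /vertical_signP.
Qed.

Lemma vertical_mult_support (lam : R) : vertical_mult k s lam != 0%N ->
  exists l : int, lam = pi * l%:~R.
Proof.
move=> /eqP; have [[sg vs] _|nex h] := pselect (exists sg : signs, vertical_sign s lam sg).
  have [b hb] := vertical_sign_int vs; exists (- b * sign_prod sg).
  have e2 : (sign_prod sg)%:~R * (sign_prod sg)%:~R = 1 :> R by rewrite -intrM sign_prod_sqr.
  have hl : lam * (sign_prod sg)%:~R = - (pi * b%:~R) by rewrite -hb opprK sgn_prodE.
  have -> : lam = lam * (sign_prod sg)%:~R * (sign_prod sg)%:~R by rewrite -mulrA e2 mulr1.
  by rewrite hl intrM mulrNz; ring.
case: h; apply: eq_card0 => sg; apply/negbTE; rewrite -topredE /=; apply/asboolP => vs.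
by apply: nex; exists sg.
Qed.

End Phases.

Lemma residue_class_sum (P : nat) (p : int) : (0 < P)%N ->
  (\sum_(i < P) dvd_indicator P (i.+1%:Z - p))%N = 1%N /\
  exists q : int, \sum_(i < P) i.+1%:Z * (dvd_indicator P (i.+1%:Z - p))%:Z = p + P%:Z * q.
Proof.
move=> P0; have P0' : P%:Z != 0 by rewrite -lt0n.
(* The sum runs over i + 1 = 1, ..., P, so the representative of p is ((p - 1) mod P) + 1. *)
pose r := ((p - 1) %% P%:Z)%Z.
have r0 : 0 <= r by rewrite modz_ge0.
have rP : r < P%:Z by rewrite ltz_pmod.
have iP : (`|r| < P)%N by lia.
pose i0 := Ordinal iP.
have hi (i : 'I_P) : dvd_indicator P (i.+1%:Z - p) = (i == i0).
  congr nat_of_bool; apply/idP/eqP => [|->].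
    rewrite -eqz_mod_dvd => /eqP h; apply: val_inj => /=.
    have : (i%:Z %% P%:Z)%Z = r.
      by apply/eqP; rewrite eqz_mod_dvd; move: h => /eqP; rewrite eqz_mod_dvd; congr (_ %| _)%Z; lia.
    by rewrite modz_small; [lia | have := ltn_ord i; lia].
  rewrite (_ : i0.+1%:Z - p = - ((p - 1) %/ P%:Z)%Z * P%:Z) ?dvdz_mull ?dvdzz //.
  by have := divz_eq (p - 1) P%:Z; rewrite -/r /=; lia.
split.
  by rewrite (bigD1 i0) // hi eqxx big1 // => i /andP[_ /negPf ii]; rewrite hi ii.
exists (- ((p - 1) %/ P%:Z)%Z).
rewrite (bigD1 i0) // hi eqxx big1 ?addr0 ?mulr1 => [|i /andP[_ /negPf ii]]; last by rewrite hi ii mulr0.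
rewrite /=.
by have := divz_eq (p - 1) P%:Z; rewrite -/r; lia.
Qed.

Section Asymmetry.
Variables (R : realType) (k : nat) (s : bool).
Local Notation C := R[i].
Local Notation P := (k.*2.+1).*2.
(* Indexed from 0: [asymmetry_int i] concerns the eigenvalues [pi (i + 1)] and [- pi (i + 1)]. *)
Definition asymmetry_int (i : nat) : int :=
  (residue_count k s i.+1%:Z)%:Z - (residue_count k s (- i.+1%:Z))%:Z.
Definition asymmetry (i : nat) : C := (asymmetry_int i)%:~R.

Lemma asymmetry_intE i : asymmetry_int i =
  \sum_(sg : {ffun 'I_k -> bool}) ((dvd_indicator P (i.+1%:Z - eigen_residue s sg))%:Z -
    (dvd_indicator P (i.+1%:Z - - eigen_residue s sg))%:Z).
Proof.
rewrite /asymmetry_int /residue_count !(big_morph Posz PoszD (erefl _)) -sumrB.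
apply: eq_bigr => sg _; congr (_ - _).
by rewrite /dvd_indicator !dvdzE -[absz (- _ - _)]abszN; congr (Posz (nat_of_bool (_ %| absz _)%N)); ring.
Qed.

Lemma asymmetry_per i : asymmetry (i + P) = asymmetry i.
Proof.
congr (_%:~R); rewrite !asymmetry_intE; apply: eq_bigr => sg _.
have h x : dvd_indicator P ((i + P).+1%:Z - x) = dvd_indicator P (i.+1%:Z - x).
  congr nat_of_bool.
  rewrite (_ : (i + P).+1%:Z - x = (i.+1%:Z - x) + P%:Z); last by lia.
  by rewrite rpredDr ?dvdzz.
by rewrite !h.
Qed.

Lemma asymmetry_sum : \sum_(i < P) asymmetry_int i = 0.
Proof.
under eq_bigr do rewrite asymmetry_intE; rewrite exchange_big big1 // => sg _.
have P0 : (0 < P)%N by [].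
rewrite sumrB -!(big_morph Posz PoszD (erefl _)).
by rewrite (residue_class_sum _ P0).1 (residue_class_sum _ P0).1 subrr.
Qed.

Hypothesis k_gt1 : (1 < k)%N.

(** Modulo P the classes of p_sg and - p_sg contribute p_sg - (- p_sg) = 2 p_sg, and the p_sg add up
    to 0. *)
Lemma asymmetry_moment : exists Q : int, \sum_(i < P) i.+1%:Z * asymmetry_int i = P%:Z * Q.
Proof.
have P0 : (0 < P)%N by [].
have hq (sg : {ffun 'I_k -> bool}) := (residue_class_sum (eigen_residue s sg) P0).2.
have hq' (sg : {ffun 'I_k -> bool}) := (residue_class_sum (- eigen_residue s sg) P0).2.
have [q Hq] := choice hq; have [q' Hq'] := choice hq'.
exists (\sum_sg (q sg - q' sg)).
under eq_bigr do rewrite asymmetry_intE mulr_sumr; rewrite exchange_big /=.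
transitivity (\sum_sg (2 * eigen_residue s sg + P%:Z * (q sg - q' sg))).
  apply: eq_bigr => sg _; under eq_bigr do rewrite mulrBr.
  by rewrite sumrB Hq Hq'; ring.
by rewrite big_split /= -!mulr_sumr sum_eigen_residue // mulr0 add0r.
Qed.

Lemma asymmetry_mean : exists m : int, mean_partial P asymmetry = m%:~R.
Proof.
have [Q hQ] := asymmetry_moment; exists (- Q).
have P0 : (P%:R : C) != 0 by rewrite pnatr_eq0.
suff h : \sum_(i < P) partial_sums asymmetry i.+1 = - (P%:Z * Q)%:~R.
  by rewrite /mean_partial h intrM mulrN mulKf // rmorphN.
(* The term A_i occurs in N - i of the partial sums. Since the total sum is zero, the mean of the
   partial sums is minus the first moment divided by P. *)
have h N (A : nat -> int) : \sum_(i < N) \sum_(j < i.+1) A j =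
    N%:Z * (\sum_(i < N) A i) + \sum_(i < N) A i - \sum_(i < N) i.+1%:Z * A i.
  elim: N => [|N IH]; first by rewrite !big_ord0 mul0r subr0 addr0.
  rewrite big_ord_recr IH !(big_ord_recr N) /= -addn1 PoszD; ring.
transitivity ((\sum_(i < P) \sum_(j < i.+1) asymmetry_int j)%:~R : C).
  by rewrite rmorph_sum; apply: eq_bigr => i _; rewrite rmorph_sum.
by rewrite h asymmetry_sum mulr0 !add0r hQ rmorphN.
Qed.

End Asymmetry.

(** * The eta function *)

Section UnorderedSums.
Variable R : realType.
Local Notation C := R[i].
Implicit Types (J T : {fset R}).

Lemma sum_fsetD (V : nmodType) (F : R -> V) T J : (T `<=` J)%fset ->
  \sum_(x <- J) F x = \sum_(x <- T) F x + \sum_(x <- (J `\` T)%fset) F x.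
Proof.
move=> TJ; rewrite -big_cat; apply: perm_big; apply: uniq_perm; rewrite ?fset_uniq //.
  rewrite cat_uniq !fset_uniq andbT; by apply/hasPn => x /=; rewrite in_fsetD => /andP[].
move=> x; rewrite mem_cat in_fsetD; case: (boolP (x \in T)) => xT //=.
exact: (fsubsetP TJ).
Qed.

Lemma unordered_limit (t : R -> C^o) (S : C) :
  (exists K : R, forall J, \sum_(x <- J) norm1 (t x) <= K) ->
  (forall J0 (e : R), 0 < e -> exists2 T, (J0 `<=` T)%fset & norm1 (\sum_(x <- T) t x - S) <= e) ->
  summability.partial_sum t @ summability.totally --> (S : C^o).
Proof.
move=> [K hK] hT; have PF := @summability.totally_filter R.
apply/cvgrPdist_le => /= e e0.
have [eI eR] : complex.Im e = 0 /\ 0 < complex.Re e by move: e0; rewrite ltcE /= => /andP[/eqP].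
have {eI} eE : e = (complex.Re e)%:C by case: e eI {e0 eR} => ? ? /= ->.
move: (complex.Re e) eR eE => er er0 ->.
(* Beyond a finite set whose absolute sum is within er / 2 of the supremum, further terms add at
   most er / 2. A suitable set [T] above it therefore controls all larger sets. *)
pose A : set R := [set y | exists J, y = \sum_(x <- J) norm1 (t x)].
have sA : has_sup A.
  by split; [exists (\sum_(x <- fset0) norm1 (t x)), fset0 | exists K => y [J ->]].
have e20 : 0 < er / 2 by rewrite divr_gt0.
have [y [J0 ->] hJ0] := sup_adherent e20 sA.
have [T J0T hTS] := hT J0 _ e20.
exists T => // J /= TJ; rewrite /summability.partial_sum -(big_seq_fsetE _ J xpredT).
apply: le_trans (norm_le_norm1 _) _; rewrite lecR -norm1N opprB.
rewrite (sum_fsetD _ TJ) addrAC; apply: le_trans (norm1D _ _) _.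
have h1 : norm1 (\sum_(x <- (J `\` T)%fset) t x) <= er / 2.
  apply: le_trans (norm1_sum _ _) _.
  have hJ : \sum_(x <- J) norm1 (t x) <= sup A by apply: ub_le_sup; [exact: sA.2 | exists J].
  have hT0 : \sum_(x <- J0) norm1 (t x) <= \sum_(x <- T) norm1 (t x).
    by rewrite (sum_fsetD _ J0T) lerDl sumr_ge0 // => x _; exact: norm1_ge0.
  by move: hJ; rewrite (sum_fsetD _ TJ); lra.
by apply: le_trans (lerD hTS h1) _; lra.
Qed.

Lemma sum_odd_sym (F : R -> C) (T : {fset R}) : (forall x, F (- x) = - F x) ->
  (forall x, (- x \in T) = (x \in T)) -> \sum_(x <- T) F x = 0.
Proof.
move=> Fo Ts; have two : (2 : C) != 0 by rewrite pnatr_eq0.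
apply: (mulfI two); rewrite mulr0 mulr_natl mulr2n -[X in X + _](_ : \sum_(x <- map -%R T) F x = _).
  by rewrite big_map -big_split /= big1 // => x _; rewrite Fo addNr.
apply: perm_big; apply: uniq_perm; rewrite ?(map_inj_uniq oppr_inj) ?fset_uniq //.
move=> x; rewrite -(Ts x); apply/mapP/idP => [[y yT ->]|xT]; first by rewrite opprK.
by exists (- x) => //; rewrite opprK.
Qed.

End UnorderedSums.

(** * Summability over the dual lattice *)

Section MultiplicityBound.
Variables (R : realType) (k : nat) (B E : 'M[R]_k.*2.+1).
Local Notation n := k.*2.+1.
Hypotheses (B_unit : B \in unitmx) (E_unit : E \in unitmx).
Variable level : R -> seq 'rV[int]_n.
Hypothesis level_uniq : forall L, uniq (level L).
Hypothesis levelE : forall L m, (m \in level L) = (freq_sqr B E m == L).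
Local Notation fs := (freq_sqr B E).

(* Summable over the dual lattice, with sum at most [5 ^ n]; by [coefficient_bound] it dominates
   an inverse power of the squared frequency. *)
Definition lattice_weight (m : 'rV[int]_n) : R := \prod_j (1 + (m 0 j)%:~R ^+ 2)^-1.

(** Passing from N to N + 1 adds the two terms at N + 1 and - (N + 1), and 2 / (1 + x^2) <= 4 / x -
    4 / (x + 1) for x >= 1. *)
Lemma sum_line_weight N : \sum_(i < N.*2.+1) (1 + ((i%:Z - N%:Z)%:~R : R) ^+ 2)^-1 <= 5 - 4 / N.+1%:R.
Proof.
elim: N => [|N IH].
  by rewrite big_ord_recl big_ord0 subrr expr0n !addr0 divr1 invr1; lra.
rewrite doubleS big_ord_recl big_ord_recr /=.
have -> : \sum_(i < N.*2.+1) (1 + (((bump 0 i)%:Z - N.+1%:Z)%:~R : R) ^+ 2)^-1 =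
    \sum_(i < N.*2.+1) (1 + ((i%:Z - N%:Z)%:~R : R) ^+ 2)^-1.
  by apply: eq_bigr => i _; congr ((1 + _%:~R ^+ 2)^-1); rewrite /bump /=; lia.
have -> : (0%:Z - N.+1%:Z)%:~R = - N.+1%:R :> R by rewrite sub0r mulrNz.
have -> : ((bump 0 N.*2.+1)%:Z - N.+1%:Z)%:~R = N.+1%:R :> R.
  by rewrite (_ : _ - _ = N.+1%:Z) // /bump /=; lia.
rewrite sqrrN.
have -> : N.+2%:R = N.+1%:R + 1 :> R by rewrite natr1.
have x1 : 1 <= N.+1%:R :> R by rewrite ler1n.
move: (N.+1%:R : R) x1 IH => x x1 IH; have x0 : 0 < x by lra.
have x20 : 0 < 1 + x ^+ 2 by rewrite ltr_pwDl // sqr_ge0.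
have step : (1 + x ^+ 2)^-1 + (1 + x ^+ 2)^-1 <= 4 / x - 4 / (x + 1).
  rewrite -subr_ge0.
  have -> : 4 / x - 4 / (x + 1) - ((1 + x ^+ 2)^-1 + (1 + x ^+ 2)^-1) =
     2 * ((x - 1) * x + 2) / (x * (x + 1) * (1 + x ^+ 2)).
    by field; rewrite !gt_eqF //; lra.
  by rewrite divr_ge0 ?mulr_ge0 ?addr_ge0 ?mulr_ge0 ?(ltW x20) //; lra.
by move: step IH; move: (_^-1) (\sum_(i < _) _) (4 / x) (4 / (x + 1)) => u v p q; lra.
Qed.

Lemma sum_box_weight N : \sum_(m <- box k N) lattice_weight m <= 5 ^+ n.
Proof.
rewrite /box big_map big_enum /=.
rewrite (eq_bigr (fun f : {ffun 'I_n -> 'I_(N.*2.+1)} =>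
    \prod_j (1 + (((f j : nat)%:Z - N%:Z)%:~R : R) ^+ 2)^-1)) => [|f _]; last first.
  by apply: eq_bigr => j _; rewrite mxE.
rewrite -(bigA_distr_bigA (fun (j : 'I_n) (i : 'I_(N.*2.+1)) => (1 + ((i%:Z - N%:Z)%:~R : R) ^+ 2)^-1)) /=.
rewrite prodr_const card_ord lerXn2r ?nnegrE //.
  by apply: sumr_ge0 => i _; rewrite invr_ge0 addr_ge0 // sqr_ge0.
by apply: le_trans (sum_line_weight N) _; rewrite lerBlDr lerDl divr_ge0.
Qed.

Lemma lattice_weight_ge0 m : 0 <= lattice_weight m.
Proof. by apply: prodr_ge0 => j _; rewrite invr_ge0 addr_ge0 // sqr_ge0. Qed.

Lemma count_square_roots (J : seq R) (c : R) : uniq J -> (count (fun x => x ^+ 2 == c) J <= 2)%N.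
Proof.
move=> uJ; rewrite -size_filter.
have [x0|nx] := pselect (exists x0, x0 ^+ 2 = c); last first.
  rewrite (eq_filter (a2 := pred0)) ?filter_pred0 // => x.
  by apply/negbTE/eqP => h; apply: nx; exists x.
have [x hx] := x0.
apply: (@leq_trans (size [:: x; - x])) => //; apply: uniq_leq_size; first exact: filter_uniq.
by move=> y; rewrite mem_filter -hx eqf_sqr !inE => /andP[].
Qed.

(** A finite box contains all levels involved. A frequency m belongs to the levels of at most two x,
    the square roots of [fs m], whence the factor 2. *)
Lemma sum_levels (J : {fset R}) :
  \sum_(x <- J) \sum_(m <- level (x ^+ 2)) lattice_weight m <= 2 * 5 ^+ n.
Proof.
have [N hN] : exists N : nat, forall x, x \in (J : seq R) -> forall m,
  m \in level (x ^+ 2) -> forall j, `|m 0 j| <= N%:Z.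
  elim: (J : seq R) => [|x r [N hN]]; first by exists 0%N.
  exists (N + \sum_(m <- level (x ^+ 2)) \sum_(j < n) `|m 0%R j|)%N => y;
    rewrite inE => /predU1P[->|yr] m my j.
    rewrite -abszE lez_nat; apply: leq_trans (leq_addl _ _).
    by rewrite (big_rem m) //= (bigD1 j) //= -!addnA leq_addr.
  by apply: le_trans (hN y yr m my j) _; rewrite lez_nat leq_addr.
have E1 x : x \in (J : seq R) -> \sum_(m <- level (x ^+ 2)) lattice_weight m =
    \sum_(m <- box k N | x ^+ 2 == fs m) lattice_weight m.
  move=> xJ; rewrite -[RHS]big_filter; apply: perm_big; apply: uniq_perm; rewrite ?filter_uniq ?box_uniq //.
  move=> m; rewrite mem_filter levelE [fs m == _]eq_sym; case: eqP => //= e1.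
  by apply/esym/mem_box => j; apply: (hN x xJ); rewrite levelE -e1.
rewrite (eq_big_seq _ E1); under eq_bigr do rewrite big_mkcond.
rewrite exchange_big /=.
apply: le_trans (_ : \sum_(m <- box k N) 2 * lattice_weight m <= _); last first.
  by rewrite -mulr_sumr ler_pM2l // sum_box_weight.
apply: ler_sum => m _; rewrite -big_mkcond /= big_const_seq iter_addr_0 -[leLHS]mulr_natl.
by rewrite ler_wpM2r ?lattice_weight_ge0 // ler_nat count_square_roots ?fset_uniq.
Qed.

(** For m nonzero K [fs m] is at least 1 and at least each m_j^2, so each of the n factors 1 + m_j^2
    is at most 2 K [fs m]. *)
Lemma freq_sqr_power_bound : exists2 K : R, 0 <= K & forall m,
  m != 0 -> (fs m ^+ n)^-1 <= K * lattice_weight m.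
Proof.
have [K K0 hK] := coefficient_bound B_unit E_unit.
exists ((2 * K) ^+ n); first by rewrite exprn_ge0 // mulr_ge0 // ltW.
move=> m m0; have f0 := freq_sqr_gt0 B_unit E_unit m0.
have Kf1 : 1 <= K * fs m.
  have [j mj] : exists j, m 0 j != 0.
    apply: contrapT => nh; case/eqP: m0; apply/rowP => j; rewrite mxE.
    by apply/eqP/negPn/negP => mj; apply: nh; exists j.
  apply: le_trans (hK m j); rewrite -rmorphXn ler1z.
  by rewrite -gtz0_ge1 exprn_even_gt0 // mj.
have h : \prod_j (1 + (m 0 j)%:~R ^+ 2) <= (2 * K * fs m) ^+ n :> R.
  rewrite -[n in leRHS]card_ord -prodr_const; apply: ler_prod => j _.
  rewrite addr_ge0 ?sqr_ge0 //=; have := hK m j.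
  by rewrite -mulrA; move: (_ ^+ 2) (K * _) Kf1 => u v; lra.
rewrite /lattice_weight prodfV; have p0 : 0 < \prod_j (1 + (m 0 j)%:~R ^+ 2) :> R.
  by apply: prodr_gt0 => j _; rewrite ltr_pwDl // sqr_ge0.
by rewrite lter_pdivlMr // mulrC ler_pdivrMr ?exprn_gt0 // -exprMn.
Qed.

End MultiplicityBound.

Lemma freq_sqr0 (R : realType) (k : nat) (B E : 'M[R]_k.*2.+1) : freq_sqr B E 0 = 0.
Proof.
rewrite /freq_sqr big1 // => i _; rewrite /freq big1 ?expr0n // => j _.
have -> : (0 : 'rV[int]_k.*2.+1) 0 j = 0 by rewrite mxE.
by rewrite !mulr0.
Qed.

Section EtaFunction.
Variables (R : realType) (k : nat) (M : FCHD R k) (s : bool).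
Variable h : ('rV[R]_k.*2.+1 -> 'rV[R]_k.*2.+1) -> clifford R k.*2.+1.
Hypotheses (h_spin : spin_structure M s h) (k_gt1 : (1 < k)%N).
Local Notation n := k.*2.+1.
Local Notation C := R[i].
Local Notation fs := (freq_sqr (lattice M) (frame M)).
Variable level : R -> seq 'rV[int]_n.
Hypothesis level_uniq : forall L, uniq (level L).
Hypothesis levelE : forall L m, (m \in level L) = (fs m == L).
Variable rho : R -> nat.
Hypothesis rhoP : forall L, 0 < L -> forall lam, lam ^+ 2 = L ->
  eigen_mult M h lam (vertical_mult k s lam + rho L) /\
  (vertical_mult k s lam + rho L <= size (level L) * 2 ^ k)%N.

Definition dirac_mult (lam : R) : nat := (vertical_mult k s lam + rho (lam ^+ 2))%N.

Lemma dirac_mult_eigen lam : lam != 0 -> eigen_mult M h lam (dirac_mult lam).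
Proof. by move=> l0; apply: (rhoP _ (erefl _)).1; rewrite exprn_even_gt0. Qed.

Lemma dirac_mult_le lam : lam != 0 -> (dirac_mult lam <= size (level (lam ^+ 2)) * 2 ^ k)%N.
Proof. by move=> l0; apply: (rhoP _ (erefl _)).2; rewrite exprn_even_gt0. Qed.

Lemma spectral_gap : exists2 c : R, 0 < c &
  forall lam, lam != 0 -> dirac_mult lam != 0%N -> c <= `|lam|.
Proof.
have [K K0 hK] := coefficient_bound (lattice_unit M) (frame_unit M).
exists (Num.sqrt K^-1) => [|lam l0 m0]; first by rewrite sqrtr_gt0 invr_gt0.
have [m ml] : exists m, m \in level (lam ^+ 2).
  have := dirac_mult_le l0; case: (level _) => [|m r _]; last by exists m; rewrite inE eqxx.
  by rewrite mul0n leqn0 (negPf m0).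
have fm : fs m = lam ^+ 2 by apply/eqP; rewrite -levelE.
have [j mj] : exists j, m 0 j != 0.
  apply: contrapT => nh; have m0' : m = 0.
    apply/rowP => j; rewrite mxE; apply/eqP/negPn/negP => mj; apply: nh; exists j.
    by [].
  by move/eqP: fm; rewrite m0' freq_sqr0 eq_sym sqrf_eq0 (negPf l0).
rewrite -sqrtr_sqr ler_wsqrtr // -fm -div1r ler_pdivrMr // mulrC.
apply: le_trans (hK m j); rewrite -rmorphXn ler1z.
by rewrite -gtz0_ge1 exprn_even_gt0 // mj.
Qed.

Lemma norm1_cpow (t : R) (z : C) : norm1 (cpow t z) <= 2 * expR (complex.Re z * ln t).
Proof.
apply: le_trans (norm1_cexp _) _; case: z => x y /=.
by rewrite mulr0 subr0.
Qed.

(** The power is split as |lam|^(- (Re z - 2n)) times (lam^2)^(- n): the spectral gap bounds the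
    first factor, the second is summed over the level, whose size bounds the multiplicity up to
    2^k. *)
Lemma eta_term_bound (z : C) : n.*2%:R <= complex.Re z -> exists2 K : R, 0 <= K &
  forall lam, norm1 (eta_term dirac_mult z lam) <=
    K * \sum_(m <- level (lam ^+ 2)) lattice_weight R m.
Proof.
move=> zn; have [c c0 hc] := spectral_gap.
have [D D0 hD] := freq_sqr_power_bound (lattice_unit M) (frame_unit M).
pose K := (2 ^ k)%:R * (2 * expR (- (complex.Re z - n.*2%:R) * ln c)) * D.
have K0 : 0 <= K by rewrite !mulr_ge0 ?expR_ge0.
exists K => // lam; have W0 : 0 <= \sum_(m <- level (lam ^+ 2)) lattice_weight R m.
  by apply: sumr_ge0 => m _; exact: lattice_weight_ge0.
rewrite /eta_term; case: eqP => [_|/eqP l0]; first by rewrite norm1_0 mulr_ge0.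
have [->|m0] := eqVneq (dirac_mult lam) 0%N; first by rewrite !mul0r norm1_0 mulr_ge0.
have cl := hc _ l0 m0; have al : 0 < `|lam| by rewrite normr_gt0.
apply: le_trans (norm1M _ _) _; apply: le_trans (ler_wpM2r (norm1_ge0 _) (norm1M _ _)) _.
have -> : norm1 (dirac_mult lam)%:R = (dirac_mult lam)%:R :> R.
  by rewrite -(rmorph_nat (real_complex R)) norm1_real ger0_norm.
have -> : norm1 (Num.sg lam)%:C = 1 by rewrite norm1_real normr_sg l0.
rewrite mulr1.
have e1 : norm1 (cpow `|lam| (- z)) <= 2 * expR (- (complex.Re z - n.*2%:R) * ln c) * ((lam ^+ 2) ^+ n)^-1.
  apply: le_trans (norm1_cpow _ _) _; rewrite -mulrA ler_pM2l //.
  have -> : ((lam ^+ 2) ^+ n)^-1 = expR (- n.*2%:R * ln `|lam|).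
    rewrite mulNr expRN expRM_natl lnK ?posrE // -exprM mul2n; congr (_^-1).
    by rewrite -mul2n !exprM real_normK ?num_real.
  rewrite -expRD ler_expR; have lncl : ln c <= ln `|lam| by rewrite ler_ln ?posrE.
  have -> : complex.Re (- z) = - complex.Re z by case: (z).
  move: lncl zn; move: (n.*2%:R : R) (complex.Re z) (ln c) (ln `|lam|) => p q u v uv pq.
  by rewrite -subr_ge0; have := mulr_ge0 (_ : 0 <= q - p) (_ : 0 <= v - u);
    rewrite !subr_ge0 => /(_ pq uv); lra.
have e2 : (size (level (lam ^+ 2)))%:R * ((lam ^+ 2) ^+ n)^-1 <=
  D * \sum_(m <- level (lam ^+ 2)) lattice_weight R m.
  have -> : (size (level (lam ^+ 2)))%:R * ((lam ^+ 2) ^+ n)^-1 =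
    \sum_(m <- level (lam ^+ 2)) ((lam ^+ 2) ^+ n)^-1.
    by rewrite big_const_seq count_predT iter_addr_0 mulr_natl.
  rewrite mulr_sumr !big_seq; apply: ler_sum => m; rewrite levelE => /eqP fm; rewrite -fm; apply: hD.
  by apply: contraNneq l0 => m0'; rewrite -sqrf_eq0 -fm m0' freq_sqr0.
have e3 : (dirac_mult lam)%:R <= (2 ^ k)%:R * (size (level (lam ^+ 2)))%:R :> R.
  by rewrite -natrM ler_nat mulnC dirac_mult_le.
have e0 : 0 <= ((lam ^+ 2) ^+ n)^-1 by rewrite invr_ge0 exprn_ge0 // sqr_ge0.
apply: le_trans (ler_pM _ (norm1_ge0 _) e3 e1) _ => //.
rewrite /K; move: (expR _) (expR_ge0 (- (complex.Re z - n.*2%:R) * ln c)) e2 => x x0 e2.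
rewrite (_ : _ * _ * (2 * x * _) = (2 ^ k)%:R * (2 * x) * ((size (level (lam ^+ 2)))%:R * ((lam ^+ 2)
  ^+ n)^-1)); last by ring.
by rewrite -[leRHS]mulrA ler_wpM2l // !mulr_ge0.
Qed.

Lemma eta_term_summable (z : C) : n.*2%:R <= complex.Re z ->
  exists K : R, forall J : {fset R}, \sum_(x <- J) norm1 (eta_term dirac_mult z x) <= K.
Proof.
move=> zn; have [K K0 hK] := eta_term_bound zn.
exists (K * (2 * 5 ^+ n)) => J; apply: le_trans (ler_sum _ (fun x _ => hK x)) _.
by rewrite -mulr_sumr ler_wpM2l // (sum_levels (lattice_unit M) (frame_unit M) level_uniq levelE).
Qed.

Definition even_term (z : C) (lam : R) : C :=
  if lam == 0 then 0 else (rho (lam ^+ 2))%:R * (Num.sg lam)%:C * cpow `|lam| (- z).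
Definition vertical_term (z : C) (lam : R) : C :=
  if lam == 0 then 0 else (vertical_mult k s lam)%:R * (Num.sg lam)%:C * cpow `|lam| (- z).

Lemma eta_term_split z lam : eta_term dirac_mult z lam = vertical_term z lam + even_term z lam.
Proof.
rewrite /eta_term /vertical_term /even_term; case: eqP => _; first by rewrite addr0.
by rewrite natrD !mulrDl.
Qed.

Lemma even_term_odd z lam : even_term z (- lam) = - even_term z lam.
Proof.
rewrite /even_term oppr_eq0; case: eqP => _; first by rewrite oppr0.
by rewrite sqrrN normrN sgrN rmorphN mulrN mulNr.
Qed.

Lemma vertical_term_pair z i :
  vertical_term z (pi * i.+1%:R) + vertical_term z (- (pi * i.+1%:R)) =
  asymmetry R k s i * cpow (pi * i.+1%:R) (- z).
Proof.
have p0 : 0 < pi * i.+1%:R :> R by rewrite mulr_gt0 ?pi_gt0.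
rewrite /vertical_term oppr_eq0 gt_eqF // sgrN normrN gtr0_sg // gtr0_norm //.
rewrite rmorphN mulrN !mulr1 mulNr -mulrBl; congr (_ * _).
rewrite /asymmetry /asymmetry_int intrB -!(vertical_multE k s R); congr (_ - _).
by rewrite mulrNz mulrN.
Qed.

Lemma vertical_term_support z lam : vertical_term z lam != 0 ->
  exists i : nat, lam = pi * i.+1%:R \/ lam = - (pi * i.+1%:R).
Proof.
rewrite /vertical_term; case: (eqVneq lam 0) => [_|l0]; first by rewrite eqxx.
have [->|m0] := eqVneq (vertical_mult k s lam) 0%N; first by rewrite !mul0r eqxx.
have [l lE] := vertical_mult_support m0; rewrite lE in l0 *; move=> _.
case: l {lE m0} l0 => [[|i]|i] l0; [by rewrite mulr0 eqxx in l0 | by exists i; left |].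
by exists i; right; rewrite NegzE mulrNz mulrN.
Qed.

Definition vertical_set (N : nat) : seq R :=
  [seq pi * i.+1%:R | i <- iota 0 N] ++ [seq - (pi * i.+1%:R) | i <- iota 0 N].

Lemma vertical_set_uniq N : uniq (vertical_set N).
Proof.
have p0 : (pi : R) != 0 by rewrite gt_eqF ?pi_gt0.
have inj : injective (fun i : nat => pi * i.+1%:R : R).
  by move=> i j /(mulfI p0) /eqP; rewrite eqr_nat => /eqP [].
rewrite cat_uniq !map_inj_uniq ?iota_uniq //; last by move=> i j /oppr_inj /inj.
rewrite andbT /=; apply/hasPn => x /mapP[i _ ->]; apply/mapP => -[j _].
have q (r : nat) : 0 < pi * r.+1%:R :> R by rewrite mulr_gt0 ?pi_gt0.
by have := q i; have := q j; move: (pi * _) (pi * _) => u v; lra.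
Qed.

Lemma sum_vertical_set z N : \sum_(x <- vertical_set N) vertical_term z x =
  \sum_(i < N) asymmetry R k s i * cpow (pi * i.+1%:R) (- z).
Proof.
rewrite big_cat /= !big_map -big_split /= -[RHS](big_mkord xpredT (fun i =>
  asymmetry R k s i * cpow (pi * i.+1%:R) (- z))) /index_iota subn0.
by apply: eq_bigr => i _; rewrite vertical_term_pair.
Qed.

(** [T] is J0, its mirror image and the vertical set: being symmetric it cancels the common
    multiplicities, and its vertical part gives exactly a partial sum of the asymmetry series. *)
Lemma symmetric_exhaustion z (J0 : {fset R}) : exists N0 : nat, forall N, (N0 <= N)%N ->
  exists2 T : {fset R}, (J0 `<=` T)%fset & \sum_(x <- T) eta_term dirac_mult z x =
    \sum_(i < N) asymmetry R k s i * cpow (pi * i.+1%:R) (- z).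
Proof.
have [N0 hN0] : exists N0 : nat, forall x, x \in (J0 : seq R) -> `|x| < N0%:R.
  elim: (J0 : seq R) => [|x r [N hN]]; first by exists 0%N.
  exists (N + (`|Num.ceil `|x| |%N).+1)%N => y; rewrite inE => /predU1P[->|/hN yN].
    rewrite natrD; apply: ltr_wpDl => //; apply: le_lt_trans (ceil_ge _) _.
    by rewrite -natr1 natr_absz ltr_pwDr // ler_int ler_norm.
  by rewrite natrD; apply: lt_le_trans yN _; rewrite lerDl.
exists N0 => N NN.
pose T := [fset x in (J0 : seq R) ++ map -%R (J0 : seq R) ++ vertical_set N]%fset.
have inT x : (x \in T) = [|| x \in J0, - x \in J0 | x \in vertical_set N].
  have -> : (- x \in J0) = (x \in map -%R (J0 : seq R)).
    by apply/idP/mapP => [xJ|[y yJ ->]]; [exists (- x); rewrite ?opprK | rewrite opprK].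
  by rewrite in_fset /= !mem_cat.
have VN x : (- x \in vertical_set N) = (x \in vertical_set N).
  rewrite !mem_cat orbC; congr (_ || _).
    by apply/mapP/mapP => -[i iN e]; exists i => //; [exact: oppr_inj | rewrite e].
  by apply/mapP/mapP => -[i iN e]; exists i => //; [rewrite -e opprK | rewrite e opprK].
exists T; first by apply/fsubsetP => x xJ; rewrite inT xJ.
under eq_bigr do rewrite eta_term_split.
rewrite big_split /= [X in _ + X](sum_odd_sym (even_term_odd z)) ?addr0; last first.
  by move=> x; rewrite !inT opprK VN orbCA.
rewrite -sum_vertical_set [LHS](bigID (fun x => x \in vertical_set N)) /= [X in _ + X]big1_seq ?addr0.
  rewrite -big_filter; apply: perm_big; apply: uniq_perm; rewrite ?filter_uniq ?fset_uniq
    ?vertical_set_uniq //.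
  by move=> x; rewrite mem_filter inT; case: (x \in vertical_set N); rewrite ?orbT ?andbF.
(* Such an x would satisfy |x| = pi (i + 1) < N0 <= N, hence i < N, and would already lie in the
   vertical set. *)
move=> x /andP[xV]; rewrite inT (negPf xV) orbF => xJ; apply/eqP/negPn/negP => /vertical_term_support[i xi].
have xN : `|x| < N0%:R by case/orP: xJ => /hN0 //; rewrite normrN.
have ax : `|x| = pi * i.+1%:R.
  by case: xi => ->; rewrite ?normrN gtr0_norm // mulr_gt0 ?pi_gt0.
have iN : (i < N)%N.
  apply: leq_trans NN; rewrite -(ltr_nat R); apply: lt_trans xN; rewrite ax.
  apply: lt_le_trans (_ : i.+1%:R <= _); first by rewrite ltr_nat.
  by rewrite ler_peMl // (le_trans _ (pi_ge2 _)) // ler1n.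
case/negP: xV; rewrite mem_cat; case: xi => ->; [apply/orP; left | apply/orP; right];
by apply/mapP; exists i; rewrite // mem_iota.
Qed.

Lemma eta_invariant_integer : exists m : int, is_eta_invariant M h (m%:~R).
Proof.
have P0 : (0 < n.*2)%N by [].
have sum0 : \sum_(i < n.*2) asymmetry R k s i = 0.
  by rewrite /asymmetry -rmorph_sum asymmetry_sum.
have pi1 : 1 <= pi :> R by rewrite (le_trans _ (pi_ge2 _)) // ler1n.
have [f hf] := continuation_exists pi1 P0 (@asymmetry_per R k s) sum0.
have [m hm] := asymmetry_mean R s k_gt1.
have df z : derivable (f : C^o -> C^o) z 1.
  have [d [K [K0 hK]]] := continuation_quadratic pi1 P0 (@asymmetry_per R k s) sum0 hf z.
  exact: quadratic_derivable K0 hK.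
have holo p : holomorphic_near f p by exact: (@filterE C^o (nbhs (p : C^o)) _ _ df).
exists m, f; split; [|exact: holo|by rewrite (continuation0 hf)].
exists dirac_mult; split; first exact: dirac_mult_eigen.
(* 4 makes the continuation agree with the series, 2n gives absolute summability. *)
- exists (Num.max 4 n.*2%:R) => z; rewrite gt_max => /andP[/ltW z4 /ltW zn].
  apply: unordered_limit; first exact: eta_term_summable.
  move=> J0 e e0; have [N0 hN] := symmetric_exhaustion z J0.
  have [K hK] := continuation_series hf z4.
  pose N := maxn N0 `|Num.ceil (`|K| / e)|%N.
  have [T JT hT] := hN N (leq_maxl _ _); exists T => //; rewrite hT.
  apply: le_trans (hK N) _; rewrite ler_pdivrMr // mulrC -ler_pdivrMr //.
  have le1 : K / e <= `|K| / e by rewrite ler_pM2r ?invr_gt0 // ler_norm.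
  apply: le_trans le1 _; apply: le_trans (ceil_ge _) _.
  apply: le_trans (_ : `|Num.ceil (`|K| / e)|%N%:R <= _).
    by rewrite natr_absz ler_int ler_norm.
  by rewrite ler_nat (leq_trans (leq_maxr N0 _)) // leqnSn.
- by move=> p; exists 0%N, f; split; [exact: holo | apply: (@filterE C^o ((p : C^o)^')) => z;
  rewrite expr0 mulr1].
Qed.

End EtaFunction.

Theorem corollary1 (R : realType) (n k : nat) (n_prime : prime n)
    (n_gt3 : (3 < n)%N) (n1_div4 : (4 %| n.+1)%N) (n_odd : n = k.*2.+1)
    (M : FCHD R k) (s : bool)
    (h : ('rV[R]_k.*2.+1 -> 'rV[R]_k.*2.+1) -> clifford R k.*2.+1)
    (h_spin : spin_structure M s h) :
  exists m : int, is_eta_invariant M h (m%:~R).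
Proof.
(* This bound makes the residues p_sg sum to zero. *)
have k_gt1 : (1 < k)%N by lia.
have lev L : exists l : seq 'rV[int]_k.*2.+1, uniq l /\
    forall m, (m \in l) = (freq_sqr (lattice M) (frame M) m == L).
  by have [l ul hl] := freq_level_finite (lattice_unit M) (frame_unit M) L; exists l.
have [level hlev] := choice lev.
have hr L : exists r : nat, 0 < L -> forall lam, lam ^+ 2 = L ->
    eigen_mult M h lam (vertical_mult k s lam + r) /\
    (vertical_mult k s lam + r <= size (level L) * 2 ^ k)%N.
  have [L0|nL0] := pselect (0 < L); last by exists 0%N.
  have [r rP] := level_mult h_spin (ltnW k_gt1) L0 (hlev L).1 (hlev L).2.
  by exists r.
have [rho rhoP] := choice hr.
exact: (eta_invariant_integer k_gt1 (fun L => (hlev L).1) (fun L => (hlev L).2) rhoP).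
Qed.
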